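(* Let $\alpha>0$, let $\Omega$ be a domain of $\mathbb{R}^N$ (possibly $\Omega=\mathbb{R}^N$) and $\delta>0$ with $\{|x|<\delta\}\subset\Omega$. Let $T_0>0$, $A_1\ge0$ and let $U:(0,T_0)\times\Omega\to\mathbb{R}$ be $C^2$ in $x$ and $C^1$ in $t$ and satisfy $$U_t-\Delta U=|U|^\alpha U\ \text{ in }(0,T_0)\times\Omega,$$ $$|U(t,x)|^\alpha\le A_1\min\{t^{-1},|x|^{-2}\}\ \text{ in }(0,T_0)\times\Omega,$$ $$|\nabla U(t,x)|^\alpha\le A_1\ \text{ in }(0,T_0)\times(\Omega\cap\{|x|>\delta\}).$$ Let $\Psi\in C^2(\mathbb{R}^N)\cap W^{2,\infty}(\mathbb{R}^N)$ with $0\le\Psi\le1$ and $\Psi(x)=1$ on $\{|x|<\delta\}$, and let $w_0\in L^\infty(\Omega)$ with $w_0(x)=0$ a.e. on $\{|x|<\delta\}$. Define $$\mathcal{M}w=2\nabla U\cdot\nabla\Psi+U\Delta\Psi+|\Psi U+w|^\alpha(\Psi U+w)-\Psi|U|^\alpha U.$$ Then there exist $T\in(0,T_0]$ and $w\in L^\infty((0,T)\times\Omega)$ such that the following properties hold. (i) $\mathcal{M}w\in L^\infty((0,T)\times\Omega)$. (ii) $w$ is a solution of the equation $$w(t,x)=\int_\Omega G_\Omega(t,x,y)w_0(y)\,dy+\int_0^t\int_\Omega G_\Omega(t-s,x,y)\,\mathcal{M}w(s,y)\,dy\,ds ,\qquad (t,x)\in(0,T)\times\Omega.$$ Moreover,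 $w$ is the unique solution of this equation in the class $$\mathcal{E}=\{w\in L^\infty((0,T)\times\Omega);\ |w|\le\Theta\},$$ where $\Theta$ is the function with parameters $K,m$ defined in the context, $K=2\|w_0\|_{L^\infty}$, and, with $A$ the constant described in the context and $B=(1+K^{\alpha+1})A$, the integer $m\ge2$ and the number $T\le\frac14$ satisfy $$\frac4m\le\frac{K}{4B},$$ $$2^{\frac N2}e^{-\frac{a_1^2}{8t}}\le\tfrac12t^{\frac m2}\ \text{ for all }0<t\le T,$$ $$T^{\frac12}(1+a_m^{-2})\le\frac{K}{4B},$$ $$m2^{\frac N2}(1+a_m^{-2})(1+t^{\frac{m+1}{2}})e^{-\frac{a_{m+1}^2}{8t}}\le\frac{K}{4B}t^{\frac m2}\ \text{ for all }0<t\le T.$$ (iii) There is a constant $C$ such that $\|w(t)-e^{t\Delta_\Omega}w_0\|_{L^\infty}\le Ct$ for $0<t<T$.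
   Context: $e^{t\Delta_\Omega}$ is the Dirichlet heat semigroup on $\Omega$ and $G_\Omega(t,x,y)$ its heat kernel; $e^{t\Delta_\Omega}v(x)=\int_\Omega G_\Omega(t,x,y)v(y)\,dy$. Fix a nondecreasing $\theta\in C^\infty(\mathbb{R},\mathbb{R})$ with $\theta(s)=0$ for $s\le1$ and $\theta(s)=1$ for $s\ge2$. For $j\ge0$ let $a_j=2^{-j}\delta$ and $\chi_j(x)=\theta(|x|/a_j)$, $x\in\mathbb{R}^N$. For given $K$ and an integer $m\ge2$ set $$\Theta(t,x)=K\Bigl(t^{\frac m2}+\sum_{j=1}^mt^{\frac{j-1}{2}}\chi_j(x)\Bigr),\qquad h(t,x)=(|x|^{-2}+1)\sum_{j=1}^mt^{\frac{j-1}{2}}\chi_j(x)+(1+t)t^{\frac{m-2}{2}}.$$ $A$ denotes a constant, which exists under the stated hypotheses on $\Omega,\delta,U,\Psi$ and is independent of $T,m,K,w,z$, such that for every $K>0$, every integer $m\ge2$, every $0<T\le\min\{\frac14,T_0\}$ and all $w,z\in L^\infty((0,T)\times\Omega)$ with $|w|\le\Theta$ and $|z|\le\Theta$ one has, on $(0,T)\times\Omega$, $|\mathcal{M}w|\le A(1+K^{\alpha+1})h$ and $|\mathcal{M}w-\mathcal{M}z|\le A(1+K^{\alpha+1})\bigl|\frac{w-z}{\Theta}\bigr|h$.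
   Formalization: The ''Moreover'' part (class 𝓔, conditions on m and T, uniqueness) is stated only when w_0 is not a.e. zero: for w_0=0 one has K=0 and 4/m ≤ K/(4B) cannot hold. Existence of T and w, (i), the equation and (iii) also cover w_0=0. *)

(* Defs.v *)
From HB Require Import structures.
From mathcomp Require Import all_boot all_order all_algebra.
From mathcomp Require Import all_classical all_reals all_analysis.

Set Implicit Arguments.
Unset Strict Implicit.
Unset Printing Implicit Defensive.
Import Order.TTheory GRing.Theory Num.Theory.
Import numFieldNormedType.Exports.
Local Open Scope classical_set_scope.
Local Open Scope ring_scope.

(* The library has no Lebesgue measure on R^N: 'rV[R]_N is given the product
   sigma-algebra (generated by the coordinates, as for tuples), and the measure
   is the iterated product of the one-dimensional Lebesgue measure. *)

Definition measure_rV_display : measure_display -> measure_display.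
Proof. exact. Qed.

Section measurable_rV.
Context {R : realType} (n : nat).

Definition rV_coord (i : 'I_n) (x : 'rV[R]_n) : R := x 0 i.

Let rV_set0 : g_sigma_preimage rV_coord set0.
Proof. exact: sigma_algebra0. Qed.

Let rV_setC A : g_sigma_preimage rV_coord A -> g_sigma_preimage rV_coord (~` A).
Proof. exact: sigma_algebraC. Qed.

Let rV_bigcup (F : _^nat) : (forall i, g_sigma_preimage rV_coord (F i)) ->
  g_sigma_preimage rV_coord (\bigcup_i (F i)).
Proof. exact: sigma_algebra_bigcup. Qed.

HB.instance Definition _ := @isMeasurable.Build
  (measure_rV_display default_measure_display)
  'rV[R]_n (g_sigma_preimage rV_coord) rV_set0 rV_setC rV_bigcup.

End measurable_rV.

Lemma measurable_rV_coord {R : realType} n (i : 'I_n) :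
  measurable_fun [set: 'rV[R]_n] (fun x => x 0 i).
Proof.
move=> _ Y mY; rewrite setTI; apply: sub_sigma_algebra => /=.
rewrite -bigcup_seq/=; exists i => /=; first by rewrite mem_index_enum.
by exists Y => //; rewrite setTI.
Qed.

Lemma measurable_fun_rV {R : realType} d (T : measurableType d) n
    (f : T -> 'rV[R]_n) :
  (forall i, measurable_fun [set: T] (fun t => f t 0 i)) ->
  measurable_fun [set: T] f.
Proof.
move=> mf.
have H : preimage_set_system [set: T] f
    (g_sigma_preimage (@rV_coord R n)) `<=` measurable.
  rewrite -g_sigma_preimage_comp; apply: smallest_sub.
    exact: sigma_algebra_measurable.
  case: n f mf => [|n] f mf; first by rewrite big_ord0.
  rewrite -bigcup_mkord_ord => B [i Ii] /= [A mA <-].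
  exact: (mf (inord i)).
by move=> _ A mA; apply: H; exists A.
Qed.

Section lebesgue_rV_step.
Context {R : realType} (n : nat).
Variable mu : {sigma_finite_measure set 'rV[R]_n -> \bar R}.
Local Open Scope ereal_scope.

Definition rV_cons (p : R * 'rV[R]_n) : 'rV[R]_n.+1 :=
  \row_i oapp (p.2 0%R) p.1 (unlift ord0 i).

Definition rV_tail (x : 'rV[R]_n.+1) : 'rV[R]_n := \row_j x 0%R (lift ord0 j).

Lemma rV_consE0 p : rV_cons p 0%R ord0 = p.1.
Proof. by rewrite mxE unlift_none. Qed.

Lemma rV_consES p j : rV_cons p 0%R (lift ord0 j) = p.2 0%R j.
Proof. by rewrite mxE liftK. Qed.

Lemma rV_consK p : rV_tail (rV_cons p) = p.2.
Proof. by apply/rowP => j; rewrite mxE rV_consES. Qed.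

Lemma measurable_rV_cons : measurable_fun [set: R * 'rV[R]_n] rV_cons.
Proof.
apply: measurable_fun_rV => i; have [j ->|->] := unliftP ord0 i.
- rewrite (_ : (fun _ => _) = (fun x : 'rV[R]_n => x 0%R j) \o snd).
    by apply: measurableT_comp => //; exact: measurable_rV_coord.
  by apply/funext => p /=; rewrite rV_consES.
- by rewrite (_ : (fun _ => _) = fst) //; apply/funext => p; rewrite rV_consE0.
Qed.

Lemma measurable_rV_tail : measurable_fun [set: 'rV[R]_n.+1] rV_tail.
Proof.
apply: measurable_fun_rV => j.
rewrite (_ : (fun _ => _) = (fun x : 'rV[R]_n.+1 => x 0%R (lift ord0 j))).
  exact: measurable_rV_coord.
by apply/funext => x; rewrite mxE.
Qed.

Definition lebesgue_rV_step : set 'rV[R]_n.+1 -> \bar R :=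
  pushforward (@lebesgue_measure R \x mu) rV_cons.

Let step0 : lebesgue_rV_step set0 = 0.
Proof. by rewrite /lebesgue_rV_step/pushforward preimage_set0 measure0. Qed.

Let step_ge0 A : 0 <= lebesgue_rV_step A.
Proof. by rewrite /lebesgue_rV_step/pushforward; exact: measure_ge0. Qed.

Let step_sigma_additive : semi_sigma_additive lebesgue_rV_step.
Proof.
by apply: (@measure_semi_sigma_additive _ _ _
  (measure_function_pushforward__canonical__measure_function_Measure
    (@lebesgue_measure R \x mu) measurable_rV_cons)).
Qed.

HB.instance Definition _ := isMeasure.Build _ _ _
  lebesgue_rV_step step0 step_ge0 step_sigma_additive.

Let step_sigma_finite : sigma_finite setT lebesgue_rV_step.
Proof.
have [F [TF ndF Foo]] :=
  (sigma_finiteP _ _).1 (sigma_finiteT (@lebesgue_measure R)).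
have [G [TG ndG Goo]] := (sigma_finiteP _ _).1 (sigma_finiteT mu).
exists (fun k => (fun x : 'rV[R]_n.+1 => x 0%R ord0 : R) @^-1` F k `&`
                 rV_tail @^-1` G k).
  apply/seteqP; split=> // x _.
  have [i _ Fi] : (\bigcup_i F i) (x 0%R ord0) by rewrite -TF.
  have [j _ Gj] : (\bigcup_i G i) (rV_tail x) by rewrite -TG.
  exists (maxn i j) => //; split => /=.
    by move: Fi; exact/subsetPset/ndF/leq_maxl.
  by move: Gj; exact/subsetPset/ndG/leq_maxr.
move=> k; have [mF Fk] := Foo k; have [mG Gk] := Goo k; split.
  apply: measurableI; rewrite -[X in measurable X]setTI.
    exact: measurable_rV_coord.
  exact: measurable_rV_tail.
rewrite /lebesgue_rV_step /pushforward (_ : _ @^-1` _ = F k `*` G k).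
  by rewrite product_measure1E// lte_mul_pinfty// ge0_fin_numE.
by apply/seteqP; split=> p; rewrite /= rV_consE0 rV_consK.
Qed.

HB.instance Definition _ := Measure_isSigmaFinite.Build _ _ _
  lebesgue_rV_step step_sigma_finite.

End lebesgue_rV_step.

Fixpoint lebesgue_rV {R : realType} (n : nat) :
    {sigma_finite_measure set 'rV[R]_n -> \bar R} :=
  match n with
  | 0 => \d_(0 : 'rV[R]_0)
  | n.+1 => lebesgue_rV_step (lebesgue_rV n)
  end.

Section euclidean_space.
Context {R : realType} {N : nat}.
Local Notation E := 'rV[R]_N.

(* The library norm on 'rV[R]_N is the sup norm; |x| is the Euclidean one. *)
Definition dot (x y : E) : R := \sum_i x 0 i * y 0 i.
Definition enorm (x : E) : R := Num.sqrt (dot x x).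

Definition pd (i : 'I_N) (f : E -> R) (x : E) : R := 'D_(delta_mx 0 i) f x.
Definition grad (f : E -> R) (x : E) : E := \row_i pd i f x.
Definition laplacian (f : E -> R) (x : E) : R := \sum_i pd i (pd i f) x.

Definition is_C1 (f : E -> R) : Prop :=
  [/\ forall i x, derivable f x (delta_mx 0 i),
      continuous f & forall i, continuous (pd i f)].

Definition is_C2 (f : E -> R) : Prop :=
  is_C1 f /\ forall i, is_C1 (pd i f).

(* u(t,x) is C^1 in t and C^2 in x on the open set D of space-time *)
Definition is_C12 (D : set (R * E)) (u : R -> E -> R) : Prop :=
  (forall t x, D (t, x) ->
     [/\ derivable (u ^~ x) t 1,
         forall i, derivable (u t) x (delta_mx 0 i) &
         forall i j, derivable (pd i (u t)) x (delta_mx 0 j)]) /\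
  (forall p, D p ->
     [/\ {for p, continuous (fun q : R * E => u q.1 q.2)},
         {for p, continuous (fun q : R * E => derive1 (u ^~ q.2) q.1)},
         forall i, {for p, continuous (fun q : R * E => pd i (u q.1) q.2)} &
         forall i j,
           {for p, continuous (fun q : R * E => pd j (pd i (u q.1)) q.2)}]).

(* For a C^2 function the weak derivatives are the classical ones. *)
Definition is_C2_W2oo (f : E -> R) : Prop :=
  is_C2 f /\ exists M, forall x,
    [/\ `|f x| <= M, forall i, `|pd i f x| <= M &
        forall i j, `|pd j (pd i f) x| <= M].

Definition is_domain (Omega : set E) : Prop :=
  [/\ open Omega, connected Omega & Omega !=set0].

End euclidean_space.

Section Lebesgue_spaces.
Context d {T : measurableType d} {R : realType}.
Variable mu : {measure set T -> \bar R}.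

(* L^p norm on D of a real function (whose values off D are irrelevant) *)
Definition Lnorm_on (p : \bar R) (D : set T) (f : T -> R) : \bar R :=
  'N[mu]_p[EFin \o (f \_ D)]%E.

Definition in_L (p : \bar R) (D : set T) (f : T -> R) : Prop :=
  measurable_fun D f /\ (Lnorm_on p D f < +oo)%E.

End Lebesgue_spaces.

Section dirichlet_heat.
Context {R : realType} {N : nat}.
Local Notation E := 'rV[R]_N.
Local Notation mu := (lebesgue_rV N).
Local Notation L2 := (in_L mu 2%:E).
Local Notation norm2 := (Lnorm_on mu 2%:E).
Variable Omega : set E.

(* test functions: C^1 on R^N with compact support in Omega *)
Definition is_C1c (phi : E -> R) : Prop :=
  is_C1 phi /\
  exists K : set E, [/\ compact K, K `<=` Omega & forall x, ~ K x -> phi x = 0].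

(* u is in H^1_0(Omega), the closure of C^1_c(Omega) in H^1(Omega), and g is
   its weak gradient *)
Definition is_H10 (u : E -> R) (g : E -> E) : Prop :=
  [/\ L2 Omega u, forall i, L2 Omega (fun x => g x 0 i) &
      exists phi : nat -> E -> R,
        [/\ forall n, is_C1c (phi n),
            norm2 Omega (phi n \- u) @[n --> \oo] --> 0%E &
            forall i, norm2 Omega (fun x => pd i (phi n) x - g x 0 i)
                        @[n --> \oo] --> 0%E]].

(* u is in the domain of the Dirichlet Laplacian of Omega and is mapped to f:
   this is the operator on L^2(Omega) associated with the Dirichlet form
   \int grad u . grad v on H^1_0(Omega) *)
Definition is_dirichlet_laplacian (u f : E -> R) : Prop :=
  exists g, [/\ is_H10 u g, L2 Omega f &
    forall v k, is_H10 v k ->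
      \int[mu]_(x in Omega) dot (g x) (k x) =
      - \int[mu]_(x in Omega) (f x * v x)].

Definition heat_semigroup (G : R -> E -> E -> R) (t : R) (v : E -> R) (x : E) :
    R := \int[mu]_(y in Omega) (G t x y * v y).

(* e^{t Delta_Omega} is the solution operator of the Cauchy problem
   u' = Delta_Omega u, u(0) = f in L^2(Omega), with Delta_Omega the Dirichlet
   Laplacian, and the heat kernel is its continuous integral kernel. *)
Definition is_dirichlet_heat_kernel (G : R -> E -> E -> R) : Prop :=
  (forall t x y, 0 < t -> Omega x -> Omega y ->
     {for (t, x, y), continuous (fun p : R * E * E => G p.1.1 p.1.2 p.2)}) /\
  (forall f, L2 Omega f ->
     let u := fun t => heat_semigroup G t f in
     (forall t x, 0 < t -> Omega x ->
        mu.-integrable Omega (fun y => (G t x y * f y)%:E)) /\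
     (exists u' : R -> E -> R, forall t, 0 < t ->
        is_dirichlet_laplacian (u t) (u' t) /\
        norm2 Omega (fun x => h^-1 * (u (t + h) x - u t x) - u' t x)
          @[h --> 0^'] --> 0%E) /\
     norm2 Omega (u t \- f) @[t --> 0^'+] --> 0%E).

End dirichlet_heat.

Section nonlinear_problem.
Context {R : realType} {N : nat}.
Local Notation E := 'rV[R]_N.
Variables (theta : R -> R) (delta alpha : R) (Omega : set E).
Variables (U : R -> E -> R) (Psi : E -> R).

Definition is_cutoff_profile : Prop :=
  [/\ forall k x, derivable (derive1n k theta) x 1,
      {homo theta : s r / s <= r},
      forall s, s <= 1 -> theta s = 0 &
      forall s, 2 <= s -> theta s = 1].

Definition a_ (j : nat) : R := 2 ^- j * delta.
Definition chi (j : nat) (x : E) : R := theta (enorm x / a_ j).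

Definition sum_chi (m : nat) (t : R) (x : E) : R :=
  \sum_(1 <= j < m.+1) t `^ ((j%:R - 1) / 2) * chi j x.

Definition Theta (K : R) (m : nat) (t : R) (x : E) : R :=
  K * (t `^ (m%:R / 2) + sum_chi m t x).

(* |x|^-2 + 1 is multiplied by a function vanishing near x = 0 *)
Definition hfun (m : nat) (t : R) (x : E) : R :=
  (enorm x ^- 2 + 1) * sum_chi m t x + (1 + t) * t `^ ((m%:R - 2) / 2).

Definition calM (w : R -> E -> R) (t : R) (x : E) : R :=
  2 * dot (grad (U t) x) (grad Psi x) + U t x * laplacian Psi x
  + `|Psi x * U t x + w t x| `^ alpha * (Psi x * U t x + w t x)
  - Psi x * (`|U t x| `^ alpha * U t x).

(* min {t^-1, |x|^-2}, with |0|^-2 = +oo *)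
Definition min_inv (t : R) (x : E) : R :=
  if x == 0 then t^-1 else Num.min t^-1 (enorm x ^- 2).

Definition cylinder (T : R) : set (R * E) := [set` `]0, T[] `*` Omega.

Definition spacetime : {measure set (measurableTypeR R * E) -> \bar R} :=
  (@lebesgue_measure R \x lebesgue_rV N)%E.

Definition Linfty_cyl (T : R) (w : R -> E -> R) : Prop :=
  in_L spacetime +oo%E (cylinder T) (fun p => w p.1 p.2).

Definition ae_cyl (T : R) (P : R -> E -> Prop) : Prop :=
  \forall p \ae spacetime, cylinder T p -> P p.1 p.2.

Definition calE (K : R) (m : nat) (T : R) (w : R -> E -> R) : Prop :=
  Linfty_cyl T w /\ ae_cyl T (fun t x => `|w t x| <= Theta K m t x).

Definition is_constant_A (T0 A : R) : Prop :=
  0 < A /\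
  forall (K : R) (m : nat) (T : R) (w z : R -> E -> R),
    0 < K -> (2 <= m)%N -> 0 < T -> T <= Num.min (1 / 4) T0 ->
    calE K m T w -> calE K m T z ->
    ae_cyl T (fun t x =>
      `|calM w t x| <= A * (1 + K `^ (alpha + 1)) * hfun m t x /\
      `|calM w t x - calM z t x| <= A * (1 + K `^ (alpha + 1))
         * `|(w t x - z t x) / Theta K m t x| * hfun m t x).

Definition admissible (K A : R) (m : nat) (T : R) : Prop :=
  let B := (1 + K `^ (alpha + 1)) * A in
  [/\ (2 <= m)%N /\ T <= 1 / 4,
      4 / m%:R <= K / (4 * B),
      forall t, 0 < t -> t <= T ->
        2 `^ (N%:R / 2) * expR (- (a_ 1 ^+ 2 / (8 * t))) <=
        1 / 2 * t `^ (m%:R / 2),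
      T `^ (1 / 2) * (1 + a_ m ^- 2) <= K / (4 * B) &
      forall t, 0 < t -> t <= T ->
        m%:R * 2 `^ (N%:R / 2) * (1 + a_ m ^- 2) * (1 + t `^ ((m%:R + 1) / 2))
          * expR (- (a_ m.+1 ^+ 2 / (8 * t))) <=
        K / (4 * B) * t `^ (m%:R / 2)].

Variable G : R -> E -> E -> R.

Definition duhamel (w0 : E -> R) (w : R -> E -> R) (t : R) (x : E) : R :=
  heat_semigroup Omega G t w0 x +
  \int[lebesgue_measure]_(s in [set` `]0, t[])
    heat_semigroup Omega G (t - s) (calM w s) x.

End nonlinear_problem.

Arguments admissible {R} N delta alpha K A m T.

(* Main.v *)
Require Import Defs.
From mathcomp Require Import all_boot all_order all_algebra.
From mathcomp Require Import all_classical all_reals all_analysis.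
From mathcomp Require Import measurable_realfun ess_sup_inf.
From mathcomp Require Import ring lra.
Set Implicit Arguments.
Unset Strict Implicit.
Unset Printing Implicit Defensive.
Import Order.TTheory GRing.Theory Num.Theory.
Import numFieldNormedType.Exports.
Local Open Scope classical_set_scope.
Local Open Scope ring_scope.

(** The equation is solved by Picard iteration among the functions bounded by the
    weight [Theta], starting from zero.

    The difficulty is the potential [|U|^alpha], which is only bounded by
    [A1 * min (1/t, |x|^-2)]. Multiplied by [Theta] it is absorbed by [hfun]
    ([potential_Theta_le]): the part [t^(m/2)] of [Theta] loses a factor [t], and
    the cut-offs [chi j], which vanish near the origin, absorb [|x|^-2]. Together
    with the boundedness of [U] and of its gradient away from the origin this gives
    the constant [A] ([exists_constant_A]).

    The Duhamel operator sends [hfun] back to a small multiple of [Theta]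
    ([hmaj_heat_integral]). The integral of [s^((m-2)/2)] is [(2/m) t^(m/2)], small
    relative to [t^(m/2)] when [m] is large. A term [s^((j-1)/2) chi j] is supported
    in [|y| >= a_j]; its flow is small for [|x|] well below [a_j], and elsewhere is
    dominated by the cut-off [chi j.+1] of half the radius. As [chi j.+1] has the
    weight [t^(j/2)] in [Theta] and time integration gains a factor [t], a factor
    [t^(1/2)] remains; for the last index the mass of the kernel is used together
    with the term [t^(m/2)]. In the same way the flow of [w0], which vanishes near
    the origin, is at most 2/3 of [Theta] ([linear_bound]). Taking [m] large and
    then [T] small ([parameters_exist]) makes the Duhamel term at most 1/3 of
    [Theta] and the iteration a contraction of ratio 1/3 ([duhamel_diff]), whence
    existence and uniqueness. Finally [hfun] is bounded, hence so is [calM w], and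
    the Duhamel term is at most linear in time ([source_bounded]).

    What is used of the heat kernel is its sign, its mass and an off-diagonal decay
    ([kernel_ge0], [kernel_mass], [kernel_far]). The kernel is known only through
    the semigroup on square integrable functions, and all three follow from one
    maximum principle ([heat_comparison]): data bounded by [rho = b * expR (l . y)]
    have a flow bounded by [expR (|l|^2 t) * rho], because the right-hand side solves
    the heat equation and is nonnegative on the boundary. It is proved by the energy method: for a
    smooth convex function [H] vanishing on negative numbers, the integral of
    [H (expR (- |l|^2 t) * u - rho)] does not increase, as one sees by testing the
    equation with [H'] of this difference, and it tends to zero at time zero. The
    truncation of a test function by [rho] again has compact support in [Omega],
    which makes it admissible in the weak formulation. For [b = 0] this gives the
    positivity of the kernel; for [b = 1], by Fatou's lemma, its exponential
    moments, hence the mass for [l = 0] and the tails by Chernoff's bound.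

    Since the Duhamel term is an iterated integral, joint measurability in time and
    space has to be ensured along the iteration. The sigma-algebras involved have
    countable bases of open sets, so that continuous functions are Borel
    ([continuous_on_measurable]), and integrals depending on a parameter are
    measurable ([potential_measurable]). *)

(** * Borel sets of euclidean space-time *)

Section borel.

(** A countable base of measurable sets: this is what makes open sets of the
    product sigma-algebras measurable, and it is stable under finite products. *)
Definition measurable_base d (X : measurableType d) (Y : topologicalType)
    (f : X -> Y) : Prop :=
  exists (I : countType) (B : I -> set X),
    (forall i, measurable (B i)) /\
    forall x U, nbhs (f x) U -> exists i, B i x /\ B i `<=` f @^-1` U.

Lemma measurable_open d (X : measurableType d) (Y : topologicalType)
    (f : X -> Y) (O : set Y) :
  measurable_base f -> open O -> measurable (f @^-1` O).
Proof.
move=> [I [B [mB BP]]] oO.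
pose C (n : nat) : set X := if unpickle n is Some i then
  (if `[< B i `<=` f @^-1` O >] then B i else set0) else set0.
rewrite (_ : f @^-1` O = \bigcup_n C n).
  apply: bigcupT_measurable => n; rewrite /C; case: (unpickle n) => // i.
  by case: ifP.
apply/seteqP; split => x /=.
  move=> Ox; have [i [Bix Bi]] := BP _ _ (open_nbhs_nbhs (conj oO Ox)).
  by exists (pickle i) => //; rewrite /C pickleK; case: asboolP.
move=> [n _]; rewrite /C; case: (unpickle n) => // i.
by case: asboolP => // Bi /Bi.
Qed.

Lemma measurable_base_R (R : realType) :
  measurable_base (id : measurableTypeR R -> R).
Proof.
exists (rat * rat)%type, (fun p => [set` `]ratr p.1, ratr p.2[]); split.
  by move=> p; exact: measurable_itv.
move=> x U /nbhs_ballP[e /= e0 eU].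
have /rat_in_itvoo[q1] : x - e < x by rewrite ltrBlDr ltrDl.
have /rat_in_itvoo[q2] : x < x + e by rewrite ltrDl.
rewrite !in_itv /= => /andP[q2a q2b] /andP[q1a q1b].
exists (q1, q2) => /=; split; first by rewrite in_itv /= q1b q2a.
move=> y /=; rewrite in_itv /= => /andP[y1 y2]; apply: eU.
rewrite /ball /= ltr_norml; apply/andP; split; lra.
Qed.

Lemma measurable_base_rV (R : realType) (n : nat) :
  measurable_base (id : 'rV[R]_n -> 'rV[R]_n).
Proof.
have [J [B [mB BP]]] := measurable_base_R R.
exists {ffun 'I_n -> J}, (fun s : {ffun 'I_n -> J} => \bigcap_(i in [set: 'I_n])
  ((fun x : 'rV[R]_n => x 0 i) @^-1` (B (s i)))); split.
  move=> s; apply: fin_bigcap_measurable => // i _.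
  rewrite -[X in measurable X]setTI; apply: measurable_rV_coord => //; exact: mB.
move=> x U /nbhs_ballP[e /= e0 eU].
have /choice[s sP] (i : 'I_n) : exists j, B j (x 0 i) /\ B j `<=` ball (x 0 i) e.
  by apply: BP; exact: nbhsx_ballx.
exists (finfun s); split => [i _|y yP] /=; first by rewrite ffunE; case: (sP i).
apply: eU; split => // i j; rewrite ord1.
by have := yP j I; rewrite /= ffunE => /(sP j).2.
Qed.

Lemma measurable_base_prod d1 d2 (X1 : measurableType d1)
    (X2 : measurableType d2) (Y1 Y2 : topologicalType)
    (f1 : X1 -> Y1) (f2 : X2 -> Y2) :
  measurable_base f1 -> measurable_base f2 ->
  measurable_base (fun p : X1 * X2 => (f1 p.1, f2 p.2)).
Proof.
move=> [I1 [B1 [mB1 BP1]]] [I2 [B2 [mB2 BP2]]].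
exists (I1 * I2)%type, (fun p => B1 p.1 `*` B2 p.2); split.
  by move=> p; exact: measurableX.
move=> [x1 x2] U /= [[A1 A2] /= [/BP1[i1 [Bx1 BA1]] /BP2[i2 [Bx2 BA2]]] AU].
exists (i1, i2); split => // -[y1 y2] [/= By1 By2]; apply: AU; split => /=.
  exact: BA1.
exact: BA2.
Qed.

Lemma continuous_on_measurable (R : realType) d (X : measurableType d)
    (Y : topologicalType) (f : X -> Y) (D : set Y) (g : Y -> R) :
  measurable_base f -> open D -> (forall y, D y -> {for y, continuous g}) ->
  measurable_fun (f @^-1` D) (g \o f).
Proof.
move=> mbf oD cg; have mD := measurable_open mbf oD.
apply: (measurability _ (RGenOInfty.measurableE R)) => _ [_ [a ->] <-].
apply: (measurable_open (O := D `&` g @^-1` `]a, +oo[%classic) mbf).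
rewrite openE => y [Dy gy]; apply: filterI; first by apply: open_nbhs_nbhs; split.
by apply: (cg _ Dy); apply: open_nbhs_nbhs; split => //; exact: open_gt.
Qed.

End borel.

(** * Cubes *)

Section cubes.
Context {R : realType}.
Local Notation mu := (lebesgue_rV _).

Definition cube n (M : R) : set 'rV[R]_n := [set x | forall i, `|x 0 i| <= M].

Definition obox n (x : 'rV[R]_n) (e : R) : set 'rV[R]_n :=
  [set y | forall i, `|x 0 i - y 0 i| < e].

Lemma open_measurable_rV n (O : set 'rV[R]_n) : open O -> measurable O.
Proof. exact: (measurable_open (@measurable_base_rV R n)). Qed.

Lemma closed_measurable_rV n (O : set 'rV[R]_n) : closed O -> measurable O.
Proof.
move=> cO; rewrite -(setCK O); apply: measurableC; apply: open_measurable_rV.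
exact: closed_openC.
Qed.

Lemma continuous_measurable_rV n (f : 'rV[R]_n -> R) :
  continuous f -> measurable_fun setT f.
Proof.
move=> cf; exact: (continuous_on_measurable (@measurable_base_rV R n) openT
  (fun y _ => cf y)).
Qed.

Lemma measurable_cube n M : measurable (@cube n M).
Proof.
rewrite (_ : cube M = \bigcap_(i in [set: 'I_n])
  ((fun x : 'rV[R]_n => x 0 i) @^-1` [set` `[- M, M]])).
  apply: fin_bigcap_measurable => // i _; rewrite -[X in measurable X]setTI.
  apply: measurable_rV_coord => //; exact: measurable_itv.
apply/seteqP; split => x /=.
  by move=> xM i _ /=; rewrite in_itv /= -ler_norml.
by move=> xM i; have := xM i Logic.I; rewrite /= in_itv /= -ler_norml.
Qed.

Lemma cube_preimage n M :
  @rV_cons R n @^-1` (@cube n.+1 M) = [set` `[- M, M]] `*` @cube n M.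
Proof.
apply/seteqP; split=> -[a y] /=.
  move=> H; split => /=; first by have := H ord0; rewrite rV_consE0 in_itv /= -ler_norml.
  by move=> i; have := H (lift ord0 i); rewrite rV_consES.
move=> [/=]; rewrite in_itv /= -ler_norml => aM yM i.
by have [j ->|->] := unliftP ord0 i; rewrite ?rV_consE0 ?rV_consES.
Qed.

Lemma obox_preimage n (x : 'rV[R]_n.+1) e :
  @rV_cons R n @^-1` (obox x e) =
  [set` `]x 0 ord0 - e, x 0 ord0 + e[] `*` obox (rV_tail x) e.
Proof.
apply/seteqP; split=> -[a y] /=.
  move=> H; split => /=.
    by have := H ord0; rewrite rV_consE0 in_itv /= distrC ltr_distl.
  by move=> i; have := H (lift ord0 i); rewrite rV_consES mxE.
move=> [/=]; rewrite in_itv /= -ltr_distl distrC => aM yM i.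
have [j ->|->] := unliftP ord0 i; rewrite ?rV_consE0 ?rV_consES //.
by have := yM j; rewrite mxE.
Qed.

Lemma rV_consE n (A : set 'rV[R]_n.+1) :
  lebesgue_rV n.+1 A = (@lebesgue_measure R \x lebesgue_rV n)%E (@rV_cons R n @^-1` A).
Proof. by []. Qed.

Lemma cube_finite n M : (lebesgue_rV n (@cube n M) < +oo)%E.
Proof.
elim: n => [|n IHn].
  by rewrite /= diracE; apply: ltry.
rewrite rV_consE cube_preimage product_measure1E; last 2 first.
- exact: measurable_itv.
- exact: measurable_cube.
have IE : (@lebesgue_measure R [set` `[(- M)%R, M : R]%R] < +oo)%E.
  by rewrite lebesgue_measure_itv /=; case: ifP => // _; exact: ltry.
by apply: lte_mul_pinfty => //; rewrite ge0_fin_numE //; exact: IE.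
Qed.

Lemma open_obox n (x : 'rV[R]_n) e : open (obox x e).
Proof.
rewrite openE => y xy; rewrite /interior.
exists (fun i j => [set z | `|x 0 j - z| < e]).
  move=> i j; have := xy j; rewrite ord1 => H.
  have : nbhs (y 0 j) (ball (x 0 j) e) by apply: open_nbhs_nbhs; split => //; exact: ball_open.
  by apply: filterS => z; rewrite /ball.
by move=> z H i; exact: H 0 i.
Qed.

Lemma obox_gt0 n (x : 'rV[R]_n) e : 0 < e -> (0 < lebesgue_rV n (obox x e))%E.
Proof.
move=> e0; elim: n x => [|n IHn] x.
  rewrite /= diracE mem_set; first exact: lte01.
  by case.
rewrite rV_consE obox_preimage product_measure1E; last 2 first.
- exact: measurable_itv.
- by apply: open_measurable_rV; exact: open_obox.
have IE : (0 < @lebesgue_measure R [set` `]x 0 ord0 - e, x 0 ord0 + e[%R])%E;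
  last by apply: mule_gt0; [exact: IE|exact: IHn].
rewrite lebesgue_measure_itv /= lte_fin ifT; last by rewrite ltrBlDr -addrA ltrDl addr_gt0.
by rewrite -EFinD lte_fin; lra.
Qed.

Lemma obox_nbhs n (x : 'rV[R]_n) U : nbhs x U -> exists2 e, 0 < e & obox x e `<=` U.
Proof.
move=> /nbhs_ballP[e /= e0 eU]; exists e => // y xy; apply: eU; split => // i j.
by rewrite ord1; exact: xy.
Qed.

Lemma nbhs_obox n (x : 'rV[R]_n) e : 0 < e -> nbhs x (obox x e).
Proof.
move=> e0; apply: open_nbhs_nbhs; split; first exact: open_obox.
by move=> i; rewrite subrr normr0.
Qed.

(** Nonempty open sets have positive measure, so that sets of full measure are
    dense: this turns almost everywhere statements into pointwise ones for
    continuous functions. *)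
Lemma ae_nbhs n (P : set 'rV[R]_n) (x : 'rV[R]_n) U :
  (\forall y \ae lebesgue_rV n, P y) -> nbhs x U -> exists y, U y /\ P y.
Proof.
move=> [A [mA A0 PA]] /obox_nbhs[e e0 eU].
apply: contrapT => nex.
have sub : obox x e `<=` A.
  by move=> y xy; apply: PA => /= Py; apply: nex; exists y; split => //; exact: eU.
have := obox_gt0 x e0; rewrite ltNge => /negP; apply.
rewrite -A0; apply: le_measure => //; rewrite inE //.
by apply: open_measurable_rV; exact: open_obox.
Qed.

Lemma compact_cube n M : compact (@cube n M).
Proof.
rewrite (_ : cube M = [set x | forall i, [set` `[- M, M]] (x 0 i)]).
  by apply: (@rV_compact R n (fun _ => [set` `[- M, M]])) => i; exact: segment_compact.
by apply/seteqP; split => x /= H i; have := H i; rewrite in_itv /= -ler_norml.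
Qed.

Lemma compact_sub_cube n (K : set 'rV[R]_n) : compact K ->
  exists M, K `<=` cube M.
Proof.
move=> cK; have [M [_ MP]] := compact_bounded cK.
exists (M + 1) => x Kx i; apply: le_trans (MP (M + 1) _ x Kx); last by rewrite ltrDl.
rewrite [leRHS]/Num.norm /= mx_normrE; exact: (le_bigmax_cond _ _ (j := (0, i))).
Qed.

End cubes.

(** * The divergence theorem for compactly supported functions *)

Section directional_derivatives.
Context {R : realType}.

(** A directional derivative only depends on the restriction of the function to
    a line, so that it can be computed on any parametrization of that line. *)
Lemma derivable_along (V W : normedModType R) (f : V -> R) (k : W -> R)
    (x v : V) (y w : W) :
  (forall h : R, k (h *: w + y) = f (h *: v + x)) ->
  derivable f x v -> derivable k y w.
Proof.
move=> H; rewrite /derivable (_ : (fun h : R => h^-1 *: ((k \o shift y) (h *: w) - k y)) =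
   (fun h : R => h^-1 *: ((f \o shift x) (h *: v) - f x))) //.
apply/funext => h /=; rewrite H; congr (_ *: (_ - _)).
by have := H 0; rewrite !scale0r !add0r.
Qed.

Lemma derive_along (V W : normedModType R) (f : V -> R) (k : W -> R)
    (x v : V) (y w : W) :
  (forall h : R, k (h *: w + y) = f (h *: v + x)) ->
  'D_w k y = 'D_v f x.
Proof.
move=> H; rewrite /derive (_ : (fun h : R => h^-1 *: ((k \o shift y) (h *: w) - k y)) =
   (fun h : R => h^-1 *: ((f \o shift x) (h *: v) - f x))) //.
apply/funext => h /=; rewrite H; congr (_ *: (_ - _)).
by have := H 0; rewrite !scale0r !add0r.
Qed.

Lemma continuous_to_rV (X : topologicalType) n (f : X -> 'rV[R]_n) (x : X) :
  (forall i, {for x, continuous (fun y => f y 0 i)}) -> {for x, continuous f}.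
Proof.
move=> cf U /obox_nbhs[e e0 eU].
have : \forall y \near x, forall i, `|f x 0 i - f y 0 i| < e.
  apply: (@filter_forall _ _ (fun i => [set y | `|f x 0 i - f y 0 i| < e])) => i.
  exact: (cf i _ (nbhsx_ballx (f x 0 i) e e0)).
by apply: filterS => y H; apply: eU.
Qed.

Lemma rV_cons_shift0 n (a h : R) (y : 'rV[R]_n) :
  rV_cons (h *: 1 + a, y) = h *: delta_mx 0 ord0 + rV_cons (a, y).
Proof.
apply/rowP => i; rewrite !mxE; have [j ->|->] := unliftP ord0 i.
  by rewrite /= mulr0 add0r.
by [].
Qed.

Lemma rV_cons_shiftS n (a h : R) (y : 'rV[R]_n) j :
  rV_cons (a, h *: delta_mx 0 j + y) =
  h *: delta_mx 0 (lift ord0 j) + rV_cons (a, y).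
Proof.
apply/rowP => i; rewrite !mxE; have [k ->|->] := unliftP ord0 i.
  by rewrite /= !mxE /= (inj_eq lift_inj).
by rewrite /= mulr0 add0r.
Qed.

Lemma continuous_rV_cons n (p : R * 'rV[R]_n) : {for p, continuous (@rV_cons R n)}.
Proof.
apply: continuous_to_rV => i; have [j ->|->] := unliftP ord0 i.
  rewrite (_ : (fun _ => _) = (fun x : 'rV[R]_n => x 0%R j) \o snd); last first.
    by apply/funext => q /=; rewrite rV_consES.
  by apply: continuous_comp; [exact: cvg_snd|exact: coord_continuous].
rewrite (_ : (fun _ => _) = fst); first exact: cvg_fst.
by apply/funext => q; rewrite rV_consE0.
Qed.

Lemma continuous_pair (X Y Z : topologicalType) (f : X -> Y) (g : X -> Z) x :
  {for x, continuous f} -> {for x, continuous g} ->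
  {for x, continuous (fun x => (f x, g x))}.
Proof.
move=> cf cg U [[A B] /= [fA gB] AB].
have nA : nbhs x (f @^-1` A) by exact: cf.
have nB : nbhs x (g @^-1` B) by exact: cg.
by apply: filterS (filterI nA nB) => y /= [Ay By]; apply: AB; split.
Qed.

Lemma continuous_consr n (a : R) : continuous (fun y : 'rV[R]_n => rV_cons (a, y)).
Proof.
move=> y; apply: (@continuous_comp _ _ _ (fun y => (a, y)) (@rV_cons R n)).
  exact: (continuous_pair (f := fun=> a) (g := id) (@cst_continuous _ _ a y) (fun U H => H)).
exact: continuous_rV_cons.
Qed.

Lemma continuous_consl n (y : 'rV[R]_n) : continuous (fun a : R => rV_cons (a, y)).
Proof.
move=> a; apply: (@continuous_comp _ _ _ (fun a => (a, y)) (@rV_cons R n)).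
  exact: (continuous_pair (f := id) (g := fun=> y) (fun U H => H) (@cst_continuous _ _ y a)).
exact: continuous_rV_cons.
Qed.

End directional_derivatives.

Section divergence.
Context {R : realType}.

Lemma pd_off_cube n (f : 'rV[R]_n -> R) i M :
  (forall x, ~ cube M x -> f x = 0) -> forall x, ~ cube M x -> pd i f x = 0.
Proof.
move=> f0 x xM; rewrite /pd (near_eq_derive (g := cst 0)); first exact: derive_cst.
have : nbhs x (~` cube M).
  apply: open_nbhs_nbhs; split => //; apply: closed_openC.
  by apply: compact_closed; [exact: norm_hausdorff|exact: compact_cube].
by apply: filterS => y /f0.
Qed.

Lemma cube_integrable n (f : 'rV[R]_n -> R) M :
  continuous f -> (forall x, ~ cube M x -> f x = 0) ->
  (lebesgue_rV n).-integrable setT (EFin \o f).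
Proof.
move=> cf f0.
have -> : EFin \o f = (EFin \o f) \_ (cube M).
  apply/funext => x; rewrite patchE; case: ifPn => // /negP xM /=.
  by rewrite f0 // => /mem_set.
apply/(integrable_mkcond _ (@measurable_cube R n M)).
apply: (measurable_bounded_integrable (@measurable_cube R n M)).
- exact: cube_finite.
- by apply: measurable_funTS; exact: continuous_measurable_rV.
- have : compact (f @` (cube M)).
    apply: continuous_compact; last exact: compact_cube.
    exact: (continuous_subspaceT cf).
  move=> /compact_bounded [C [Cr CP]]; exists C; split => // e eC x xM /=.
  by apply: CP => //; exists x.
Qed.

Lemma measurable_cons n :
  measurable_fun [set: measurableTypeR R * 'rV[R]_n] (@rV_cons R n).
Proof. exact: measurable_rV_cons. Qed.

Lemma integral_rV_cons n (f : 'rV[R]_n.+1 -> \bar R) :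
  measurable_fun setT f ->
  (lebesgue_rV n.+1).-integrable setT f ->
  (@lebesgue_measure R \x lebesgue_rV n)%E.-integrable setT (f \o @rV_cons R n).
Proof.
move=> mf /integrableP[_ foo]; apply/integrableP; split.
  by apply: measurableT_comp => //; exact: measurable_rV_cons.
move: foo; rewrite ge0_integral_pushforward //; [exact: measurable_cons|].
exact: measurableT_comp.
Qed.

(** By induction on the dimension: Fubini isolates the first coordinate, along
    which the fundamental theorem of calculus applies if it is the coordinate of
    differentiation; otherwise the induction hypothesis holds on each slice. *)
Lemma integral_pd0 n (f : 'rV[R]_n -> R) i M :
  (forall x, derivable f x (delta_mx 0 i)) -> continuous (pd i f) ->
  (forall x, ~ cube M x -> f x = 0) ->
  (\int[lebesgue_rV n]_x (pd i f x)%:E = 0)%E.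
Proof.
elim: n f i M => [|n IHn] f i M; first by case: i.
move=> df cf f0.
have mf : measurable_fun setT (EFin \o pd i f).
  by apply/measurable_EFinP; exact: continuous_measurable_rV.
have intf := cube_integrable cf (pd_off_cube i f0).
have intc := integral_rV_cons mf intf.
have -> : (\int[lebesgue_rV n.+1]_x (pd i f x)%:E =
    \int[(@lebesgue_measure R \x lebesgue_rV n)%E]_p (pd i f (rV_cons p))%:E)%E.
  exact: (integral_pushforward (@measurable_cons n) mf intc measurableT).
rewrite -(integral12_prod_meas1 intc) /fubini_F /=.
have [j ij|i0] := unliftP ord0 i.
  apply: integral0_eq => a _.
  have E y : pd i f (rV_cons (a, y)) = pd j (fun y => f (rV_cons (a, y))) y.
    by rewrite /pd ij; apply/esym/derive_along => h; rewrite rV_cons_shiftS.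
  under eq_integral do rewrite E.
  apply: (IHn _ j M).
  - move=> y; apply: (derivable_along (f := f) (x := rV_cons (a, y)) (v := delta_mx 0 i)) => //.
    by move=> h; rewrite rV_cons_shiftS ij.
  - have -> : pd j (fun y => f (rV_cons (a, y))) = pd i f \o (fun y => rV_cons (a, y)).
      by apply/funext => y; rewrite /= E.
    move=> y; apply: (@continuous_comp _ _ _ (fun y => rV_cons (a, y)) (pd i f)).
      exact: continuous_consr.
    exact: cf.
  - by move=> y yM; apply: f0 => H; apply: yM => k; have := H (lift ord0 k); rewrite rV_consES.
transitivity (\int[lebesgue_rV n]_y \int[@lebesgue_measure R]_a (pd i f (rV_cons (a, y)))%:E)%E.
  exact: (Fubini intc).
apply: integral0_eq => y _.
pose F (a : R) := f (rV_cons (a, y)).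
have E a : pd i f (rV_cons (a, y)) = derive1 F a.
  rewrite derive1E /pd i0; apply/esym/derive_along => h.
  by rewrite /F rV_cons_shift0.
have dF a : derivable F a 1.
  apply: (derivable_along (f := f) (x := rV_cons (a, y)) (v := delta_mx 0 i)) => //.
  by move=> h; rewrite /F rV_cons_shift0 i0.
have cF a : {for a, continuous F}.
  by apply/differentiable_continuous/derivable1_diffP.
have F0 a : ~ (`|a| <= M) -> F a = 0.
  by move=> aM; apply: f0 => /(_ ord0); rewrite rV_consE0.
have cF' : continuous (fun a => derive1 F a).
  have -> : (fun a => derive1 F a) = pd i f \o (fun a => rV_cons (a, y)).
    by apply/funext => a; rewrite /= E.
  move=> a; apply: (@continuous_comp _ _ _ (fun a => rV_cons (a, y)) (pd i f)).
    exact: continuous_consl.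
  exact: cf.
pose M' := `|M| + 1.
have M'0 : - M' < M' by rewrite /M'; have := normr_ge0 M; lra.
have MM' : M < M' by rewrite /M'; have := ler_norm M; lra.
have -> : (\int[lebesgue_measure]_a (pd i f (rV_cons (a, y)))%:E =
   \int[lebesgue_measure]_(a in `[(- M')%R, M']) (derive1 F a)%:E)%E.
  rewrite [RHS]integral_mkcond; apply: eq_integral => a _; rewrite patchE E.
  case: ifPn => // /negP aM; rewrite -E (pd_off_cube i f0) // => /(_ ord0).
  rewrite rV_consE0 /= => aM'; apply: aM; rewrite inE /= in_itv /= -ler_norml.
  exact: le_trans aM' (ltW MM').
have Fz : ((F M')%:E - (F (- M'))%:E = 0)%E.
  rewrite !F0 ?subee //.
  + by rewrite normrN; have := ler_norm M'; lra.
  + by have := ler_norm M'; lra.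
rewrite -Fz; apply: (@continuous_FTC2 R (derive1 F) F (- M') M' M'0).
- exact: (continuous_subspaceT cF').
- split => [a _||]; first exact: dF.
  + by apply: cvg_at_right_filter; exact: cF.
  + by apply: cvg_at_left_filter; exact: cF.
- by move=> a _.
Qed.

End divergence.

(** * Square integrable functions on a measurable set *)

Lemma discriminant (R : realFieldType) (X Y Z : R) : 0 <= X -> 0 <= Z ->
  (forall a b, 0 <= a ^+ 2 * X - 2 * a * b * Y + b ^+ 2 * Z) -> Y ^+ 2 <= X * Z.
Proof.
move=> X0 Z0 H; have := H Y X.
have [Xz|Xn0] := eqVneq X 0.
  (* a degenerate form is affine in [a], and this [a] makes it negative unless [Y = 0] *)
  move=> _; rewrite Xz mul0r; have := H ((Z + 1) / (2 * Y)) 1.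
  rewrite Xz => K; have [->|Y0] := eqVneq Y 0; first by rewrite expr0n.
  have E : 2 * ((Z + 1) / (2 * Y)) * 1 * Y = Z + 1 by field.
  by move: K; rewrite E; lra.
have Xp : 0 < X by rewrite lt_neqAle eq_sym Xn0.
rewrite (_ : _ + _ = X * (X * Z - Y ^+ 2)); last by ring.
by rewrite pmulr_rge0 // subr_ge0.
Qed.

Section square_integrable.
Context d {T : measurableType d} {R : realType}.
Variables (mu : {measure set T -> \bar R}) (D : set T).
Hypothesis mD : measurable D.

Definition sqint (f : T -> R) : Prop :=
  measurable_fun D f /\ mu.-integrable D (fun x => (f x ^+ 2)%:E).

Definition ip (f g : T -> R) : R := \int[mu]_(x in D) (f x * g x).
Definition nm (f : T -> R) : R := Num.sqrt (ip f f).

Lemma Lnorm_on2E f :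
  (Lnorm_on mu 2%:E D f `^ 2 = \int[mu]_(x in D) (f x ^+ 2)%:E)%E.
Proof.
rewrite /Lnorm_on poweR_Lnorm ?pnatr_eq0 // [RHS]integral_mkcond.
apply: eq_integral => x _ /=; rewrite !patchE; case: ifPn => _ /=.
  by rewrite powR_mulrn ?normr_ge0 // real_normK ?num_real.
by rewrite normr0 powR0 // pnatr_eq0.
Qed.

Lemma integrable_le (f g : T -> R) : measurable_fun D g ->
  mu.-integrable D (EFin \o f) -> (forall x, D x -> `|g x| <= f x) ->
  mu.-integrable D (EFin \o g).
Proof.
move=> mg intf gf; apply: (le_integrable mD _ _ intf).
  exact/measurable_EFinP.
move=> x Dx /=; rewrite lee_fin; apply: le_trans (gf x Dx) (ler_norm _).
Qed.

Lemma sqintP f : in_L mu 2%:E D f <-> sqint f.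
Proof.
have E0 : (0 <= Lnorm_on mu 2%:E D f)%E by exact: Lnorm_ge0.
split => -[mf foo]; split => //.
  apply/integrableP; split; first by apply/measurable_EFinP; exact: measurable_funX.
  under eq_integral do rewrite gee0_abs ?lee_fin ?sqr_ge0 //.
  by rewrite -Lnorm_on2E; exact: poweR_lty.
have H := integrable_lty mD foo.
have {}H : (\int[mu]_(x in D) (f x ^+ 2)%:E < +oo)%E by exact: H.
move: H; rewrite -Lnorm_on2E; move: E0; case: (Lnorm_on _ _ _ _) => [r|_ |//] //.
  by move=> _ _; exact: ltry.
by rewrite poweRyr ?pnatr_eq0.
Qed.

Lemma sqint_measurable f : sqint f -> measurable_fun D f.
Proof. by case. Qed.

Lemma sqint_ipE f : sqint f -> (\int[mu]_(x in D) (f x ^+ 2)%:E = (ip f f)%:E)%E.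
Proof.
move=> [_ intf]; rewrite /ip /Rintegral fineK.
  by apply: eq_integral => x _; rewrite expr2.
rewrite (_ : (fun x => (f x * f x)%:E) = (fun x => (f x ^+ 2)%:E)); last first.
  by apply/funext => x; rewrite expr2.
exact: integrable_fin_num.
Qed.

Lemma Lnorm_on2_nm f : sqint f -> Lnorm_on mu 2%:E D f = (nm f)%:E.
Proof.
move=> Lf; have [mf foo] := (sqintP f).2 Lf.
have := sqint_ipE Lf; rewrite -Lnorm_on2E.
have : (0 <= Lnorm_on mu 2%:E D f)%E by exact: Lnorm_ge0.
move: foo; case: (Lnorm_on _ _ _ _) => [r _|//|//].
rewrite lee_fin => r0; rewrite poweR_EFin powR_mulrn // => -[rE].
by rewrite /nm -rE sqrtr_sqr ger0_norm.
Qed.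

Lemma sqintM_integrable f g : sqint f -> sqint g ->
  mu.-integrable D (fun x => (f x * g x)%:E).
Proof.
move=> [mf intf] [mg intg].
have := integrableD mD intf intg; move/(integrable_le (g := f \* g)); apply.
  exact: measurable_funM.
move=> x Dx /=; rewrite normrM; have := sqr_ge0 (`|f x| - `|g x|).
rewrite sqrrB !real_normK ?num_real // => H.
have := mulr_ge0 (normr_ge0 (f x)) (normr_ge0 (g x)); lra.
Qed.

Lemma sqint_le (f g : T -> R) : sqint f -> measurable_fun D g ->
  (forall x, D x -> `|g x| <= `|f x|) -> sqint g.
Proof.
move=> [mf intf] mg gf; split => //; apply: (integrable_le _ intf).
  exact: measurable_funX.
move=> x Dx /=; rewrite ger0_norm ?sqr_ge0 //.
by rewrite -[g x ^+ 2]real_normK ?num_real // -[f x ^+ 2]real_normK ?num_real // lerXn2r ?nnegrE ?gf.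
Qed.

Lemma sqintZ a f : sqint f -> sqint (fun x => a * f x).
Proof.
move=> [mf intf]; split; first exact: measurable_funM.
have := integrableZl mD (a ^+ 2) intf; apply: eq_integrable => // x _ /=.
by rewrite exprMn.
Qed.

Lemma sqintD f g : sqint f -> sqint g -> sqint (f \+ g).
Proof.
move=> Lf Lg; have [mf intf] := Lf; have [mg intg] := Lg; split.
  exact: measurable_funD.
have h1 := integrableD mD intf intg.
have h2 := integrableZl mD 2 (sqintM_integrable Lf Lg).
have := integrableD mD h1 h2; apply: eq_integrable => // x _ /=.
by rewrite -EFinM -!EFinD; congr EFin; ring.
Qed.

Lemma sqintN f : sqint f -> sqint (\- f).
Proof.
move=> /(sqintZ (-1)).
by rewrite (_ : (fun x => _) = \- f) //; apply/funext => x; exact: mulN1r.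
Qed.

Lemma sqintB f g : sqint f -> sqint g -> sqint (f \- g).
Proof. by move=> Lf Lg; apply: (@sqintD f (\- g)) => //; exact: sqintN. Qed.

Lemma ipC f g : ip f g = ip g f.
Proof. by apply: eq_Rintegral => x _; rewrite mulrC. Qed.

Lemma ipDl f g h : sqint f -> sqint g -> sqint h -> ip (f \+ g) h = ip f h + ip g h.
Proof.
move=> Lf Lg Lh; rewrite /ip -RintegralD //; try exact: sqintM_integrable.
by apply: eq_Rintegral => x _ /=; rewrite mulrDl.
Qed.

Lemma ipZl a f g : sqint f -> sqint g -> ip (fun x => a * f x) g = a * ip f g.
Proof.
move=> Lf Lg; rewrite /ip -RintegralZl //; last exact: sqintM_integrable.
by apply: eq_Rintegral => x _ /=; rewrite mulrA.
Qed.

Lemma ipBl f g h : sqint f -> sqint g -> sqint h -> ip (f \- g) h = ip f h - ip g h.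
Proof.
move=> Lf Lg Lh; rewrite /ip -RintegralB //; try exact: sqintM_integrable.
by apply: eq_Rintegral => x _ /=; rewrite mulrBl.
Qed.

Lemma ipBr f g h : sqint f -> sqint g -> sqint h -> ip h (f \- g) = ip h f - ip h g.
Proof. by move=> Lf Lg Lh; rewrite ipC ipBl // !(ipC h). Qed.

Lemma ip_ge0 f : 0 <= ip f f.
Proof. by apply: Rintegral_ge0 => x _; rewrite -expr2 sqr_ge0. Qed.

Lemma nm_ge0 f : 0 <= nm f. Proof. exact: sqrtr_ge0. Qed.

Lemma sqr_nm f : nm f ^+ 2 = ip f f.
Proof. by rewrite sqr_sqrtr // ip_ge0. Qed.

(** Cauchy-Schwarz, from the sign of the discriminant. *)
Lemma ip_le_nm f g : sqint f -> sqint g -> `|ip f g| <= nm f * nm g.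
Proof.
move=> Lf Lg; rewrite -(@ler_pXn2r _ 2) ?nnegrE ?normr_ge0 ?mulr_ge0 ?nm_ge0 //.
rewrite real_normK ?num_real // exprMn !sqr_nm.
have H (a b : R) : 0 <= a ^+ 2 * ip f f - 2 * a * b * ip f g + b ^+ 2 * ip g g.
  have Lh : sqint (fun x => a * f x) by exact: sqintZ.
  have Lk : sqint (fun x => b * g x) by exact: sqintZ.
  have := ip_ge0 ((fun x => a * f x) \- (fun x => b * g x)).
  rewrite ipBl //; last exact: sqintB.
  rewrite !ipBr // !ipZl // !(ipC _ (fun x => _ * _)) !ipZl // (ipC g f).
  lra.
exact: discriminant (ip_ge0 f) (ip_ge0 g) H.
Qed.

Lemma nmD_le f g : sqint f -> sqint g -> nm (f \+ g) <= nm f + nm g.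
Proof.
move=> Lf Lg; rewrite -(@ler_pXn2r _ 2) ?nnegrE ?addr_ge0 ?nm_ge0 //.
rewrite sqrrD !sqr_nm ipDl //; last exact: sqintD.
rewrite !(ipC _ (f \+ g)) !ipDl // (ipC g f).
have := ip_le_nm Lf Lg; have := ler_norm (ip f g); lra.
Qed.

Lemma nm_le (f g : T -> R) : sqint f -> measurable_fun D g ->
  (forall x, D x -> `|g x| <= `|f x|) -> nm g <= nm f.
Proof.
move=> Lf mg gf; have Lg := sqint_le Lf mg gf.
apply: ler_wsqrtr; apply: le_Rintegral => //; try exact: sqintM_integrable.
move=> x Dx; rewrite -!expr2.
by rewrite -[g x ^+ 2]real_normK ?num_real // -[f x ^+ 2]real_normK ?num_real // lerXn2r ?nnegrE ?gf.
Qed.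

Lemma nmZ a f : sqint f -> nm (fun x => a * f x) = `|a| * nm f.
Proof.
move=> Lf; rewrite /nm ipZl //; last exact: sqintZ.
rewrite ipC ipZl // mulrA -expr2 sqrtrM ?sqr_ge0 // sqrtr_sqr //.
Qed.

(** The difference splits as [ip (f_ i - f) (g_ i) + ip f (g_ i - g)], to which
    Cauchy-Schwarz applies since the norms of the [g_ i] stay bounded. *)
Lemma ip_cvg I (F : set_system I) {FF : Filter F} (f_ g_ : I -> T -> R) f g :
  (\forall i \near F, sqint (f_ i)) -> (\forall i \near F, sqint (g_ i)) ->
  sqint f -> sqint g ->
  nm (f_ i \- f) @[i --> F] --> (0 : R) -> nm (g_ i \- g) @[i --> F] --> (0 : R) ->
  ip (f_ i) (g_ i) @[i --> F] --> ip f g.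
Proof.
move=> Lf_ Lg_ Lf Lg cf cg.
have cB : nm (f_ i \- f) * (nm g + nm (g_ i \- g)) + nm f * nm (g_ i \- g)
    @[i --> F] --> (0 : R).
  rewrite -[X in _ --> X](_ : 0 * (nm g + 0) + nm f * 0 = _); last by rewrite mul0r mulr0 addr0.
  apply: cvgD; last by apply: cvgM => //; exact: cvg_cst.
  by apply: cvgM => //; apply: cvgD => //; exact: cvg_cst.
apply/cvgrPdist_le => e e0.
have B := (cvgr0Pnorm_le (F := F) _).1 cB e e0.
apply: filterS3 Lf_ Lg_ (B FF) => i Lfi Lgi /=; apply: le_trans.
rewrite [leRHS]ger0_norm; last by rewrite addr_ge0 ?mulr_ge0 ?addr_ge0 ?nm_ge0.
rewrite (_ : ip f g - _ = - (ip (f_ i \- f) (g_ i) + ip f (g_ i \- g))); last first.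
  by rewrite ipBl // ipBr //; ring.
have Lfd : sqint (f_ i \- f) by exact: sqintB.
have Lgd : sqint (g_ i \- g) by exact: sqintB.
rewrite normrN; apply: le_trans (ler_normD _ _) _; apply: lerD; last exact: ip_le_nm.
apply: le_trans (ip_le_nm Lfd Lgi) _; apply: ler_wpM2l; first exact: nm_ge0.
have := nmD_le Lg Lgd; rewrite (_ : g \+ (g_ i \- g) = g_ i) //.
by apply/funext => x /=; ring.
Qed.

End square_integrable.

(** * A smooth convex truncation *)

Section truncation.
Context {R : realType}.
Implicit Types s a b : R.

(** A convex function vanishing exactly on the negative half-line, with
    quadratic growth, and twice continuously differentiable: composing its
    derivative [eta] with a C^1 function gives a C^1 function, which the
    positive part would not. *)
Definition H s : R := if s <= 0 then 0 else s ^+ 3 / (1 + s).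
Definition eta s : R := if s <= 0 then 0 else 2 * s - 1 + ((1 + s) ^+ 2)^-1.
Definition eta' s : R := if s <= 0 then 0 else 2 - 2 * ((1 + s) ^+ 3)^-1.

Lemma eta0 s : s <= 0 -> eta s = 0. Proof. by rewrite /eta => ->. Qed.

Lemma H_ge0 s : 0 <= H s.
Proof.
rewrite /H; case: (leP s 0) => // s0; apply: divr_ge0; last lra.
by rewrite exprn_ge0 // ltW.
Qed.

Lemma H_eq0 s : H s = 0 -> s <= 0.
Proof.
rewrite /H; case: (leP s 0) => // s0 /eqP.
by rewrite mulf_eq0 invr_eq0 expf_eq0 /= => /orP[] /eqP; lra.
Qed.

Lemma eta_posE s : 0 < s -> eta s = s ^+ 2 * (3 + 2 * s) / (1 + s) ^+ 2.
Proof.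
move=> s0; rewrite /eta leNgt s0 /=; field; apply/eqP; lra.
Qed.

Lemma eta_ge0 s : 0 <= eta s.
Proof.
have [s0|s0] := leP s 0; first by rewrite eta0.
rewrite eta_posE //; apply: divr_ge0; last exact: sqr_ge0.
by apply: mulr_ge0; [exact: sqr_ge0|lra].
Qed.

Lemma eta_le s : 0 <= s -> eta s <= 2 * s.
Proof.
move=> s0; rewrite /eta; case: (leP s 0) => [_|s1]; first lra.
suff : ((1 + s) ^+ 2)^-1 <= 1 by lra.
by rewrite invf_le1; [apply: exprn_ege1; lra|apply: exprn_gt0; lra].
Qed.

Lemma eta'_ge0 s : 0 <= eta' s.
Proof.
rewrite /eta'; case: (leP s 0) => // s0.
suff : ((1 + s) ^+ 3)^-1 <= 1 by lra.
by rewrite invf_le1; [apply: exprn_ege1; lra|apply: exprn_gt0; lra].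
Qed.

Lemma eta'_le2 s : eta' s <= 2.
Proof.
rewrite /eta'; case: (leP s 0) => // s0.
suff : 0 < ((1 + s) ^+ 3)^-1 by lra.
by rewrite invr_gt0; apply: exprn_gt0; lra.
Qed.

Lemma eta_lip a b : a <= b -> eta b - eta a <= 2 * (b - a).
Proof.
move=> ab; have [a0|a0] := leP a 0.
  rewrite (eta0 a0); have [b0|b0] := leP b 0; first by rewrite eta0 //; lra.
  by have := eta_le (ltW b0); lra.
rewrite /eta !ifF; try by apply/negbTE; rewrite -ltNge; lra.
suff : ((1 + b) ^+ 2)^-1 <= ((1 + a) ^+ 2)^-1 by lra.
rewrite lef_pV2 ?posrE; last 2 first.
- by apply: exprn_gt0; lra.
- by apply: exprn_gt0; lra.
by apply: lerXn2r; rewrite ?nnegrE; lra.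
Qed.

Lemma eta_mono a b : a <= b -> eta a <= eta b.
Proof.
move=> ab; have [a0|a0] := leP a 0; first by rewrite (eta0 a0) eta_ge0.
have b0 : 0 < b by lra.
rewrite /eta !ifF; try by apply/negbTE; rewrite -ltNge; lra.
suff : ((1 + a) ^+ 2)^-1 - ((1 + b) ^+ 2)^-1 <= 2 * (b - a) by lra.
rewrite (_ : _ - _ = (b - a) * ((2 + a + b) / ((1 + a) ^+ 2 * (1 + b) ^+ 2))); last first.
  by field; apply/andP; split; apply/eqP; lra.
rewrite mulrC ler_wpM2r; [by []|lra|].
rewrite ler_pdivrMr; last by rewrite mulr_gt0 // exprn_gt0 //; lra.
have ab0 : 0 <= a * b by rewrite mulr_ge0 //; lra.
have aab0 : 0 <= a * a * b by rewrite !mulr_ge0 //; lra.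
have bab0 : 0 <= b * a * b by rewrite !mulr_ge0 //; lra.
have aabb0 : 0 <= a * a * b * b by rewrite !mulr_ge0 //; lra.
have := sqr_ge0 a; have := sqr_ge0 b; rewrite !expr2; lra.
Qed.

Lemma eta_lip_norm a b : `|eta b - eta a| <= 2 * `|b - a|.
Proof.
wlog ab : a b / a <= b => [H'|].
  case/orP: (le_total a b) => ab; first exact: H'.
  by rewrite distrC (distrC b); exact: H'.
rewrite ger0_norm ?subr_ge0 ?eta_mono // ger0_norm ?subr_ge0 //.
exact: eta_lip.
Qed.

(** This is [0 <= H'' <= 2], checked algebraically after clearing denominators,
    according to the signs of [a] and [b]. *)
Lemma H_taylor a b : 0 <= H b - H a - eta a * (b - a) <= (b - a) ^+ 2.
Proof.
have [a0|a0] := leP a 0.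
  rewrite (eta0 a0) mul0r !subr0 {2 4}/H a0 subr0 H_ge0 /=.
  rewrite /H; case: (leP b 0) => b0; first exact: sqr_ge0.
  rewrite ler_pdivrMr; last lra.
  have ab : 0 <= - a * b by rewrite mulr_ge0 //; lra.
  have abb : 0 <= - a * b * b by rewrite !mulr_ge0 //; lra.
  have aab : 0 <= - a * - a * b by rewrite !mulr_ge0 //; lra.
  have := sqr_ge0 a; have := sqr_ge0 b; rewrite !expr2 !exprS expr0; lra.
have [b0|b0] := leP b 0.
  rewrite {1 3}/H b0 sub0r.
  rewrite /H ifF; last by apply/negbTE; rewrite -ltNge.
  rewrite eta_posE //.
  have -> : - (a ^+ 3 / (1 + a)) - a ^+ 2 * (3 + 2 * a) / (1 + a) ^+ 2 * (b - a) =
    (a ^+ 3 * (2 + a) + a ^+ 2 * (3 + 2 * a) * - b) / (1 + a) ^+ 2.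
    by field; apply/eqP; lra.
  have nb : 0 <= - b by lra.
  have p0 : 0 < (1 + a) ^+ 2 by apply: exprn_gt0; lra.
  have a2 := sqr_ge0 a.
  have a3 : 0 <= a ^+ 3 by apply: exprn_ge0; exact: ltW.
  apply/andP; split.
    apply: divr_ge0; last exact: ltW.
    by apply: addr_ge0; apply: mulr_ge0 => //; [lra|apply: mulr_ge0 => //; lra].
  rewrite ler_pdivrMr //.
  have n1 : 0 <= - b * a by rewrite mulr_ge0 //; lra.
  have n2 : 0 <= - b * a * a by rewrite !mulr_ge0 //; lra.
  have n4 : 0 <= - b * - b by rewrite !mulr_ge0 //; lra.
  have n5 : 0 <= - b * - b * a by rewrite !mulr_ge0 //; lra.
  have n6 : 0 <= - b * - b * a * a by rewrite !mulr_ge0 //; lra.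
  move: a2; rewrite !expr2 !exprS expr0; lra.
rewrite /H !ifF; try by apply/negbTE; rewrite -ltNge.
rewrite eta_posE //.
have -> : b ^+ 3 / (1 + b) - a ^+ 3 / (1 + a) - a ^+ 2 * (3 + 2 * a) / (1 + a) ^+ 2 * (b - a) =
   (b - a) ^+ 2 * ((a ^+ 2 * b + 2 * a * b + a ^+ 2 + b + 2 * a) / ((1 + a) ^+ 2 * (1 + b))).
  by field; apply/andP; split; apply/eqP; lra.
have ab0 : 0 <= a * b by rewrite mulr_ge0 //; lra.
have aab0 : 0 <= a ^+ 2 * b by rewrite mulr_ge0 ?sqr_ge0 //; lra.
have a2 := sqr_ge0 a.
have p0 : 0 < (1 + a) ^+ 2 * (1 + b) by rewrite mulr_gt0 ?exprn_gt0 //; lra.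
apply/andP; split.
  by apply: mulr_ge0; [exact: sqr_ge0|apply: divr_ge0; [lra|exact: ltW]].
rewrite -[leRHS]mulr1 ler_wpM2l ?sqr_ge0 // ler_pdivrMr // mul1r.
move: aab0 a2; rewrite !expr2; lra.
Qed.

Lemma H_le s : H s <= s ^+ 2.
Proof.
have /andP[_] := H_taylor 0 s.
by rewrite (@eta0 0) // mul0r !subr0 {2}/H lexx subr0.
Qed.

Lemma H_mono a b : a <= b -> H a <= H b.
Proof.
move=> ab; have /andP[h _] := H_taylor a b.
have := mulr_ge0 (eta_ge0 a) (_ : 0 <= b - a); rewrite subr_ge0 => /(_ ab); lra.
Qed.

(** A quadratic error with a uniform constant gives differentiability also at 0,
    where the two branches of [eta] meet. *)
Lemma eta_taylor a b : `|eta b - eta a - eta' a * (b - a)| <= 6 * (b - a) ^+ 2.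
Proof.
have eta3 s : eta s <= 3 * s ^+ 2.
  have [s0|s0] := leP s 0; first by rewrite eta0 // mulr_ge0 // sqr_ge0.
  rewrite eta_posE // ler_pdivrMr; last by apply: exprn_gt0; lra.
  have h1 : 0 <= s * s * s by rewrite !mulr_ge0 // ltW.
  have h2 : 0 <= s * s * s * s by rewrite !mulr_ge0 // ltW.
  rewrite !expr2; lra.
have [a0|a0] := leP a 0.
  rewrite (eta0 a0) /eta' a0 mul0r !subr0 ger0_norm ?eta_ge0 //.
  have [b0|b0] := leP b 0; first by rewrite eta0 // mulr_ge0 // sqr_ge0.
  apply: le_trans (eta3 b) _.
  have h : 0 <= - a * b by rewrite mulr_ge0 //; lra.
  have := sqr_ge0 a; have := sqr_ge0 b; rewrite !expr2; lra.
have [b0|b0] := leP b 0.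
  have h1 := eta3 a; have h2 := eta_ge0 a.
  have e1 : eta' a <= 6 * a.
    rewrite /eta' (leNgt a) a0 /=.
    have p0 : 0 < (1 + a) ^+ 3 by apply: exprn_gt0; lra.
    suff : 1 - 3 * a <= ((1 + a) ^+ 3)^-1 by lra.
    rewrite -[((1 + a) ^+ 3)^-1]mul1r ler_pdivlMr //.
    have q1 : 0 <= a * a by rewrite !mulr_ge0 // ltW.
    have q2 : 0 <= a * a * a by rewrite !mulr_ge0 // ltW.
    have q3 : 0 <= a * a * a * a by rewrite !mulr_ge0 // ltW.
    rewrite !exprS expr0; lra.
  have e3 : eta' a * (a - b) <= 6 * a * (a - b) by rewrite ler_wpM2r //; lra.
  have n1 : 0 <= - b * a by rewrite mulr_ge0 //; lra.
  have := sqr_ge0 b; have := sqr_ge0 a.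
  rewrite (eta0 b0) !expr2 ler_norml in h1 *; move=> *.
  have e2' : 0 <= eta' a * (a - b) by apply: mulr_ge0; [exact: eta'_ge0|lra].
  apply/andP; split; lra.
rewrite /eta /eta' !ifF; try by apply/negbTE; rewrite -ltNge.
have -> : 2 * b - 1 + ((1 + b) ^+ 2)^-1 - (2 * a - 1 + ((1 + a) ^+ 2)^-1) -
    (2 - 2 * ((1 + a) ^+ 3)^-1) * (b - a) =
   (3 + a + 2 * b) / ((1 + a) ^+ 3 * (1 + b) ^+ 2) * (b - a) ^+ 2.
  by field; apply/andP; split; apply/eqP; lra.
have p0 : 0 < (1 + a) ^+ 3 by apply: exprn_gt0; lra.
have q0 : 0 < (1 + b) ^+ 2 by apply: exprn_gt0; lra.
rewrite ger0_norm; last first.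
  by apply: mulr_ge0; [apply: divr_ge0; [lra|rewrite mulr_ge0 // ltW]|exact: sqr_ge0].
rewrite ler_wpM2r ?sqr_ge0 // ler_pdivrMr ?(mulr_gt0 p0 q0) //.
have h1 : 1 + a <= (1 + a) ^+ 3 by apply: ler_eXnr => //; lra.
have h2 : 1 + b <= (1 + b) ^+ 2 by apply: ler_eXnr => //; lra.
have a1 : 1 <= (1 + a) ^+ 3 by apply: exprn_ege1; lra.
have b1 : 1 <= (1 + b) ^+ 2 by apply: exprn_ege1; lra.
have h3 : (1 + a) ^+ 3 <= (1 + a) ^+ 3 * (1 + b) ^+ 2 by rewrite ler_peMr // ltW.
have h4 : (1 + b) ^+ 2 <= (1 + a) ^+ 3 * (1 + b) ^+ 2 by rewrite ler_peMl // ltW.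
lra.
Qed.

Lemma eta'_lip a b : `|eta' b - eta' a| <= 6 * `|b - a|.
Proof.
wlog ab : a b / a <= b => [H'|].
  case/orP: (le_total a b) => ab; first exact: H'.
  by rewrite distrC (distrC b); exact: H'.
rewrite (ger0_norm (_ : 0 <= b - a)); last lra.
have [b0|b0] := leP b 0.
  by rewrite /eta' b0 (le_trans ab b0) subrr normr0; lra.
have key (c : R) : 0 <= c -> c <= b -> ((1 + c) ^+ 3)^-1 - ((1 + b) ^+ 3)^-1 <= 3 * (b - c) /\
    0 <= ((1 + c) ^+ 3)^-1 - ((1 + b) ^+ 3)^-1.
  move=> c0 cb.
  have cp : 0 < (1 + c) ^+ 3 by apply: exprn_gt0; lra.
  have bp : 0 < (1 + b) ^+ 3 by apply: exprn_gt0; lra.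
  rewrite (_ : _ - _ = (b - c) * (((1 + b) ^+ 2 + (1 + b) * (1 + c) + (1 + c) ^+ 2) /
     ((1 + b) ^+ 3 * (1 + c) ^+ 3))); last by field; apply/andP; split; apply/eqP; lra.
  have q0 : 0 <= (1 + b) ^+ 2 + (1 + b) * (1 + c) + (1 + c) ^+ 2.
    by rewrite !addr_ge0 ?sqr_ge0 // mulr_ge0 //; lra.
  split; last by apply: mulr_ge0; [lra|apply: divr_ge0 => //; rewrite mulr_ge0 // ltW].
  rewrite mulrC ler_wpM2r //; first lra.
  rewrite ler_pdivrMr ?(mulr_gt0 bp cp) //.
  have b1 : 1 <= (1 + b) ^+ 3 by apply: exprn_ege1; lra.
  have c1 : 1 <= (1 + c) ^+ 3 by apply: exprn_ege1; lra.
  have h1 : (1 + b) ^+ 2 <= (1 + b) ^+ 3 by apply: ler_weXn2l => //; lra.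
  have h2 : (1 + c) ^+ 2 <= (1 + b) ^+ 2 by apply: lerXn2r; rewrite ?nnegrE; lra.
  have h3 : (1 + b) * (1 + c) <= (1 + b) ^+ 2 by rewrite expr2 ler_wpM2l //; lra.
  have : (1 + b) ^+ 3 <= (1 + b) ^+ 3 * (1 + c) ^+ 3 by rewrite ler_peMr // ltW.
  lra.
rewrite {1}/eta' (leNgt b) b0 /=.
have [a0|a0] := leP a 0.
  rewrite /eta' a0 subr0; have [] := key 0 (lexx _) (ltW b0).
  rewrite addr0 expr1n invr1 => h1 h2; rewrite ger0_norm; lra.
rewrite /eta' (leNgt a) a0 /=; have [h1 h2] := key a (ltW a0) ab.
rewrite ger0_norm; lra.
Qed.

End truncation.

(** * Testing the Dirichlet Laplacian against truncations *)

Section weights.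
Context {R : realType} {N : nat}.
Local Notation E := 'rV[R]_N.

Lemma dot_shift (l y : E) i (h : R) :
  dot l (h *: delta_mx 0 i + y) = h * l 0 i + dot l y.
Proof.
rewrite /dot (eq_bigr (fun j => h * (l 0 j * (j == i)%:R) + l 0 j * y 0 j)); last first.
  by move=> j _; rewrite !mxE eqxx /=; ring.
rewrite big_split /= -mulr_sumr; congr (_ * _ + _).
rewrite (bigD1 i) //= eqxx mulr1 big1 ?addr0 // => j /negbTE ->.
by rewrite mulr0.
Qed.

Lemma continuous_cstM (X : topologicalType) (a : R) (g : X -> R) :
  continuous g -> continuous (fun x => a * g x).
Proof.
move=> cg x.
have H : {for x, continuous (fun _ : X => a)} by apply: cst_continuous.
exact: (continuousM H (cg x)).
Qed.

Lemma continuous_dot (l : E) : continuous (dot l).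
Proof.
rewrite /dot; apply: continuous_big => [|i _ y]; first exact: add_continuous.
exact: (@continuous_cstM _ (l 0 i) (fun z : E => z 0 i) (@coord_continuous _ _ _ _ _)).
Qed.

(** Exponentials of linear forms are eigenfunctions of the Laplacian with constant
    logarithmic gradient; the factor [b] includes the zero function. *)
Definition wexp (b : R) (l y : E) : R := b * expR (dot l y).

Lemma continuous_wexp b l : continuous (wexp b l).
Proof.
apply: continuous_cstM => y.
by apply: (@continuous_comp _ _ _ (dot l) (@expR R)); [exact: continuous_dot|exact: continuous_expR].
Qed.

Lemma is_derive_wexp b l y i :
  is_derive y (delta_mx 0 i : E) (wexp b l) (l 0 i * wexp b l y).
Proof.
pose k (h : R) := wexp b l (h *: delta_mx 0 i + y).
have E0 h : k h = b * expR (h * l 0 i + dot l y) by rewrite /k /wexp dot_shift.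
have D : is_derive (0 : R) 1 k (l 0 i * wexp b l y).
  pose g (h : R) := h * l 0 i + dot l y.
  have -> : k = b \*: (@expR R \o g) by apply/funext => h; rewrite E0.
  have D1 : is_derive (0 : R) 1 g (l 0 i).
    by apply: is_derive_eq; rewrite /GRing.scale /=; ring.
  have D2 := @is_derive1_comp R (@expR R) g 0 _ _ (is_derive_expR (g 0)) D1.
  apply: is_derive_eq; rewrite /g mul0r add0r /wexp.
  by rewrite /GRing.scale /=; ring.
have H h : wexp b l (h *: delta_mx 0 i + y) = k (h *: 1 + 0).
  by rewrite /k addr0 /GRing.scale /= mulr1.
apply: DeriveDef; first by apply: (derivable_along H); case: D.
by rewrite (derive_along H); case: D.
Qed.

End weights.

Section chain_rule.
Context {R : realType}.

(** For functions defined by cases this criterion avoids one-sided limits. *)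
Lemma is_derive_taylor (f : R -> R) (a l C : R) :
  (forall b, `|f b - f a - l * (b - a)| <= C * (b - a) ^+ 2) ->
  is_derive a 1 f l.
Proof.
move=> H.
have c : h^-1 *: ((f \o shift a) (h *: 1) - f a) @[h --> (0 : R)^'] --> l.
  apply/cvgrPdist_le => e e0.
  have C0 : 0 < `|C| + 1 by rewrite ltr_wpDl.
  have : \forall h \near (0 : R)^', `|h| <= e / (`|C| + 1).
    apply: nbhs_dnbhs; apply/nbhs_ballP; exists (e / (`|C| + 1)) => /=; first exact: divr_gt0.
    by move=> h; rewrite /ball /= sub0r normrN => /ltW.
  have : \forall h \near (0 : R)^', h != 0 by exact: nbhs_dnbhs_neq.
  apply: filterS2 => h h0 he /=.
  have := H (h + a); rewrite addrK => Hh.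
  have -> : l - h^-1 *: (f (h *: 1 + a) - f a) = - h^-1 * (f (h + a) - f a - l * h).
    by rewrite /GRing.scale /= mulr1; field.
  rewrite normrM normrN normfV ler_pdivrMl ?normr_gt0 //.
  apply: le_trans Hh _; rewrite -[h ^+ 2]real_normK ?num_real // expr2 mulrCA.
  rewrite ler_wpM2l ?normr_ge0 //.
  have Ce : C <= `|C| + 1 by have := ler_norm C; lra.
  apply: le_trans (_ : (`|C| + 1) * `|h| <= _); first by rewrite ler_wpM2r.
  by rewrite mulrC -ler_pdivlMr.
by apply: DeriveDef; [exact: cvgP c|exact: cvg_lim c].
Qed.

Lemma is_derive_eta (s : R) : is_derive s 1 (@eta R) (eta' s).
Proof. by apply: is_derive_taylor => b; exact: eta_taylor. Qed.

Lemma lipschitz_continuous (f : R -> R) C :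
  (forall a b, `|f b - f a| <= C * `|b - a|) -> continuous f.
Proof.
move=> H a; apply/cvgrPdist_le => e e0.
have C0 : 0 < `|C| + 1 by rewrite ltr_wpDl.
apply/nbhs_ballP; exists (e / (`|C| + 1)) => /=; first exact: divr_gt0.
move=> b; rewrite /ball /= => ab; rewrite distrC; apply: le_trans (H _ _) _.
have Ce : C <= `|C| + 1 by have := ler_norm C; lra.
apply: le_trans (_ : (`|C| + 1) * `|b - a| <= _); first by rewrite ler_wpM2r.
by rewrite mulrC -ler_pdivlMr // distrC ltW.
Qed.

Lemma continuous_eta : continuous (@eta R).
Proof. by apply: lipschitz_continuous => a b; exact: eta_lip_norm. Qed.

Lemma continuous_eta' : continuous (@eta' R).
Proof. by apply: lipschitz_continuous => a b; exact: eta'_lip. Qed.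

Lemma is_derive_eta_comp (V : normedModType R) (f : V -> R) (x v : V) :
  derivable f x v -> is_derive x v (fun y => eta (f y)) (eta' (f x) * 'D_v f x).
Proof.
move=> df; pose k (h : R) := f (h *: v + x).
have H h : k (h *: 1 + 0) = f (h *: v + x) by rewrite /k addr0 /GRing.scale /= mulr1.
have dk : is_derive (0 : R) 1 k ('D_v f x).
  apply: DeriveDef; first exact: (derivable_along H).
  exact: (derive_along H).
have D := is_derive1_comp (is_derive_eta (k 0)) dk.
have H' h : eta (f (h *: v + x)) = (@eta R \o k) (h *: 1 + 0) by rewrite /= H.
have k0 : k 0 = f x by rewrite /k scale0r add0r.
rewrite -k0; apply: DeriveDef; first by apply: (derivable_along H'); case: D.
by rewrite (derive_along H'); case: D.
Qed.

End chain_rule.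

Section continuity.
Context {R : realType} (X : topologicalType).

Lemma continuous_addf (f g : X -> R) :
  continuous f -> continuous g -> continuous (fun x => f x + g x).
Proof. by move=> cf cg x; exact: (continuousD (cf x) (cg x)). Qed.

Lemma continuous_subf (f g : X -> R) :
  continuous f -> continuous g -> continuous (fun x => f x - g x).
Proof. by move=> cf cg x; exact: (continuousB (cf x) (cg x)). Qed.

Lemma continuous_mulf (f g : X -> R) :
  continuous f -> continuous g -> continuous (fun x => f x * g x).
Proof. by move=> cf cg x; exact: (continuousM (cf x) (cg x)). Qed.

End continuity.

Section testing.
Context {R : realType} {N : nat}.
Local Notation E := 'rV[R]_N.
Local Notation mu := (lebesgue_rV N : {measure set E -> \bar R}).
Variables (Omega : set E).
Hypothesis oO : open Omega.
Let mO : measurable Omega := open_measurable_rV oO.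
Local Notation sq := (sqint mu Omega).
Local Notation ipO := (ip mu Omega).
Local Notation nmO := (nm mu Omega).

Lemma C1c_support (phi : E -> R) : is_C1c Omega phi ->
  exists M (K : set E), [/\ K `<=` cube M, K `<=` Omega,
    forall x, ~ K x -> phi x = 0 & forall i x, ~ K x -> pd i phi x = 0].
Proof.
move=> [[dphi cphi cpd] [K [cK KO phi0]]].
have [M KM] := compact_sub_cube cK.
exists M, K; split => // i x Kx.
rewrite /pd (near_eq_derive (g := cst 0)); first exact: derive_cst.
have : nbhs x (~` K).
  apply: open_nbhs_nbhs; split => //; apply: closed_openC.
  by apply: compact_closed => //; exact: norm_hausdorff.
by apply: filterS => y /phi0.
Qed.

(** Integrals of test functions over [Omega] are integrals over the whole space,
    to which the divergence theorem applies. *)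
Lemma integral_support (f : E -> R) (K : set E) :
  K `<=` Omega -> (forall x, ~ K x -> f x = 0) ->
  (\int[mu]_(x in Omega) (f x)%:E = \int[mu]_x (f x)%:E)%E.
Proof.
move=> KO f0; rewrite integral_mkcond; apply: eq_integral => x _.
by rewrite patchE; case: ifPn => // /negP xO; rewrite f0 // => /KO /mem_set.
Qed.

Lemma support_integrable (f : E -> R) M :
  continuous f -> (forall x, ~ cube M x -> f x = 0) ->
  mu.-integrable Omega (EFin \o f).
Proof.
move=> cf f0; apply: (integrableS measurableT) => //.
exact: cube_integrable cf f0.
Qed.

Lemma support_sqint (f : E -> R) M :
  continuous f -> (forall x, ~ cube M x -> f x = 0) -> sq f.
Proof.
move=> cf f0; split; first by apply: measurable_funTS; exact: continuous_measurable_rV.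
apply: (support_integrable (f := fun x => f x ^+ 2) (M := M)).
  by move=> x; apply: continuousM => //; exact: cf.
by move=> x /f0 ->; rewrite expr0n.
Qed.

Lemma C1c_sqint (phi : E -> R) : is_C1c Omega phi ->
  sq phi /\ forall i, sq (pd i phi).
Proof.
move=> C; have [M [K [KM KO f0 p0]]] := C1c_support C.
have [[dphi cphi cpd] _] := C; split => [|i].
  by apply: (support_sqint cphi (M := M)) => x xM; apply: f0 => /KM.
by apply: (support_sqint (cpd i) (M := M)) => x xM; apply: p0 => /KM.
Qed.

Lemma C1c_H10 (phi : E -> R) : is_C1c Omega phi -> is_H10 Omega phi (grad phi).
Proof.
move=> C; have [s0 s1] := C1c_sqint C.
have gE i : (fun x => grad phi x 0 i) = pd i phi by apply/funext => x; rewrite mxE.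
split; first exact/sqintP.
  by move=> i; rewrite gE; apply/sqintP.
have L0 (f : E -> R) : (forall x, f x = 0) ->
    (fun _ : nat => Lnorm_on mu 2%:E Omega f) @ \oo --> 0%E.
  move=> f0; rewrite (_ : f = fun=> 0); last exact/funext.
  rewrite Lnorm_on2_nm //; last first.
    by apply: (support_sqint (M := 0)) => //; exact: cst_continuous.
  rewrite /nm /ip /Rintegral; under eq_integral do rewrite mul0r.
  by rewrite integral0 /= sqrtr0; exact: cvg_cst.
exists (fun=> phi); split => // [|i].
  by apply: L0 => x /=; rewrite subrr.
by apply: L0 => x /=; rewrite mxE subrr.
Qed.

(** Integration by parts against an exponential: the flux [rho * psi] has compact
    support. *)
Lemma ibp_wexp b (l : E) (psi : E -> R) i : is_C1c Omega psi ->
  ipO (wexp b l) (pd i psi) = - (l 0 i * ipO (wexp b l) psi).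
Proof.
move=> C; have [M [K [KM KO f0 p0]]] := C1c_support C.
have [[dpsi cpsi cpd] _] := C.
pose rho := wexp b l; pose F x := rho x * psi x.
have dF x : is_derive x (delta_mx 0 i : E) F (l 0 i * rho x * psi x + rho x * pd i psi x).
  have D1 := is_derive_wexp b l x i.
  have D2 : is_derive x (delta_mx 0 i : E) psi (pd i psi x) by apply: DeriveDef; [exact: dpsi|].
  have := is_deriveM D1 D2; move=> D3; apply: is_derive_eq.
  by rewrite /GRing.scale /= /rho; ring.
have pF : pd i F = fun x => l 0 i * (rho x * psi x) + rho x * pd i psi x.
  by apply/funext => x; rewrite /pd (@derive_val _ _ _ _ _ _ _ (dF x)) mulrA.
have crho : continuous rho by exact: continuous_wexp.
have c1 : continuous (fun x => rho x * psi x).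
  by move=> x; apply: continuousM; [exact: crho|exact: cpsi].
have c2 : continuous (fun x => rho x * pd i psi x).
  by move=> x; apply: continuousM; [exact: crho|exact: cpd].
have := @integral_pd0 R N F i M; rewrite pF => /(_ _ _ _) H0.
have {}H0 : (\int[mu]_x (l 0 i * (rho x * psi x) + rho x * pd i psi x)%:E = 0)%E.
  apply: H0 => [x||x xM]; first by case: (dF x).
    by apply: continuous_addf => //; exact: continuous_cstM.
  by rewrite /F f0 ?mulr0 // => /KM.
rewrite -(integral_support KO) in H0; last first.
  by move=> x Kx; rewrite f0 // p0 // !mulr0 addr0.
have i1 : mu.-integrable Omega (EFin \o (fun x => rho x * psi x)).
  by apply: (support_integrable c1 (M := M)) => x xM; rewrite f0 ?mulr0 // => /KM.
have i2 : mu.-integrable Omega (EFin \o (fun x => rho x * pd i psi x)).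
  by apply: (support_integrable c2 (M := M)) => x xM; rewrite p0 ?mulr0 // => /KM.
have i3 : mu.-integrable Omega (EFin \o (fun x => l 0 i * (rho x * psi x))).
  apply: (@support_integrable (fun x => l 0 i * (rho x * psi x)) M).
    exact: continuous_cstM.
  by move=> x xM; rewrite f0 ?mulr0 // => /KM.
have : \int[mu]_(x in Omega) (l 0 i * (rho x * psi x) + rho x * pd i psi x) = 0.
  by rewrite /Rintegral H0.
rewrite RintegralD // RintegralZl // => H1.
by apply/eqP; rewrite -addr_eq0 addrC; apply/eqP.
Qed.

Section smooth_test.
Variables (b c : R) (l : E) (phi : E -> R).
Hypotheses (b0 : 0 <= b) (c0 : 0 <= c) (Cphi : is_C1c Omega phi).
Let psi := fun x => eta (c * phi x - wexp b l x).

Lemma wexp_ge0 x : 0 <= wexp b l x.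
Proof. by rewrite mulr_ge0 // expR_ge0. Qed.

Lemma is_derive_trunc i x : is_derive x (delta_mx 0 i : E) psi
  (eta' (c * phi x - wexp b l x) * (c * pd i phi x - l 0 i * wexp b l x)).
Proof.
have [[dphi _ _] _] := Cphi.
have D1 := is_derive_wexp b l x i.
have D2 : is_derive x (delta_mx 0 i : E) phi (pd i phi x) by apply: DeriveDef; [exact: dphi|].
have D3 : is_derive x (delta_mx 0 i : E) (fun x => c * phi x - wexp b l x)
    (c * pd i phi x - l 0 i * wexp b l x).
  have D4 := is_deriveB (is_deriveZ c D2) D1; apply: is_derive_eq.
  by rewrite /GRing.scale.
have D5 := is_derive_eta_comp (@ex_derive _ _ _ _ _ _ _ D3).
by move: D5; rewrite (@derive_val _ _ _ _ _ _ _ D3).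
Qed.

Lemma pd_trunc i x : pd i psi x =
  eta' (c * phi x - wexp b l x) * (c * pd i phi x - l 0 i * wexp b l x).
Proof. exact: (@derive_val _ _ _ _ _ _ _ (is_derive_trunc i x)). Qed.

(** Subtracting a nonnegative weight keeps the support inside that of [phi], hence
    inside [Omega]: the truncation is admissible in the weak formulation. *)
Lemma trunc_C1c : is_C1c Omega psi.
Proof.
have [[dphi cphi cpd] [K [cK KO phi0]]] := Cphi.
have cs : continuous (fun x => c * phi x - wexp b l x).
  by apply: continuous_subf; [exact: continuous_cstM|exact: continuous_wexp].
split; last first.
  exists K; split => // x Kx; rewrite /psi phi0 // mulr0 sub0r eta0 //.
  by rewrite oppr_le0 wexp_ge0.
split.
- by move=> i x; case: (is_derive_trunc i x).
- move=> x; apply: (@continuous_comp _ _ _ (fun x => c * phi x - wexp b l x) (@eta R)).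
    exact: cs.
  exact: continuous_eta.
- move=> i; rewrite (_ : pd i psi = fun x => eta' (c * phi x - wexp b l x) *
    (c * pd i phi x - l 0 i * wexp b l x)); last by apply/funext => x; exact: pd_trunc.
  apply: continuous_mulf => [x|].
    apply: (@continuous_comp _ _ _ (fun x => c * phi x - wexp b l x) (@eta' R)).
      exact: cs.
    exact: continuous_eta'.
  apply: continuous_subf; apply: continuous_cstM; [exact: cpd|exact: continuous_wexp].
Qed.

(** Where [eta'] does not vanish the weight lies below [c * phi], so that its
    exponential growth does not enter the bound. *)
Lemma trunc_grad_le i x :
  `|pd i psi x| <= 2 * c * `|pd i phi x| + 2 * c * `|l 0 i| * `|phi x|.
Proof.
rewrite pd_trunc; set s := c * phi x - _.
have r0 := wexp_ge0 x.
have [s0|s0] := leP s 0.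
  rewrite {1}/eta' s0 mul0r normr0.
  by rewrite addr_ge0 // ?mulr_ge0.
rewrite normrM (ger0_norm (eta'_ge0 _)).
apply: le_trans (_ : 2 * (c * `|pd i phi x| + `|l 0 i| * (c * `|phi x|)) <= _); last first.
  by rewrite mulrDr !mulrA (mulrAC _ `|l 0 i|) -!mulrA lexx.
apply: ler_pM => //; [exact: eta'_ge0|exact: eta'_le2|].
apply: le_trans (ler_normB _ _) _.
rewrite (normrM c) (normrM (l 0 i)) (ger0_norm c0) lerD2l.
rewrite ler_wpM2l // (ger0_norm r0).
apply: le_trans (_ : c * phi x <= _); first by move: s0; rewrite /s subr_gt0 => /ltW.
by rewrite ler_wpM2l // ler_norm.
Qed.

Lemma trunc_grad_nm i :
  nmO (pd i psi) <= 2 * c * nmO (pd i phi) + 2 * c * `|l 0 i| * nmO phi.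
Proof.
have [s0 s1] := C1c_sqint Cphi; have [t0 t1] := C1c_sqint trunc_C1c.
have abs (f : E -> R) : sq f -> sq (fun x => `|f x|) /\ nmO (fun x => `|f x|) = nmO f.
  move=> sf; split.
    apply: (sqint_le _ sf) => // [|x _]; last by rewrite normr_id.
    by apply: measurableT_comp => //; exact: sqint_measurable sf.
  rewrite /nm /ip; congr Num.sqrt; apply: eq_Rintegral => x _.
  by rewrite -!expr2 real_normK ?num_real.
have [a0 a0E] := abs _ s0; have [a1 a1E] := abs _ (s1 i).
have k0 := sqintZ mO (2 * c * `|l 0 i|) a0; have k1 := sqintZ mO (2 * c) a1.
apply: le_trans (nm_le mO (sqintD mO k1 k0) (sqint_measurable (t1 i)) _) _.
  move=> x _ /=; rewrite (le_trans (trunc_grad_le i x)) // ler_norm //.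
apply: le_trans (nmD_le mO k1 k0) _.
have h1 : 0 <= 2 * c by rewrite mulr_ge0.
have h2 : 0 <= 2 * c * `|l 0 i| by rewrite mulr_ge0.
by rewrite (nmZ mO _ a0) (nmZ mO _ a1) a0E a1E (ger0_norm h1) (ger0_norm h2).
Qed.

(** The test inequality behind the maximum principle. Replacing [g] by the
    gradient of [phi] costs the first term on the right; then
    [(c * pd i phi - pd i (wexp b l)) * pd i psi] is nonnegative, being [eta']
    times a square, and the weight is an eigenfunction of the Laplacian lying
    below [c * phi] wherever the truncation is active. *)
Lemma trunc_test (g : E -> E) i : sq (fun x => g x 0 i) ->
  - (c * ipO (fun x => g x 0 i) (pd i psi)) <=
  c * (nmO (fun x => pd i phi x - g x 0 i) * nmO (pd i psi)) +
  l 0 i ^+ 2 * ipO (fun x => c * phi x) psi.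
Proof.
move=> sg; have [s0 s1] := C1c_sqint Cphi; have [t0 t1] := C1c_sqint trunc_C1c.
have [M [K [KM KO f0 p0]]] := C1c_support trunc_C1c.
have [[_ cpsi cpd] _] := trunc_C1c.
have sd : sq (fun x => pd i phi x - g x 0 i) by exact: sqintB.
have crho := @continuous_wexp R N b l.
have irho (f : E -> R) : continuous f -> (forall x, ~ K x -> f x = 0) ->
    mu.-integrable Omega (fun x => (wexp b l x * f x)%:E).
  move=> cf fK; apply: (support_integrable (f := fun x => wexp b l x * f x) (M := M)).
    by move=> x; apply: continuousM; [exact: crho|exact: cf].
  by move=> x xM; rewrite fK ?mulr0 // => /KM.
have e1 : c * ipO (pd i phi) (pd i psi) - c * ipO (fun x => g x 0 i) (pd i psi) <=
    c * (nmO (fun x => pd i phi x - g x 0 i) * nmO (pd i psi)).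
  rewrite -mulrBr ler_wpM2l // -(ipBl mO) //.
  by apply: le_trans (ler_norm _) _; exact: (ip_le_nm mO sd (t1 i)).
have e2 : l 0 i * ipO (wexp b l) (pd i psi) <= c * ipO (pd i phi) (pd i psi).
  rewrite -(ipZl mO c (s1 i) (t1 i)) /ip -RintegralZl //; last exact: (irho _ (cpd i) (p0 i)).
  apply: le_Rintegral => //.
  - have := irho (fun x => l 0 i * pd i psi x).
    rewrite (_ : (fun x => (wexp b l x * (l 0 i * pd i psi x))%:E) =
       EFin \o (fun x => l 0 i * (wexp b l x * pd i psi x))); last first.
      by apply/funext => x /=; congr EFin; ring.
    apply; first exact: continuous_cstM.
    by move=> x Kx; rewrite p0 ?mulr0.
  - by apply: (sqintM_integrable mO) => //; exact: sqintZ.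
  move=> x _; rewrite -subr_ge0 mulrA -mulrBl pd_trunc mulrCA.
  by rewrite mulr_ge0 ?eta'_ge0 // -expr2 sqr_ge0.
have e3 : ipO (wexp b l) psi <= ipO (fun x => c * phi x) psi.
  apply: le_Rintegral => //; first exact: (irho _ cpsi f0).
    by apply: (sqintM_integrable mO) => //; exact: sqintZ.
  move=> x _; have [s|s] := leP (c * phi x - wexp b l x) 0.
    by rewrite /psi eta0 // !mulr0.
  by rewrite ler_wpM2r ?eta_ge0 //; move: s; rewrite subr_gt0 => /ltW.
rewrite ibp_wexp in e2; last exact: trunc_C1c.
have e4 := ler_wpM2l (sqr_ge0 (l 0 i)) e3.
have arith (a G P X Y Z : R) : P - G <= Z -> a * - (a * X) <= P ->
    a ^+ 2 * X <= a ^+ 2 * Y -> - G <= Z + a ^+ 2 * Y.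
  by rewrite !expr2; lra.
exact: arith e1 e2 e4.
Qed.

End smooth_test.
End testing.

Section real_limits.
Context {R : realType} (I : Type) (F : set_system I) {FF : Filter F}.
Implicit Types a b : I -> R.

Lemma cvg_mull (k l : R) a : a i @[i --> F] --> l -> k * a i @[i --> F] --> k * l.
Proof. by move=> H; apply: cvgM => //; exact: cvg_cst. Qed.

Lemma squeeze0 a b : (\forall i \near F, 0 <= a i <= b i) ->
  b i @[i --> F] --> (0 : R) -> a i @[i --> F] --> (0 : R).
Proof. by move=> H cb; apply: (squeeze_cvgr H _ cb); exact: cvg_cst. Qed.

Lemma cvg_sumr (J : Type) (s : seq J) (a : J -> I -> R) (l : J -> R) :
  (forall j, a j i @[i --> F] --> l j) ->
  \sum_(j <- s) a j i @[i --> F] --> \sum_(j <- s) l j.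
Proof.
move=> H; elim: s => [|j s IH].
  rewrite big_nil (_ : (fun _ => _) = cst 0); first exact: cvg_cst.
  by apply/funext => i; rewrite big_nil.
rewrite big_cons (_ : (fun i => _) = (fun i => a j i + \sum_(j <- s) a j i)).
  exact: cvgD.
by apply/funext => i; rewrite big_cons.
Qed.

End real_limits.

Section dissipation.
Context {R : realType} {N : nat}.
Local Notation E := 'rV[R]_N.
Local Notation mu := (lebesgue_rV N : {measure set E -> \bar R}).
Variables (Omega : set E).
Hypothesis oO : open Omega.
Let mO : measurable Omega := open_measurable_rV oO.
Local Notation sq := (sqint mu Omega).
Local Notation ipO := (ip mu Omega).
Local Notation nmO := (nm mu Omega).

Lemma Lnorm_cvg0 I (F : set_system I) {FF : Filter F} (f_ : I -> E -> R) :
  (\forall i \near F, sq (f_ i)) ->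
  Lnorm_on mu 2%:E Omega (f_ i) @[i --> F] --> 0%E ->
  nmO (f_ i) @[i --> F] --> (0 : R).
Proof.
move=> sf c; apply: cvg_trans (fine_cvg c); apply: near_eq_cvg.
by apply: filterS sf => i sfi /=; rewrite (Lnorm_on2_nm mO sfi).
Qed.

Lemma trunc_measurable b c l (u : E -> R) : measurable_fun Omega u ->
  measurable_fun Omega (fun x => eta (c * u x - wexp b l x)).
Proof.
move=> mu_; apply: (measurableT_comp (f := @eta R)).
  by apply: continuous_measurable_fun; exact: continuous_eta.
apply: measurable_funB; first exact: measurable_funM.
apply: measurable_funTS; apply: continuous_measurable_rV; exact: continuous_wexp.
Qed.

Lemma trunc_sqint b c l (u : E -> R) : 0 <= b -> sq u ->
  sq (fun x => eta (c * u x - wexp b l x)).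
Proof.
move=> b0 su; apply: (sqint_le mO (sqintZ mO (2 * c) su)).
  exact: trunc_measurable (sqint_measurable su).
move=> x _; have r0 := wexp_ge0 l b0 x.
have [s|s] := leP (c * u x - wexp b l x) 0; first by rewrite eta0 // normr0.
rewrite ger0_norm ?eta_ge0 //; apply: le_trans (eta_le (ltW s)) _.
rewrite -mulrA normrM ger0_norm // ler_wpM2l //.
by apply: le_trans (ler_norm _); rewrite lerBlDr lerDl.
Qed.

Lemma nm_triangle (f g : E -> R) : sq f -> sq g -> nmO f <= nmO g + nmO (fun x => f x - g x).
Proof.
move=> sf sg; have := nmD_le mO sg (sqintB mO sf sg).
by rewrite (_ : g \+ (f \- g) = f) //; apply/funext => x /=; rewrite addrC subrK.
Qed.

Lemma Rintegral_bigD (I : Type) (s : seq I) (h : I -> E -> R) :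
  (forall i, mu.-integrable Omega (EFin \o h i)) ->
  mu.-integrable Omega (EFin \o (fun x => \sum_(i <- s) h i x)) /\
  \int[mu]_(x in Omega) (\sum_(i <- s) h i x) =
  \sum_(i <- s) \int[mu]_(x in Omega) h i x.
Proof.
move=> ih; elim: s => [|i s [IH1 IH2]].
  have -> : (fun x => \sum_(i <- [::]) h i x) = cst 0.
    by apply/funext => x; rewrite big_nil.
  split; first exact: integrable0.
  by rewrite big_nil /Rintegral integral0.
have -> : (fun x => \sum_(j <- i :: s) h j x) = (fun x => h i x + \sum_(j <- s) h j x).
  by apply/funext => x; rewrite big_cons.
split; last by rewrite big_cons -IH2 RintegralD.
exact: (integrableD mO (ih i) IH1).
Qed.

(** Testing the equation for [u] with the truncation of approximating test
    functions, and passing to the limit in the energy norm. *)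
Lemma dissipation b c (l : E) (u f : E -> R) : 0 <= b -> 0 <= c ->
  is_dirichlet_laplacian Omega u f ->
  c * ipO f (fun x => eta (c * u x - wexp b l x)) <=
  dot l l * ipO (fun x => c * u x) (fun x => eta (c * u x - wexp b l x)).
Proof.
move=> b0 c0 [g [[/(sqintP mu mO) su sg [phi [Cphi cphi cgrad]]] /(sqintP mu mO) sf weak]].
have {}sg i : sq (fun x => g x 0 i) by apply/(sqintP mu mO).
have sphi n : sq (phi n) by have [] := C1c_sqint oO (Cphi n).
have sgrad n i : sq (pd i (phi n)) by have [_] := C1c_sqint oO (Cphi n).
pose psi n x := eta (c * phi n x - wexp b l x).
pose psi0 x := eta (c * u x - wexp b l x).
have Cpsi n : is_C1c Omega (psi n) by exact: trunc_C1c.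
have spsi n : sq (psi n) by have [] := C1c_sqint oO (Cpsi n).
have spgrad n i : sq (pd i (psi n)) by have [_] := C1c_sqint oO (Cpsi n).
have spsi0 : sq psi0 by exact: trunc_sqint.
have {}cphi : nmO (phi n \- u) @[n --> \oo] --> (0 : R).
  by apply: Lnorm_cvg0 => //; apply: nearW => n; exact: sqintB.
have {}cgrad i : nmO (fun x => pd i (phi n) x - g x 0 i) @[n --> \oo] --> (0 : R).
  by apply: Lnorm_cvg0 => //; apply: nearW => n; exact: (sqintB mO (sgrad n i) (sg i)).
have cpsi : nmO (psi n \- psi0) @[n --> \oo] --> (0 : R).
  apply: (@squeeze0 _ _ _ _ _ (fun n => 2 * c * nmO (phi n \- u))); last first.
    by rewrite -(mulr0 (2 * c)); exact: cvg_mull.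
  apply: nearW => n; rewrite nm_ge0 /=.
  have h2 : 0 <= 2 * c by rewrite mulr_ge0.
  rewrite -[in leRHS](ger0_norm h2) -(nmZ mO) //; last exact: sqintB.
  apply: (nm_le mO); first by apply: sqintZ => //; exact: sqintB.
    exact: sqint_measurable (sqintB mO (spsi n) spsi0).
  move=> x _ /=; apply: le_trans (eta_lip_norm _ _) _.
  rewrite [leRHS]normrM (ger0_norm h2) -mulrA ler_wpM2l //.
  by rewrite opprB addrA subrK -mulrBr normrM (ger0_norm c0).
have test n : c * ipO f (psi n) <=
    \sum_i c * (nmO (fun x => pd i (phi n) x - g x 0 i) * nmO (pd i (psi n))) +
    dot l l * ipO (fun x => c * phi n x) (psi n).
  have W := weak _ _ (C1c_H10 oO (Cpsi n)).
  have -> : c * ipO f (psi n) = \sum_i - (c * ipO (fun x => g x 0 i) (pd i (psi n))).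
    rewrite sumrN -mulr_sumr -mulrN; congr (_ * _).
    apply/eqP; rewrite -eqr_oppLR; apply/eqP; rewrite /ip -W.
    rewrite (_ : (fun x => dot (g x) (grad (psi n) x)) =
       fun x => \sum_i (g x 0 i * pd i (psi n) x)); last first.
      by apply/funext => x; apply: eq_bigr => i _; rewrite mxE.
    by rewrite (Rintegral_bigD _ _).2 // => i; exact: (sqintM_integrable mO).
  rewrite /dot mulr_suml -big_split; apply: ler_sum => i _.
  by have := trunc_test oO l b0 c0 (Cphi n) (sg i); rewrite expr2.
have lim1 : c * ipO f (psi n) @[n --> \oo] --> c * ipO f psi0.
  apply: cvg_mull; apply: (ip_cvg mO) => //; [exact: nearW|exact: nearW|].
  rewrite (_ : (fun=> _) = (fun=> 0)); first exact: cvg_cst.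
  by apply/funext => n; rewrite /nm /ip /Rintegral; under eq_integral do rewrite /= subrr mul0r;
   rewrite integral0 sqrtr0.
have lim2 : dot l l * ipO (fun x => c * phi n x) (psi n) @[n --> \oo] -->
   dot l l * ipO (fun x => c * u x) psi0.
  apply: cvg_mull; apply: (ip_cvg mO) => //; [apply: nearW => n; exact: sqintZ|exact: nearW|exact: sqintZ|].
  rewrite (_ : (fun n => _) = (fun n => `|c| * nmO (phi n \- u))); last first.
    apply/funext => n; rewrite -(nmZ mO) //; last exact: sqintB.
    by congr nm; apply/funext => x /=; rewrite mulrBr.
  by rewrite -(mulr0 `|c|); exact: cvg_mull.
(* the gradients of the truncations are merely bounded, but they meet a factor
   that tends to zero *)
have lim3 i : c * (nmO (fun x => pd i (phi n) x - g x 0 i) * nmO (pd i (psi n))) @[n --> \oo] --> (0 : R).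
  pose B n := c * (nmO (fun x => pd i (phi n) x - g x 0 i) *
     (2 * c * (nmO (fun x => g x 0 i) + nmO (fun x => pd i (phi n) x - g x 0 i)) +
      2 * c * `|l 0 i| * (nmO u + nmO (phi n \- u)))).
  have cB : B n @[n --> \oo] --> (0 : R).
    rewrite -[X in _ --> X](_ : c * (0 * (2 * c * (nmO (fun x => g x 0 i) + 0) +
      2 * c * `|l 0 i| * (nmO u + 0))) = _); last by rewrite mul0r mulr0.
    apply: cvg_mull; apply: cvgM; first exact: cgrad.
    by apply: cvgD; apply: cvg_mull; apply: cvgD => //; exact: cvg_cst.
  apply: squeeze0 cB; apply: nearW => n; rewrite !mulr_ge0 ?nm_ge0 //=.
  rewrite ler_wpM2l // ler_wpM2l ?nm_ge0 //.
  apply: le_trans (trunc_grad_nm oO l b0 c0 (Cphi n) i) _.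
  apply: lerD; rewrite ler_wpM2l ?mulr_ge0 //.
    exact: nm_triangle.
  exact: nm_triangle.
have lim : \sum_i c * (nmO (fun x => pd i (phi n) x - g x 0 i) * nmO (pd i (psi n))) +
    dot l l * ipO (fun x => c * phi n x) (psi n) @[n --> \oo] -->
    \sum_(i < N) 0 + dot l l * ipO (fun x => c * u x) psi0.
  have S2 : forall (A B : nat -> R) (a1 b1 : R), A n @[n --> \oo] --> a1 -> B n @[n --> \oo] --> b1 ->
    A n + B n @[n --> \oo] --> a1 + b1 by move=> A B a1 b1; exact: cvgD.
  by apply: S2; [apply: cvg_sumr => i; exact: lim3|exact: lim2].
rewrite big1 // add0r in lim.
by apply: (ler_cvg_to lim1 lim); exact: nearW.
Qed.

End dissipation.

(** * Comparison with exponentials *)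

Section real_derivatives.
Context {R : realType}.

Lemma is_derive_continuous (f : R -> R) (a l : R) :
  is_derive a 1 f l -> {for a, continuous f}.
Proof. by move=> [df _]; apply/differentiable_continuous/derivable1_diffP. Qed.

Lemma is_derive_H (s : R) : is_derive s 1 (@H R) (eta s).
Proof.
apply: (is_derive_taylor (C := 1)) => b; have /andP[h1 h2] := H_taylor s b.
by rewrite ger0_norm // mul1r.
Qed.

Lemma is_derive_expRN (C t : R) :
  is_derive (0 : R) 1 (fun h => expR (- (C * (t + h)))) (- C * expR (- (C * t))).
Proof.
pose g (h : R) := - (C * (t + h)).
have D1 : is_derive (0 : R) 1 g (- C).
  by apply: is_derive_eq; rewrite /GRing.scale /=; ring.
have D2 := @is_derive1_comp R (@expR R) g 0 _ _ (is_derive_expR (g 0)) D1.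
apply: is_derive_eq; rewrite /g addr0; ring.
Qed.

Lemma is_derive_cvg (f : R -> R) (a l : R) : is_derive a 1 f l ->
  h^-1 * (f (a + h) - f a) @[h --> (0 : R)^'] --> l.
Proof.
move=> [df <-]; move: df; rewrite /derivable /derive => c.
rewrite (_ : (fun h => _) = (fun h => h^-1 *: ((f \o shift a) (h *: 1) - f a))); first exact: c.
by apply/funext => h /=; rewrite [h *: 1]mulr1 (addrC a).
Qed.

Lemma difference_quotient_bound (P Q F a n m h : R) : h != 0 ->
  0 <= F - h * (P + Q) -> F - h * (P + Q) <= h ^+ 2 * n -> `|Q| <= a -> n <= m ->
  `|P - h^-1 * F| <= a + `|h| * m.
Proof.
move=> h0; set r := F - _ => r0 rn Qa nm_.
have -> : P - h^-1 * F = - Q - h^-1 * r by rewrite /r; field.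
apply: le_trans (ler_normB _ _) _; rewrite normrN; apply: lerD => //.
rewrite normrM normfV (ger0_norm r0) ler_pdivrMl ?normr_gt0 // mulrA -expr2.
rewrite real_normK ?num_real //; apply: le_trans rn _.
by rewrite ler_wpM2l ?sqr_ge0.
Qed.

End real_derivatives.

Section energy.
Context {R : realType} {N : nat}.
Local Notation E := 'rV[R]_N.
Local Notation mu := (lebesgue_rV N : {measure set E -> \bar R}).
Variables (Omega : set E).
Hypothesis oO : open Omega.
Let mO : measurable Omega := open_measurable_rV oO.
Local Notation sq := (sqint mu Omega).
Local Notation ipO := (ip mu Omega).
Local Notation nmO := (nm mu Omega).
Variables (b : R) (l : E).
Hypothesis b0 : 0 <= b.

(** A smooth substitute for the squared norm of the positive part of
    [v - wexp b l], finite although the weight may not be square integrable. *)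
Definition energy (v : E -> R) : R := \int[mu]_(x in Omega) H (v x - wexp b l x).

Lemma energy_integrable v : sq v ->
  mu.-integrable Omega (fun x => (H (v x - wexp b l x))%:E).
Proof.
move=> sv; have [mv iv] := sv; apply: (integrable_le mO _ iv).
  apply: (measurableT_comp (f := @H R)).
    apply: continuous_measurable_fun => s; exact: is_derive_continuous (is_derive_H s).
  apply: measurable_funB => //.
  apply: measurable_funTS; apply: continuous_measurable_rV; exact: continuous_wexp.
move=> x _; rewrite ger0_norm ?H_ge0 //; have r0 := wexp_ge0 l b0 x.
have [s|s] := leP (v x - wexp b l x) 0.
  by rewrite {1}/H s sqr_ge0.
apply: le_trans (H_le _) _; apply: lerXn2r; rewrite ?nnegrE; try lra.
Qed.

Lemma energy_ge0 v : 0 <= energy v.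
Proof. by apply: Rintegral_ge0 => x _; exact: H_ge0. Qed.

Lemma energy_eq0 v : sq v -> energy v = 0 ->
  \forall x \ae mu, Omega x -> v x <= wexp b l x.
Proof.
move=> sv F0; have iH := energy_integrable sv.
have /integrableP[mH _] := iH.
have : (\int[mu]_(x in Omega) `|(H (v x - wexp b l x))%:E| = 0)%E.
  under eq_integral do rewrite gee0_abs ?lee_fin ?H_ge0 //.
  have := integrable_fin_num mO iH; move/fineK => <-.
  by congr EFin; exact: F0.
move/(ae_eq_integral_abs _ mO mH); apply: filterS => x Hx /Hx /= [] /H_eq0.
by rewrite subr_le0.
Qed.

Lemma energy_le (v f : E -> R) : sq v -> sq f ->
  (forall x, Omega x -> f x <= wexp b l x) -> energy v <= nmO (v \- f) ^+ 2.
Proof.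
move=> sv sf fr; rewrite sqr_nm; have sd := sqintB mO sv sf.
apply: le_Rintegral => //; first exact: energy_integrable.
  exact: sqintM_integrable.
move=> x Ox; apply: le_trans (_ : H (v x - f x) <= _).
  by apply: H_mono; rewrite lerD2l lerN2 fr.
by rewrite -expr2; exact: H_le.
Qed.

(** Integrating the pointwise estimate replaces differentiation under the
    integral sign: along a curve differentiable in norm the energy is
    differentiable. *)
Lemma energy_taylor (v w : E -> R) : sq v -> sq w ->
  0 <= energy w - energy v - ipO (fun x => eta (v x - wexp b l x)) (w \- v)
  <= nmO (w \- v) ^+ 2.
Proof.
move=> sv sw; have sd := sqintB mO sw sv.
have sp : sq (fun x => eta (v x - wexp b l x)).
  have := trunc_sqint oO 1 l b0 sv.
  by rewrite (_ : (fun x => eta (1 * v x - _)) = (fun x => eta (v x - wexp b l x))) //;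
    apply/funext => x; rewrite mul1r.
have iv := energy_integrable sv; have iw := energy_integrable sw.
have ip1 := sqintM_integrable mO sp sd.
have ip2 := sqintM_integrable mO sd sd.
have i1 := integrableB mO iw iv; have i2 := integrableB mO i1 ip1.
rewrite sqr_nm /energy /ip -RintegralB // -RintegralB //.
apply/andP; split.
  apply: Rintegral_ge0 => x _ /=.
  have /andP[h _] := H_taylor (v x - wexp b l x) (w x - wexp b l x).
  by apply: le_trans h _; rewrite opprB addrA subrK.
apply: le_Rintegral => // x _ /=.
have /andP[_ h] := H_taylor (v x - wexp b l x) (w x - wexp b l x).
by move: h; rewrite opprB addrA subrK -expr2.
Qed.

Lemma energy_derive (v : R -> E -> R) (v' : E -> R) t :
  sq (v t) -> (\forall h \near (0 : R)^', sq (v (t + h))) -> sq v' ->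
  nmO (fun x => h^-1 * (v (t + h) x - v t x) - v' x) @[h --> (0 : R)^'] --> (0 : R) ->
  is_derive t 1 (fun s => energy (v s))
    (ipO (fun x => eta (v t x - wexp b l x)) v').
Proof.
move=> sv svh sv' cw.
pose psi x := eta (v t x - wexp b l x).
have sp : sq psi.
  have := trunc_sqint oO 1 l b0 sv.
  by rewrite (_ : (fun x => eta (1 * v t x - _)) = psi) //; apply/funext => x; rewrite mul1r.
pose w h x := h^-1 * (v (t + h) x - v t x) - v' x.
have swh : \forall h \near (0 : R)^', sq (w h).
  apply: filterS svh => h svh; apply: sqintB => //; apply: sqintZ => //; exact: sqintB.
pose B h := nmO psi * nmO (w h) + `|h| * (nmO v' + nmO (w h)) ^+ 2.
have cB : B h @[h --> (0 : R)^'] --> (0 : R).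
  rewrite -[X in _ --> X](_ : nmO psi * 0 + `|0 : R| * (nmO v' + 0) ^+ 2 = _); last first.
    by rewrite mulr0 normr0 mul0r addr0.
  have c0 : (fun h : R => `|h|) @ (0 : R)^' --> `|0 : R|.
    exact: cvg_trans (cvg_app _ (@nbhs_dnbhs _ (0 : R))) (@norm_continuous _ _ (0 : R)).
  have c1 : nmO v' + nmO (w h) @[h --> (0 : R)^'] --> nmO v' + 0.
    by apply: cvgD; [exact: cvg_cst|exact: cw].
  apply: cvgD; first by apply: cvg_mull; exact: cw.
  by apply: cvgM => //; rewrite !expr2; apply: cvgM.
have c : h^-1 *: (((fun s => energy (v s)) \o shift t) (h *: 1) - energy (v t))
    @[h --> (0 : R)^'] --> ipO psi v'.
  apply/cvgrPdist_le => e e0.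
  have Be : \forall h \near (0 : R)^', `|B h| <= e by exact: (cvgr0Pnorm_le _).1.
  have h0 : \forall h \near (0 : R)^', h != 0 by exact: nbhs_dnbhs_neq.
  have Bh0 : \forall h \near (0 : R)^', `|B h| <= e /\ h != 0 by exact: (filterI Be h0).
  apply: filterS3 svh swh Bh0 => h svh' sw [Bh hn0] /=.
  apply: le_trans Bh; rewrite [h *: 1]mulr1 (addrC h).
  have Eh : v (t + h) \- v t = (fun x => h * (v' x + w h x)).
    by apply/funext => x; rewrite /w /=; field.
  have /andP[T1 T2] := energy_taylor sv svh'.
  have svw : sq (fun x => v' x + w h x) by exact: sqintD.
  rewrite Eh (nmZ mO) // (ipC _ _ psi) (ipZl mO) // exprMn real_normK ?num_real // in T1 T2.
  rewrite ipC in T1 T2.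
  have E2 : ipO psi (fun x => v' x + w h x) = ipO psi v' + ipO psi (w h).
    by rewrite ipC (ipDl mO sv' sw sp) !(ipC _ _ psi).
  rewrite E2 in T1 T2.
  have n1 := ip_le_nm mO sp sw; have n2 := nmD_le mO sv' sw.
  have B0 : 0 <= B h by rewrite addr_ge0 // mulr_ge0 ?nm_ge0 ?sqr_ge0.
  rewrite (ger0_norm B0).
  have n3 : nmO (fun x => v' x + w h x) ^+ 2 <= (nmO v' + nmO (w h)) ^+ 2.
    by apply: lerXn2r; rewrite ?nnegrE ?addr_ge0 ?nm_ge0.
  exact: (difference_quotient_bound hn0 T1 T2 n1 n3).
by apply: DeriveDef; [exact: cvgP c|exact: cvg_lim c].
Qed.

(** The product rule in norm for the damping factor [expR (- (C * s))], which turns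
    the growth rate of the weight into a decay of the energy. *)
Lemma scaled_derivative (u : R -> E -> R) (u' : E -> R) (C t : R) :
  sq (u t) -> (\forall h \near (0 : R)^', sq (u (t + h))) -> sq u' ->
  nmO (fun x => h^-1 * (u (t + h) x - u t x) - u' x) @[h --> (0 : R)^'] --> (0 : R) ->
  let e s := expR (- (C * s)) in
  nmO (fun x => h^-1 * (e (t + h) * u (t + h) x - e t * u t x) -
      (e t * u' x - C * (e t * u t x))) @[h --> (0 : R)^'] --> (0 : R).
Proof.
move=> su suh su' cu e.
have De := is_derive_expRN C t.
have ce : e (t + h) @[h --> (0 : R)^'] --> e t.
  have c := is_derive_continuous De.
  rewrite (_ : e t = expR (- (C * (t + 0)))); last by rewrite addr0.
  by apply: cvg_trans c; apply: cvg_app; exact: nbhs_dnbhs.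
have de : h^-1 * (e (t + h) - e t) + C * e t @[h --> (0 : R)^'] --> (0 : R).
  rewrite -[X in _ --> X](_ : - C * e t + C * e t = 0); last by ring.
  apply: cvgD; last exact: cvg_cst.
  have := is_derive_cvg De; rewrite addr0.
  by under eq_fun do rewrite add0r.
pose d h x := h^-1 * (u (t + h) x - u t x) - u' x.
have sd : \forall h \near (0 : R)^', sq (d h).
  apply: filterS suh => h suh; apply: sqintB => //; apply: sqintZ => //; exact: sqintB.
apply: (@squeeze0 _ _ _ _ _ (fun h => `|e (t + h)| * nmO (d h) + `|e (t + h) - e t| * nmO u' +
    `|h^-1 * (e (t + h) - e t) + C * e t| * nmO (u t))).
  have h0 : \forall h \near (0 : R)^', h != 0 by exact: nbhs_dnbhs_neq.
  apply: filterS2 sd h0 => h sdh hn0; rewrite nm_ge0 /=.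
  have s1 := sqintZ mO (e (t + h)) sdh.
  have s2 := sqintZ mO (e (t + h) - e t) su'.
  have s3 := sqintZ mO (h^-1 * (e (t + h) - e t) + C * e t) su.
  have s12 := sqintD mO s1 s2.
  rewrite -(nmZ mO _ sdh) -(nmZ mO _ su') -(nmZ mO _ su).
  have T1 := nmD_le mO s1 s2; have T2 := nmD_le mO s12 s3.
  set rhs := (X in _ <= X); set lhs := (X in nmO X).
  have E1 : lhs = (((fun x => e (t + h) * d h x) \+ (fun x => (e (t + h) - e t) * u' x)) \+
     (fun x => (h^-1 * (e (t + h) - e t) + C * e t) * u t x)).
    by apply/funext => x; rewrite /lhs /d /=; field.
  by rewrite E1; apply: le_trans T2 _; rewrite lerD2r.
rewrite -[X in _ --> X](_ : `|e t| * 0 + `|0 : R| * nmO u' + `|0 : R| * nmO (u t) = _); last first.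
  by rewrite normr0 !mul0r mulr0 !addr0.
apply: cvgD; last by apply: cvgM; [exact: cvg_norm|exact: cvg_cst].
apply: cvgD; first by apply: cvgM; [exact: cvg_norm|exact: cu].
apply: cvgM; last exact: cvg_cst.
have c2 : e (t + h) - e t @[h --> (0 : R)^'] --> (0 : R).
  by rewrite -[X in _ --> X](subrr (e t)); exact: (cvgB ce (cvg_cst _)).
exact: (cvg_norm c2).
Qed.

End energy.

Section comparison.
Context {R : realType} {N : nat}.
Local Notation E := 'rV[R]_N.
Local Notation mu := (lebesgue_rV N : {measure set E -> \bar R}).
Variables (Omega : set E) (G : R -> E -> E -> R).
Hypothesis oO : open Omega.
Hypothesis hG : is_dirichlet_heat_kernel Omega G.
Let mO : measurable Omega := open_measurable_rV oO.
Local Notation sq := (sqint mu Omega).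
Local Notation ipO := (ip mu Omega).
Local Notation nmO := (nm mu Omega).

(** The maximum principle: [expR (dot l l * t) * wexp b l] solves the heat equation
    and is nonnegative on the boundary, so that the energy of the part of the
    Dirichlet solution above it, zero at time zero, does not increase. *)
Theorem heat_comparison (f : E -> R) (b : R) (l : E) (t : R) :
  0 <= b -> sq f -> (forall x, Omega x -> f x <= wexp b l x) -> 0 < t ->
  \forall x \ae mu, Omega x ->
    heat_semigroup Omega G t f x <= expR (dot l l * t) * wexp b l x.
Proof.
move=> b0 sf fr t0.
have [_ /(_ f ((sqintP mu mO f).2 sf)) /= [_ [[u' hu'] u0]]] := hG.
pose u s := heat_semigroup Omega G s f.
pose C := dot l l.
pose e s := expR (- (C * s)).
pose v s x := e s * u s x.
have su (s : R) : 0 < s -> sq (u s).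
  by move=> s0; have [[g [[/(sqintP mu mO) + _ _] _ _]] _] := hu' s s0.
have su' (s : R) : 0 < s -> sq (u' s).
  by move=> s0; have [[g [_ /(sqintP mu mO) + _]] _] := hu' s s0.
have sv (s : R) : 0 < s -> sq (v s) by move=> s0; apply: sqintZ => //; exact: su.
have nearpos (s : R) : 0 < s -> \forall h \near (0 : R)^', 0 < s + h.
  move=> s0; apply: nbhs_dnbhs; apply/nbhs_ballP; exists s => //= h.
  by rewrite /ball /= sub0r normrN ltr_norml => /andP[h1 _]; lra.
pose F s := energy Omega b l (v s).
pose psi s x := eta (v s x - wexp b l x).
pose v' s x := e s * u' s x - C * (e s * u s x).
have DF (s : R) : 0 < s -> is_derive s 1 F (ipO (psi s) (v' s)).
  move=> s0; have [_ du] := hu' s s0.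
  have suh : \forall h \near (0 : R)^', sq (u (s + h)).
    by apply: filterS (nearpos s s0) => h; exact: su.
  have {}du : nmO (fun x => h^-1 * (u (s + h) x - u s x) - u' s x) @[h --> (0 : R)^'] --> (0 : R).
    apply: (Lnorm_cvg0 oO) => //; apply: filterS suh => h suh.
    apply: sqintB => //; last exact: su'.
    by apply: sqintZ => //; apply: sqintB => //; exact: su.
  apply: (energy_derive oO) => //; first exact: sv.
  - by apply: filterS (nearpos s s0) => h; exact: sv.
  - apply: sqintB => //; first by apply: sqintZ => //; exact: su'.
    by apply: sqintZ => //; apply: sqintZ => //; exact: su.
  - exact: (scaled_derivative oO C (su s s0) suh (su' s s0) du).
have F'le (s : R) : 0 < s -> ipO (psi s) (v' s) <= 0.
  move=> s0; have [lap _] := hu' s s0.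
  have := dissipation oO l b0 (expR_ge0 (- (C * s))) lap.
  have spsi : sq (psi s) by exact: (trunc_sqint oO (e s) l b0 (su s s0)).
  have s1 : sq (fun x => e s * u' s x) by apply: sqintZ => //; exact: su'.
  have s2 : sq (fun x => C * (e s * u s x)) by apply: sqintZ => //; exact: sv.
  rewrite /v' (ipBr mO s1 s2 spsi) !(ipC _ _ (psi s)) (ipZl mO _ (su' s s0) spsi).
  by rewrite (ipZl mO C (sv s s0) spsi) subr_le0.
have Fle (s : R) : 0 < s -> s <= t -> F t <= F s.
  move=> s0 st; apply: (@ler0_derive1_nincr R F s t) => //.
  - by move=> x; rewrite in_itv /= => /andP[sx _]; case: (DF x (lt_trans s0 sx)).
  - move=> x; rewrite in_itv /= => /andP[sx _]; have x0 := lt_trans s0 sx.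
    by rewrite derive1E (@derive_val _ _ _ _ _ _ _ (DF x x0)); exact: F'le.
  - apply: derivable_within_continuous => x; rewrite in_itv /= => /andP[sx _].
    by case: (DF x (lt_le_trans s0 sx)).
pose B s := e s * nmO (u s \- f) + `|e s - 1| * nmO f.
have pos0 : \forall s \near (0 : R)^'+, 0 < s by exact: nbhs_right_gt.
have cB : B s @[s --> (0 : R)^'+] --> (0 : R).
  have ce : e s @[s --> (0 : R)^'+] --> (1 : R).
    have := is_derive_continuous (is_derive_expRN C 0).
    rewrite (_ : 1 = expR (- (C * (0 + 0)))); last by rewrite addr0 mulr0 oppr0 expR0.
    move=> c; apply: cvg_trans (cvg_at_right_filter c).
    by rewrite (_ : e = fun s => expR (- (C * (0 + s)))) //; apply/funext => s; rewrite add0r.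
  have c2 : e s - 1 @[s --> (0 : R)^'+] --> (0 : R).
    by rewrite -[X in _ --> X](subrr 1); exact: (cvgB ce (cvg_cst _)).
  have c3 : nmO (u s \- f) @[s --> (0 : R)^'+] --> (0 : R).
    apply: (Lnorm_cvg0 oO) => //; apply: filterS pos0 => s s0.
    by apply: sqintB => //; exact: su.
  rewrite -[X in _ --> X](_ : 1 * 0 + `|0 : R| * nmO f = _); last by rewrite mulr0 normr0 mul0r addr0.
  apply: cvgD; first by apply: cvgM.
  by apply: cvgM; [exact: (cvg_norm c2)|exact: cvg_cst].
have FB (s : R) : 0 < s -> F s <= B s ^+ 2.
  move=> s0; apply: le_trans (energy_le oO b0 (sv s s0) sf fr) _.
  have B0 : 0 <= B s by rewrite addr_ge0 // mulr_ge0 ?nm_ge0 ?expR_ge0.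
  apply: lerXn2r; rewrite ?nnegrE ?nm_ge0 //.
  have sd : sq (u s \- f) by apply: sqintB => //; exact: su.
  have E1 : v s \- f = (fun x => e s * (u s \- f) x) \+ (fun x => (e s - 1) * f x).
    by apply/funext => x /=; rewrite /v; ring.
  rewrite E1; apply: le_trans (nmD_le mO (sqintZ mO _ sd) (sqintZ mO _ sf)) _.
  by rewrite (nmZ mO _ sd) (nmZ mO _ sf) ger0_norm ?expR_ge0.
have F0 : F t = 0.
  apply/eqP; rewrite eq_le energy_ge0 // andbT leNgt; apply/negP => Ft.
  have cB2 : B s ^+ 2 @[s --> (0 : R)^'+] --> (0 : R).
    rewrite -[X in _ --> X](mul0r 0) (_ : (fun s => B s ^+ 2) = (fun s => B s * B s)).
      exact: (cvgM cB cB).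
    by apply/funext => s; rewrite expr2.
  have n1 : \forall s \near (0 : R)^'+, B s ^+ 2 < F t by exact: (cvgr_lt _ cB2).
  have n2 : \forall s \near (0 : R)^'+, s < t by exact: nbhs_right_lt.
  have [s [[s1 s2] s3]] := filter_ex (filterI (filterI n1 n2) pos0).
  by have := le_lt_trans (le_trans (Fle s s3 (ltW s2)) (FB s s3)) s1; rewrite ltxx.
have := energy_eq0 oO b0 (sv t t0) F0; apply: filterS => x Hx Ox.
have := Hx Ox; rewrite /v /e -/(u t) => H1.
by rewrite -ler_pdivrMl ?expR_gt0 // -expRN.
Qed.

Lemma kernel_continuous t x y : 0 < t -> Omega x -> Omega y ->
  {for (x, y), continuous (fun p : E * E => G t p.1 p.2)}.
Proof.
move=> t0 Ox Oy; have [cG _] := hG.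
have c := cG t x y t0 Ox Oy.
apply: (@continuous_comp _ _ _ (fun p : E * E => (t, p.1, p.2))
  (fun p : R * E * E => G p.1.1 p.1.2 p.2)) => //.
apply: continuous_pair; first apply: continuous_pair.
- exact: cst_continuous.
- exact: cvg_fst.
- exact: cvg_snd.
Qed.

Lemma kernel_continuousr t x y : 0 < t -> Omega x -> Omega y ->
  {for y, continuous (G t x)}.
Proof.
move=> t0 Ox Oy; apply: (@continuous_comp _ _ _ (fun y : E => (x, y))
  (fun p : E * E => G t p.1 p.2)); last exact: kernel_continuous.
exact: (continuous_pair (f := fun=> x) (g := id) (@cst_continuous _ _ x y) (fun U H => H)).
Qed.

Lemma kernel_continuousl t x y : 0 < t -> Omega x -> Omega y ->
  {for x, continuous (fun x => G t x y)}.
Proof.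
move=> t0 Ox Oy; apply: (@continuous_comp _ _ _ (fun x : E => (x, y))
  (fun p : E * E => G t p.1 p.2)); last exact: kernel_continuous.
exact: (continuous_pair (f := id) (g := fun=> y) (fun U H => H) (@cst_continuous _ _ y x)).
Qed.

Lemma kernel_measurabler t x : 0 < t -> Omega x -> measurable_fun Omega (G t x).
Proof.
move=> t0 Ox; apply: (continuous_on_measurable (@measurable_base_rV R N) oO) => y Oy.
exact: kernel_continuousr.
Qed.

Lemma restrict_sqint (A : set E) M (g : E -> R) : measurable A -> A `<=` cube M ->
  continuous g -> sq (g \_ A).
Proof.
move=> mA AM cg.
have mg : measurable_fun setT (g \_ A).
  by apply/(measurable_restrictT _ mA); apply: measurable_funTS; exact: continuous_measurable_rV.
split; first exact: measurable_funTS.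
apply: (integrableS measurableT) => //.
have -> : (fun x => ((g \_ A) x ^+ 2)%:E) = (fun x => (g x ^+ 2)%:E) \_ A.
  by apply/funext => x; rewrite !patchE; case: ifP => // _; rewrite expr0n.
apply/(integrable_mkcond _ mA); apply: (integrableS (@measurable_cube R N M)) => //.
apply: (measurable_bounded_integrable (f := fun x => g x ^+ 2) (@measurable_cube R N M)).
- exact: cube_finite.
- by apply: measurable_funTS; apply: continuous_measurable_rV => x; apply: continuousM; exact: cg.
- have : compact ((fun x => g x ^+ 2) @` (cube M)).
    apply: continuous_compact; last exact: compact_cube.
    by apply: continuous_subspaceT => x; apply: continuousM; exact: cg.
  move=> /compact_bounded [C [Cr CP]]; exists C; split => // e eC x xM /=.
  by apply: CP => //; exists x.
Qed.

Lemma kernel_integrable t x f : 0 < t -> Omega x -> sq f ->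
  mu.-integrable Omega (fun y => (G t x y * f y)%:E).
Proof.
move=> t0 Ox sf; have [_ /(_ f ((sqintP mu mO f).2 sf)) [+ _]] := hG; exact.
Qed.

Lemma obox_cube (y : E) (e : R) : obox y e `<=` cube (`|y| + e).
Proof.
move=> z yz i; have yi : `|y 0 i| <= `|y|.
  by rewrite [leRHS]/Num.norm /= mx_normrE; exact: (le_bigmax_cond _ _ (j := (0, i))).
have := yz i; have := ler_normD (y 0 i) (- (y 0 i - z 0 i)).
by rewrite normrN opprB addrC subrK; lra.
Qed.

(** Comparison with [b = 0] says that nonpositive data have a nonpositive flow.
    For minus the indicator of a small box where the kernel is negative the flow
    is also nonnegative, hence zero, and so is the kernel at some point of the
    box. *)
Lemma kernel_ge0 t x0 y0 : 0 < t -> Omega x0 -> Omega y0 -> 0 <= G t x0 y0.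
Proof.
move=> t0 Ox0 Oy0; rewrite leNgt; apply/negP => Gneg.
have := kernel_continuous t0 Ox0 Oy0 => /(_ [set s | s < 0]).
have : nbhs (G t x0 y0) [set s | s < 0].
  by apply: open_nbhs_nbhs; split => //; exact: open_lt.
move=> Hn /(_ Hn) [[U V] /= [nU nV] UV].
have [e e0 eV] := obox_nbhs (filterI nV (open_nbhs_nbhs (conj oO Oy0))).
pose A := obox y0 e.
have mA : measurable A by apply: open_measurable_rV; exact: open_obox.
pose f : E -> R := (cst (-1 : R)) \_ A.
have sf : sq f.
  by apply: (restrict_sqint mA (@obox_cube y0 e)); exact: cst_continuous.
have fr x : Omega x -> f x <= wexp 0 0 x.
  by move=> _; rewrite /wexp mul0r /f patchE; case: ifP => // _; rewrite lerN10.
have := heat_comparison (lexx 0) sf fr t0 => H1.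
have [x [[Ux Ox] /(_ Ox)]] := ae_nbhs H1 (filterI nU (open_nbhs_nbhs (conj oO Ox0))).
rewrite /wexp mul0r mulr0 /heat_semigroup => I0.
have nonneg y : Omega y -> 0 <= G t x y * f y.
  move=> Oy; rewrite /f patchE; case: ifPn => [|_]; last by rewrite mulr0.
  rewrite inE => /eV [Vy _]; rewrite mulrN1 oppr_ge0 ltW //.
  exact: (UV (x, y) (conj Ux Vy)).
have ig := kernel_integrable t0 Ox sf.
have : (\int[mu]_(y in Omega) `|(G t x y * f y)%:E| = 0)%E.
  rewrite (eq_integral (fun y => (G t x y * f y)%:E)); last first.
    by move=> y; rewrite inE => Oy; rewrite gee0_abs // lee_fin nonneg.
  rewrite -(fineK (integrable_fin_num mO ig)); congr EFin.
  by apply/eqP; rewrite eq_le [X in X && _]I0; apply: Rintegral_ge0.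
have /integrableP[mg _] := ig.
move/(ae_eq_integral_abs _ mO mg) => ae0.
have [y [yA /= Hy]] := ae_nbhs ae0 (nbhs_obox y0 e0).
have [Vy Oy] := eV _ yA; have [/eqP] := Hy Oy.
rewrite /f patchE mem_set // mulrN1 oppr_eq0 => /eqP G0.
by have := UV (x, y) (conj Ux Vy); rewrite /= G0 ltxx.
Qed.

(** Exponential moments of the heat kernel, obtained from the comparison with
    truncated exponentials by Fatou's lemma; the passage from almost every [x] to
    every [x] uses the continuity of the kernel. *)
Lemma kernel_wexp t x0 (l : E) : 0 < t -> Omega x0 ->
  (\int[mu]_(y in Omega) (G t x0 y * wexp 1 l y)%:E <=
   (expR (dot l l * t) * wexp 1 l x0)%:E)%E.
Proof.
move=> t0 Ox0.
pose f (k : nat) : E -> R := wexp 1 l \_ (cube k%:R).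
have cw := @continuous_wexp R N 1 l.
have w0 y : 0 <= wexp 1 l y by exact: wexp_ge0.
have sf k : sq (f k) by exact: (restrict_sqint (@measurable_cube R N k%:R) (@subset_refl _ _) cw).
have f0 k y : 0 <= f k y by rewrite /f patchE; case: ifP.
have fr k y : Omega y -> f k y <= wexp 1 l y by move=> _; rewrite /f patchE; case: ifP.
(* points tending to [x0] at which the almost everywhere comparison holds *)
have /choice[x xP] (k : nat) : exists x, [/\ obox x0 k.+1%:R^-1 x, Omega x &
    heat_semigroup Omega G t (f k) x <= expR (dot l l * t) * wexp 1 l x].
  have := heat_comparison ler01 (sf k) (fr k) t0 => H1.
  have k0 : 0 < k.+1%:R^-1 :> R by rewrite invr_gt0.
  have [x [[x1 x2] /(_ x2) x3]] := ae_nbhs H1 (filterI (nbhs_obox x0 k0) (open_nbhs_nbhs (conj oO Ox0))).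
  by exists x.
have cx : x k @[k --> \oo] --> x0.
  move=> U /obox_nbhs[e e0 eU].
  have [n _ nP] := near_infty_natSinv_lt (PosNum e0).
  exists n => // k /= nk; apply: eU => i; have [xk _ _] := xP k.
  exact: lt_trans (xk i) (nP k nk).
pose g k y := (G t (x k) y * f k y)%:E.
have Ox k : Omega (x k) by have [] := xP k.
have g0 k y : Omega y -> (0 <= g k y)%E.
  by move=> Oy; rewrite lee_fin mulr_ge0 //; exact: kernel_ge0.
have mg k : measurable_fun Omega (g k).
  apply/measurable_EFinP; apply: measurable_funM; first exact: kernel_measurabler.
  exact: sqint_measurable (sf k).
have := fatou mu mO mg g0.
have -> : (\int[mu]_(y in Omega) limn_einf (g^~ y) =
    \int[mu]_(y in Omega) (G t x0 y * wexp 1 l y)%:E)%E.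
  apply: eq_integral => y; rewrite inE => Oy.
  apply: (cvg_limn_einf_sup _).1; apply: cvg_EFin; first exact: nearW.
  apply: (@cvgM _ _ _ _ (fun k => G t (x k) y) (fun k => f k y)).
    exact: (continuous_cvg _ (kernel_continuousl t0 Ox0 Oy) cx).
  have yk : \forall k \near \oo, wexp 1 l y = f k y.
    have := nbhs_infty_ger `|y|; apply: filterS => k yk; rewrite /f patchE mem_set // => i.
    apply: le_trans yk; rewrite [leRHS]/Num.norm /= mx_normrE.
    exact: (le_bigmax_cond _ _ (j := (0, i))).
  by apply: cvg_trans (near_eq_cvg yk) _; exact: cvg_cst.
move=> H1; apply: le_trans H1 _.
pose r k := (expR (dot l l * t) * wexp 1 l (x k))%:E.
have cr : r @ \oo --> (expR (dot l l * t) * wexp 1 l x0)%:E.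
  apply: cvg_EFin; first exact: nearW.
  by apply: cvg_mull; exact: (continuous_cvg _ (cw x0) cx).
rewrite limn_einf_lim -(cvg_lim _ cr) //.
apply: lee_lim; [exact: is_cvg_einfs|exact: cvgP cr|].
apply: nearW => k.
have le1 : (einfs (fun n => \int[mu]_(y in Omega) g n y) k <=
    \int[mu]_(y in Omega) g k y)%E by apply: ereal_inf_lbound; exists k => /=.
apply: (le_trans le1); rewrite /r -(fineK (integrable_fin_num mO (kernel_integrable t0 (Ox k) (sf k)))) lee_fin.
by have [_ _] := xP k.
Qed.

End comparison.

(** * Mass and tails of the heat kernel *)

Section euclidean_norm.
Context {R : realType} {N : nat}.
Implicit Types x y z : 'rV[R]_N.

Lemma dot_ge0 x : 0 <= dot x x.
Proof. by apply: sumr_ge0 => i _; rewrite -expr2 sqr_ge0. Qed.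

Lemma sqr_enorm x : enorm x ^+ 2 = dot x x.
Proof. by rewrite sqr_sqrtr // dot_ge0. Qed.

Lemma enorm_ge0 x : 0 <= enorm x. Proof. exact: sqrtr_ge0. Qed.

Lemma enormD x y : enorm (x + y) <= enorm x + enorm y.
Proof.
rewrite -(@ler_pXn2r _ 2) ?nnegrE ?addr_ge0 ?enorm_ge0 //.
rewrite sqrrD !sqr_enorm.
have E a b : dot (a *: x - b *: y) (a *: x - b *: y) =
    a ^+ 2 * dot x x - 2 * a * b * dot x y + b ^+ 2 * dot y y.
  rewrite /dot !mulr_sumr -sumrB -big_split /=; apply: eq_bigr => i _.
  by rewrite !mxE; ring.
have E1 : dot (x + y) (x + y) = dot x x + 2 * dot x y + dot y y.
  rewrite /dot !mulr_sumr -!big_split /=; apply: eq_bigr => i _.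
  by rewrite !mxE; ring.
have := discriminant (dot_ge0 x) (dot_ge0 y) (fun a b => _ : 0 <= a ^+ 2 * dot x x - 2 * a * b * dot x y + b ^+ 2 * dot y y).
move=> /(_ (fun a b => eq_ind _ (fun c => is_true (0 <= c)) (dot_ge0 (a *: x - b *: y)) _ (E a b))) D.
have : dot x y <= enorm x * enorm y.
  apply: le_trans (ler_norm _) _.
  rewrite -(@ler_pXn2r _ 2) ?nnegrE ?mulr_ge0 ?enorm_ge0 //.
  by rewrite real_normK ?num_real // exprMn !sqr_enorm.
by rewrite E1 mulr2n; lra.
Qed.

Lemma continuous_enorm : continuous (@enorm R N).
Proof.
move=> x; apply: (@continuous_comp _ _ _ (fun x => dot x x) (@Num.sqrt R)); last exact: sqrt_continuous.
rewrite /dot; apply: continuous_big => [|i _ y]; first exact: add_continuous.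
by apply: continuousM; exact: coord_continuous.
Qed.

(** Otherwise the squares of the [N] coordinates would add up to less than
    [r ^+ 2]. *)
Lemma enorm_coord x (r : R) : (0 < N)%N -> 0 < r -> r <= enorm x ->
  exists i, r / Num.sqrt N%:R <= `|x 0 i|.
Proof.
move=> N0 r0 rx; apply: contrapT => nex.
have Np : 0 < N%:R :> R by rewrite ltr0n.
have sN : 0 < Num.sqrt N%:R :> R by rewrite sqrtr_gt0.
have lt1 i : x 0 i * x 0 i < r ^+ 2 / N%:R.
  have : `|x 0 i| < r / Num.sqrt N%:R.
    by rewrite ltNge; apply/negP => h; apply: nex; exists i.
  move=> h; rewrite -expr2 -real_normK ?num_real //.
  rewrite -(sqr_sqrtr (ltW Np)) -expr_div_n.
  by apply: ltrXn2r => //; rewrite nnegrE divr_ge0 // ltW.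
have : dot x x < \sum_(i < N) r ^+ 2 / N%:R.
  by apply: ltr_sum => //; apply/hasP; exists (Ordinal N0) => //; rewrite mem_index_enum.
rewrite sumr_const card_ord -[X in _ < X]mulr_natr mulfVK ?gt_eqF //.
rewrite -sqr_enorm ltNge => /negP; apply.
by apply: lerXn2r; rewrite ?nnegrE ?enorm_ge0 // ltW.
Qed.

End euclidean_norm.

Section kernel_tails.
Context {R : realType} {N : nat}.
Local Notation E := 'rV[R]_N.
Local Notation mu := (lebesgue_rV N : {measure set E -> \bar R}).
Variables (Omega : set E) (G : R -> E -> E -> R).
Hypothesis N0 : (0 < N)%N.
Hypothesis oO : open Omega.
Hypothesis hG : is_dirichlet_heat_kernel Omega G.
Let mO : measurable Omega := open_measurable_rV oO.

(** Extended real valued, so that nonnegative functions can be estimated before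
    anything is known about integrability. *)
Definition heat_ge0 t x (g : E -> R) : \bar R := \int[mu]_(y in Omega) (G t x y * g y)%:E.

Lemma heat_ge0_nonneg t x g : 0 < t -> Omega x -> (forall y, Omega y -> 0 <= g y) ->
  (0 <= heat_ge0 t x g)%E.
Proof.
move=> t0 Ox g0; apply: integral_ge0 => y Oy.
by rewrite lee_fin mulr_ge0 ?g0 //; exact: (kernel_ge0 oO hG).
Qed.

Lemma heat_ge0_measurable t x g : 0 < t -> Omega x -> measurable_fun Omega g ->
  measurable_fun Omega (fun y => (G t x y * g y)%:E).
Proof.
move=> t0 Ox mg; apply/measurable_EFinP; apply: measurable_funM => //.
exact: (kernel_measurabler oO hG).
Qed.

Lemma heat_ge0_le (t : R) x (f g : E -> R) : 0 < t -> Omega x ->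
  measurable_fun Omega f -> measurable_fun Omega g ->
  (forall y, Omega y -> 0 <= f y) -> (forall y, Omega y -> f y <= g y) ->
  (heat_ge0 t x f <= heat_ge0 t x g)%E.
Proof.
move=> t0 Ox mf mg f0 fg; apply: ge0_le_integral => //.
- by move=> y Oy; rewrite lee_fin mulr_ge0 ?f0 //; exact: (kernel_ge0 oO hG).
- exact: heat_ge0_measurable.
- exact: heat_ge0_measurable.
- move=> y Oy; rewrite lee_fin ler_wpM2l ?fg //; exact: (kernel_ge0 oO hG).
Qed.

Lemma heat_ge0D (t : R) x (f g : E -> R) : 0 < t -> Omega x ->
  measurable_fun Omega f -> measurable_fun Omega g ->
  (forall y, Omega y -> 0 <= f y) -> (forall y, Omega y -> 0 <= g y) ->
  heat_ge0 t x (fun y => f y + g y) = (heat_ge0 t x f + heat_ge0 t x g)%E.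
Proof.
move=> t0 Ox mf mg f0 g0; rewrite /heat_ge0.
under eq_integral do rewrite mulrDr EFinD.
rewrite ge0_integralD //.
- by move=> y Oy; rewrite lee_fin mulr_ge0 ?f0 //; exact: (kernel_ge0 oO hG).
- exact: heat_ge0_measurable.
- by move=> y Oy; rewrite lee_fin mulr_ge0 ?g0 //; exact: (kernel_ge0 oO hG).
- exact: heat_ge0_measurable.
Qed.

Lemma heat_ge0Z (t : R) x (a : R) (f : E -> R) : 0 < t -> Omega x -> 0 <= a ->
  measurable_fun Omega f -> (forall y, Omega y -> 0 <= f y) ->
  heat_ge0 t x (fun y => a * f y) = (a%:E * heat_ge0 t x f)%E.
Proof.
move=> t0 Ox a0 mf f0; rewrite /heat_ge0.
under eq_integral do rewrite mulrCA EFinM.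
rewrite ge0_integralZl_EFin //.
- by move=> y Oy; rewrite lee_fin mulr_ge0 ?f0 //; exact: (kernel_ge0 oO hG).
- exact: heat_ge0_measurable.
Qed.

Lemma heat_ge0_sum (J : Type) (s : seq J) t x (f : J -> E -> R) : 0 < t -> Omega x ->
  (forall j, measurable_fun Omega (f j)) ->
  (forall j y, Omega y -> 0 <= f j y) ->
  heat_ge0 t x (fun y => \sum_(j <- s) f j y) = (\sum_(j <- s) heat_ge0 t x (f j))%E.
Proof.
move=> t0 Ox mf f0; rewrite /heat_ge0.
under eq_integral do rewrite mulr_sumr -sumEFin.
rewrite ge0_integral_sum // => [j|j y Oy].
  exact: heat_ge0_measurable.
by rewrite lee_fin mulr_ge0 ?f0 //; exact: (kernel_ge0 oO hG).
Qed.

Lemma kernel_moment (t : R) x l : 0 < t -> Omega x ->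
  (heat_ge0 t x (fun y => expR (dot l y - dot l x)) <= (expR (dot l l * t))%:E)%E.
Proof.
move=> t0 Ox.
have ml : measurable_fun Omega (wexp 1 l).
  by apply: measurable_funTS; apply: continuous_measurable_rV; exact: continuous_wexp.
have -> : (fun y => expR (dot l y - dot l x)) = fun y => expR (- dot l x) * wexp 1 l y.
  by apply/funext => y; rewrite /wexp mul1r expRD mulrC.
rewrite heat_ge0Z ?expR_ge0 //; last by move=> y _; exact: wexp_ge0.
have := kernel_wexp oO hG l t0 Ox; rewrite -/(heat_ge0 t x (wexp 1 l)) => H1.
apply: le_trans (lee_wpmul2l _ H1) _; first by rewrite lee_fin expR_ge0.
rewrite -EFinM lee_fin /wexp mul1r mulrCA -expRD addNr expR0 mulr1 //.
Qed.

(** The exponential moment for [l = 0]. *)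
Lemma kernel_mass (t : R) x : 0 < t -> Omega x -> (heat_ge0 t x (cst (1 : R)%R) <= 1)%E.
Proof.
move=> t0 Ox; have := kernel_moment (0 : E) t0 Ox.
have d0 y : dot (0 : E) y = 0 by rewrite /dot big1 // => i _; rewrite mxE mul0r.
rewrite (d0 0) mul0r expR0; congr (_ <= _)%E; apply: eq_integral => y _ /=.
by rewrite !d0 subrr expR0.
Qed.

(** The factor [N] in the exponent is what is lost by using exponentials in
    coordinate directions only. *)
Definition gauss t r : R := (N%:R * 2) * expR (- (r ^+ 2 / (4 * N%:R * t))).

(** Chernoff bound: the indicator of the far region is at most a sum of [2 * N]
    normalized exponentials. *)
Lemma kernel_tail (t : R) x (r : R) : 0 < t -> Omega x -> 0 < r ->
  (heat_ge0 t x (\1_[set y | r <= enorm (y - x)]%R) <= (gauss t r)%:E)%E.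
Proof.
move=> t0 Ox r0.
have Np : 0 < N%:R :> R by rewrite ltr0n.
pose r' := r / Num.sqrt N%:R.
have r'2 : r' ^+ 2 = r ^+ 2 / N%:R by rewrite /r' expr_div_n sqr_sqrtr // ltW.
have r'0 : 0 < r' by rewrite divr_gt0 // sqrtr_gt0.
(* the minimizer of [la ^+ 2 * t - la * r'] *)
pose la := r' / (2 * t).
have la0 : 0 < la by rewrite divr_gt0 // mulr_gt0.
pose l (p : 'I_N * bool) : E := ((-1) ^+ p.2 * la) *: delta_mx 0 p.1.
have dl p y : dot (l p) y = (-1) ^+ p.2 * la * y 0 p.1.
  rewrite /dot (bigD1 p.1) //= big1 ?addr0; last first.
    by move=> i /negbTE ip; rewrite !mxE ip /= mulr0 mul0r.
  by rewrite !mxE !eqxx /= mulr1.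
have dll p : dot (l p) (l p) = la ^+ 2.
  by rewrite dl !mxE !eqxx /= mulr1; case: p.2; rewrite ?expr1 ?expr0; ring.
pose f p y := expR (- (la * r')) * expR (dot (l p) y - dot (l p) x).
have me p : measurable_fun Omega (fun y : E => expR (dot (l p) y - dot (l p) x)).
  apply: measurable_funTS; apply: continuous_measurable_rV => y.
  apply: (@continuous_comp _ _ _ (fun y => dot (l p) y - dot (l p) x) (@expR R)); last exact: continuous_expR.
  apply: continuous_subf; [exact: continuous_dot|exact: cst_continuous].
have mf p : measurable_fun Omega (f p) by apply: measurable_funM.
have f0 p y : Omega y -> 0 <= f p y by rewrite mulr_ge0 ?expR_ge0.
have mfar : measurable [set y : E | r <= enorm (y - x)].
  apply: closed_measurable_rV; apply: (@closed_comp _ _ (fun y : E => enorm (y - x)) [set s | r <= s]).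
    move=> y _; apply: (@continuous_comp _ _ _ (fun y : E => y - x) (@enorm R N)); last exact: continuous_enorm.
    exact: (continuousB (f := id) (fun U H => H) (@cst_continuous _ _ _ _)).
  exact: closed_ge.
apply: le_trans (_ : heat_ge0 t x (fun y => \sum_(p <- index_enum ('I_N * bool)%type) f p y)%R <= _)%E.
  apply: heat_ge0_le => //.
  - by apply: measurable_sum.
  - move=> y Oy; rewrite indicE; case: (boolP (y \in _)) => /= [|_]; last by apply: sumr_ge0 => p _; exact: f0.
    rewrite inE /= => far.
    have [i hi] := enorm_coord N0 r0 far.
    pose p0 : 'I_N * bool := (i, (y - x) 0 i < 0).
    rewrite (bigD1 p0) //= -[leLHS]addr0; apply: lerD; last by apply: sumr_ge0 => p _; exact: f0.
    rewrite /f -expRD -expR0 ler_expR !dl -mulrBr /p0 /=.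
    have -> : (-1) ^+ ((y - x) 0 i < 0)%R * la * (y 0 i - x 0 i) = la * `|(y - x) 0 i|.
      have zE : (y - x) 0 i = y 0 i - x 0 i by rewrite !mxE.
      by rewrite -zE (normrEsign ((y - x) 0 i)) [RHS]mulrA [la * _]mulrC.
    by rewrite addrC subr_ge0 ler_pM2l.
rewrite heat_ge0_sum //.
apply: le_trans (_ : (\sum_(p <- index_enum ('I_N * bool)%type) (expR (- (la * r')) * expR (la ^+ 2 * t))%R%:E <= _)%E).
  apply: lee_sum => p _; rewrite heat_ge0Z ?expR_ge0 //.
  rewrite EFinM; apply: lee_wpmul2l; first by rewrite lee_fin expR_ge0.
  by rewrite -(dll p); exact: kernel_moment.
rewrite sumEFin lee_fin sumr_const card_prod card_ord card_bool.
rewrite /gauss -[leLHS]mulr_natl natrM -expRD ler_wpM2l //.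
rewrite ler_expR (_ : - (la * r') + _ = - (r' ^+ 2 / (4 * t))); last first.
  by rewrite /la; field; rewrite gt_eqF.
rewrite r'2 lerN2 le_eqVlt; apply/orP; left; apply/eqP; field.
by rewrite !gt_eqF.
Qed.

(** If [x] lies well inside the ball of radius [a], the heat starting outside of it
    is exponentially small; otherwise the cut-off [theta] is already large at [x]. *)
Lemma kernel_far (theta : R -> R) (q a t : R) x : 0 < t -> Omega x -> 0 < a -> q < 1 ->
  (forall s, 0 <= theta s) -> (forall s, 2 * q <= s -> 3 / 4 <= theta s) ->
  (heat_ge0 t x (\1_[set y | a <= enorm y]%R) <=
   (4 / 3 * theta (enorm x / (a / 2)) + gauss t ((1 - q) * a))%:E)%E.
Proof.
move=> t0 Ox a0 q1 th0 thq.
have g0 : 0 <= gauss t ((1 - q) * a) by rewrite mulr_ge0 ?mulr_ge0 ?expR_ge0.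
have mfar z r : measurable [set y : E | r <= enorm (y - z)].
  apply: closed_measurable_rV; apply: (@closed_comp _ _ (fun y : E => enorm (y - z)) [set s | r <= s]).
    move=> y _; apply: (@continuous_comp _ _ _ (fun y : E => y - z) (@enorm R N)); last exact: continuous_enorm.
    exact: (continuousB (f := id) (fun U H => H) (@cst_continuous _ _ _ _)).
  exact: closed_ge.
have ma : measurable [set y : E | a <= enorm y].
  by have := mfar 0 a; under eq_set do rewrite subr0.
have [xq|xq] := leP (q * a) (enorm x).
  (* the cut-off is at least 3/4, so that 4/3 of it bounds the total mass *)
  apply: le_trans (_ : 1 <= _)%E.
    apply: le_trans (kernel_mass t0 Ox); apply: heat_ge0_le => //.
    - by move=> y _ /=; rewrite indicE; case: (_ \in _).
  rewrite lee_fin.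
  suff : 3 / 4 <= theta (enorm x / (a / 2)) by lra.
  apply: thq; rewrite ler_pdivlMr ?divr_gt0 //; lra.
have r0 : 0 < (1 - q) * a by rewrite mulr_gt0 // subr_gt0.
apply: le_trans (_ : (gauss t ((1 - q) * a))%:E <= _)%E; last first.
  by rewrite lee_fin lerDr mulr_ge0.
apply: le_trans (kernel_tail t0 Ox r0); apply: heat_ge0_le => //.
- move=> y _; rewrite !indicE; case: (boolP (y \in _)) => /= [|_]; last by case: (_ \in _).
  rewrite inE /= => ay; rewrite mem_set //=.
  have := enormD x (y - x); rewrite addrC subrK; lra.
Qed.

Lemma gauss_le t t' r : 0 < t -> t <= t' -> gauss t r <= gauss t' r.
Proof.
move=> t0 tt'; have Np : 0 < N%:R :> R by rewrite ltr0n.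
rewrite ler_wpM2l ?mulr_ge0 // ler_expR lerN2 ler_wpM2l ?sqr_ge0 //.
rewrite lef_pV2 ?posrE ?mulr_gt0 //; last exact: lt_le_trans tt'.
by rewrite ler_pM2l ?mulr_gt0.
Qed.

End kernel_tails.

(** * The nonlinearity and the weights *)

Section powers.
Context {R : realType}.
Implicit Types a b x y al : R.

(** For [r = y / x] this is [1 - r `^ al <= al * (r^-1 - 1)], a consequence of
    [expR z >= 1 + z] and [ln z <= z - 1]. *)
Lemma powR_sub_le al x y : 0 < al -> 0 <= y -> y <= x ->
  (x `^ al - y `^ al) * y <= al * x `^ al * (x - y).
Proof.
move=> al0 y0 yx; have [->|yn0] := eqVneq y 0.
  by rewrite mulr0 mulr_ge0 ?subr_ge0 ?mulr_ge0 ?powR_ge0 ?(le_trans y0 yx) // ltW.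
have yp : 0 < y by rewrite lt_neqAle eq_sym yn0.
have xp : 0 < x by exact: lt_le_trans yx.
pose r := y / x.
have r0 : 0 < r by rewrite divr_gt0.
have yE : y = r * x by rewrite /r divfK ?gt_eqF.
have h1 : 1 - al * (r^-1 - 1) <= r `^ al.
  rewrite /powR gt_eqF //.
  apply: le_trans (expR_ge1Dx _); rewrite lerD2l -mulrN ler_wpM2l ?(ltW al0) //.
  have ri : 0 < r^-1 by rewrite invr_gt0.
  have : ln r^-1 <= r^-1 - 1.
    have rE : r^-1 = 1 + (r^-1 - 1) by rewrite addrC subrK.
    by rewrite {1}rE; apply: le_ln1Dx; lra.
  by rewrite lnV ?posrE //; lra.
rewrite {1}yE powRM ?(ltW r0) ?(ltW xp) //.
have x0 := powR_ge0 x al.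
have h2 : (1 - r `^ al) * r <= al * (1 - r).
  apply: le_trans (_ : al * (r^-1 - 1) * r <= _).
    by rewrite ler_wpM2r ?(ltW r0) //; lra.
  by rewrite -mulrA mulrBl mul1r mulVf ?gt_eqF.
have := ler_wpM2l (mulr_ge0 x0 (ltW xp)) h2.
have e1 : x `^ al * x * ((1 - r `^ al) * r) = (x `^ al - r `^ al * x `^ al) * y.
  by rewrite [X in _ * X = _]mulrC [in RHS]yE; ring.
have e2 : x `^ al * x * (al * (1 - r)) = al * x `^ al * (x - y).
  by rewrite yE; ring.
by rewrite e1 e2.
Qed.

(** The difference is [`|a| `^ al * (a - b) + (`|a| `^ al - `|b| `^ al) * b], and for
    [`|b| <= `|a|] the second term is controlled by [powR_sub_le]. *)
Lemma power_lip al a b : 0 < al ->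
  `| `|a| `^ al * a - `|b| `^ al * b| <= (1 + al) * (`|a| `^ al + `|b| `^ al) * `|a - b|.
Proof.
move=> al0; wlog ab : a b / `|b| <= `|a| => [H|].
  case/orP: (le_total `|b| `|a|) => ab; first exact: H.
  by rewrite distrC (distrC a) (addrC (`|a| `^ al)); exact: H.
have pa := powR_ge0 `|a| al; have pb := powR_ge0 `|b| al.
have -> : `|a| `^ al * a - `|b| `^ al * b =
    `|a| `^ al * (a - b) + (`|a| `^ al - `|b| `^ al) * b by ring.
apply: le_trans (ler_normD _ _) _.
rewrite !normrM (ger0_norm pa).
have pab : `|b| `^ al <= `|a| `^ al by apply: ge0_ler_powR; rewrite ?nnegrE // ltW.
rewrite (ger0_norm (_ : 0 <= `|a| `^ al - `|b| `^ al)) ?subr_ge0 //.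
have h := powR_sub_le al0 (normr_ge0 b) ab.
have h3 : `|a| - `|b| <= `|a - b| by exact: lerB_dist.
have h4 : al * `|a| `^ al * (`|a| - `|b|) <= al * `|a| `^ al * `|a - b|.
  by rewrite ler_wpM2l // mulr_ge0 // ltW.
have h5 : 0 <= (1 + al) * `|b| `^ al * `|a - b| by rewrite !mulr_ge0 // addr_ge0 // ltW.
have -> : (1 + al) * (`|a| `^ al + `|b| `^ al) * `|a - b| =
   `|a| `^ al * `|a - b| + al * `|a| `^ al * `|a - b| + (1 + al) * `|b| `^ al * `|a - b| by ring.
lra.
Qed.

Lemma powR_add_le al x y : 0 < al -> 0 <= x -> 0 <= y ->
  (x + y) `^ al <= 2 `^ al * (x `^ al + y `^ al).
Proof.
move=> al0 x0 y0; wlog yx : x y x0 y0 / y <= x => [H|].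
  case/orP: (le_total y x) => yx; first exact: H.
  by rewrite addrC (addrC (x `^ al)); exact: H.
apply: le_trans (_ : (2 * x) `^ al <= _).
  by apply: ge0_ler_powR; rewrite ?nnegrE ?(ltW al0) ?addr_ge0 ?mulr_ge0 //; lra.
by rewrite powRM // ler_wpM2l ?powR_ge0 // lerDl powR_ge0.
Qed.

Lemma powR_inv_le al x c : 0 < al -> 0 <= x -> x `^ al <= c -> x <= c `^ al^-1.
Proof.
move=> al0 x0 xc.
have -> : x = (x `^ al) `^ al^-1 by rewrite -powRrM mulfV ?gt_eqF // powRr1.
by apply: ge0_ler_powR; rewrite ?nnegrE ?invr_ge0 ?(ltW al0) ?powR_ge0 ?(le_trans (powR_ge0 _ _) xc).
Qed.

Lemma le_1_powR K al : 0 <= al -> 0 < K -> K <= 1 + K `^ (al + 1).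
Proof.
move=> al0 K0; have p := powR_ge0 K (al + 1).
have [K1|K1] := leP K 1; first lra.
have : K `^ 1 <= K `^ (al + 1) by apply: ler_powR; [exact: ltW|lra].
by rewrite powRr1 ?(ltW K0) //; lra.
Qed.

Lemma powR_half_nat (t : R) n : 0 <= t -> t `^ (n%:R / 2) = Num.sqrt t ^+ n.
Proof.
by move=> t0; rewrite -powR12_sqrt // mulrC powRrM powR_mulrn // powR_ge0.
Qed.

Lemma powRD1 x al : 0 <= x -> 0 < al -> x `^ (al + 1) = x `^ al * x.
Proof.
move=> x0 al0; rewrite powRD ?powRr1 //.
by apply/implyP => /eqP; lra.
Qed.

End powers.

Section weights_theta.
Context {R : realType} {N : nat}.
Variables (theta : R -> R) (delta : R).
Hypothesis htheta : is_cutoff_profile theta.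
Hypothesis delta0 : 0 < delta.
Implicit Types (t : R) (x : 'rV[R]_N).

Lemma theta_ge0 s : 0 <= theta s.
Proof.
have [_ mono th0 th2] := htheta.
have [s1|s1] := leP s 1; first by rewrite th0.
by rewrite -(th0 1 (lexx _)) mono // ltW.
Qed.

Lemma theta_le1 s : theta s <= 1.
Proof.
have [_ mono th0 th2] := htheta.
have [s1|s1] := leP 2 s; first by rewrite th2.
by rewrite -(th2 2 (lexx _)) mono // ltW.
Qed.

Lemma a_gt0 j : 0 < a_ delta j.
Proof. by rewrite mulr_gt0 // invr_gt0 exprn_gt0. Qed.

Lemma a_S j : a_ delta j.+1 = a_ delta j / 2.
Proof. by rewrite /a_ exprS; field; rewrite expf_neq0. Qed.

Lemma a_le i j : (i <= j)%N -> a_ delta j <= a_ delta i.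
Proof.
move=> ij; rewrite ler_wpM2r ?(ltW delta0) // lef_pV2 ?posrE ?exprn_gt0 //.
by apply: ler_weXn2l => //; rewrite ler1n.
Qed.

Lemma chi_ge0 j x : 0 <= chi theta delta j x. Proof. exact: theta_ge0. Qed.
Lemma chi_le1 j x : chi theta delta j x <= 1. Proof. exact: theta_le1. Qed.

Lemma chi_eq0 j x : enorm x <= a_ delta j -> chi theta delta j x = 0.
Proof.
move=> xa; have [_ _ th0 _] := htheta; apply: th0.
by rewrite ler_pdivrMr ?a_gt0 // mul1r.
Qed.

Lemma sum_chiE m t x : 0 <= t ->
  sum_chi theta delta m t x = \sum_(1 <= j < m.+1) Num.sqrt t ^+ j.-1 * chi theta delta j x.
Proof.
move=> t0; apply: eq_big_nat => j /andP[j1 _].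
by rewrite -powR_half_nat // -subn1 natrB.
Qed.

Lemma sum_chi_ge0 m t x : 0 <= sum_chi theta delta m t x.
Proof. by apply: sumr_ge0 => j _; rewrite mulr_ge0 ?powR_ge0 ?chi_ge0. Qed.

Lemma sqrt_le_half t : t <= 1 / 4 -> Num.sqrt t <= 1 / 2.
Proof.
move=> t4; rewrite (_ : 1 / 2 = Num.sqrt (1 / 4)); first exact: ler_wsqrtr.
rewrite (_ : 1 / 4 = (1 / 2) ^+ 2); last by field.
by rewrite sqrtr_sqr ger0_norm.
Qed.

(** A geometric series of ratio at most 1/2. *)
Lemma sum_chi_le2 m t x : 0 <= t -> t <= 1 / 4 -> sum_chi theta delta m t x <= 2.
Proof.
move=> t0 t4; rewrite sum_chiE //.
suff : \sum_(1 <= j < m.+1) Num.sqrt t ^+ j.-1 * chi theta delta j x <= 2 - 2 * (1 / 2) ^+ m.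
  have : 0 <= (1 / 2 : R) ^+ m by rewrite exprn_ge0.
  by lra.
elim: m => [|m IH]; first by rewrite big_geq // expr0; lra.
rewrite big_nat_recr //=.
have h1 : Num.sqrt t ^+ m * chi theta delta m.+1 x <= (1 / 2) ^+ m.
  rewrite -[leRHS]mulr1; apply: ler_pM; rewrite ?exprn_ge0 ?sqrtr_ge0 ?chi_ge0 ?chi_le1 //.
  by apply: lerXn2r; rewrite ?nnegrE ?sqrtr_ge0 ?sqrt_le_half.
by rewrite exprS; lra.
Qed.

Lemma chi1_sum_chi m t x : (1 <= m)%N -> 0 <= t ->
  chi theta delta 1 x <= sum_chi theta delta m t x.
Proof.
move=> m1 t0; rewrite sum_chiE // big_nat_recl //= expr0 mul1r lerDl.
by apply: sumr_ge0 => j _; rewrite mulr_ge0 ?exprn_ge0 ?sqrtr_ge0 ?chi_ge0.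
Qed.

Lemma powR_m2 m t : (2 <= m)%N -> 0 < t ->
  t `^ (m%:R / 2) = t * t `^ ((m%:R - 2) / 2).
Proof.
move=> m2 t0; rewrite (_ : m%:R / 2 = (m%:R - 2) / 2 + 1); last by field.
rewrite powRD ?powRr1 ?(ltW t0) 1?mulrC //.
by rewrite (gt_eqF t0) implybT.
Qed.

Lemma Theta_gt0 K m t x : 0 < K -> 0 < t -> 0 < Theta theta delta K m t x.
Proof.
by move=> K0 t0; rewrite mulr_gt0 // ltr_pwDl ?powR_gt0 // sum_chi_ge0.
Qed.

Lemma powR_half_le1 m t : 0 <= t -> t <= 1 / 4 -> t `^ (m%:R / 2) <= 1.
Proof.
move=> t0 t4; rewrite powR_half_nat //; apply: exprn_ile1; first exact: sqrtr_ge0.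
by apply: le_trans (sqrt_le_half t4) _; lra.
Qed.

Lemma Theta_le K m t x : 0 < K -> 0 <= t -> t <= 1 / 4 -> Theta theta delta K m t x <= 3 * K.
Proof.
move=> K0 t0 t4; rewrite [leRHS]mulrC /Theta ler_pM2l //.
by have := powR_half_le1 m t0 t4; have := sum_chi_le2 m x t0 t4; lra.
Qed.

Lemma Theta_le_h K m t x : 0 < K -> 0 < t -> (2 <= m)%N ->
  Theta theta delta K m t x <= K * hfun theta delta m t x.
Proof.
move=> K0 t0 m2; rewrite ler_pM2l // /hfun powR_m2 //.
have S0 := sum_chi_ge0 m t x; have p0 := powR_ge0 t ((m%:R - 2) / 2).
have e0 : 0 <= enorm x ^- 2 by rewrite invr_ge0 exprn_ge0 // enorm_ge0.
have := mulr_ge0 e0 S0; move: S0 p0 e0.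
move: (enorm x ^- 2) (sum_chi _ _ _ _ _) (_ `^ _) => e S P; lra.
Qed.

Lemma hfun_ge0 m t x : 0 <= t -> 0 <= hfun theta delta m t x.
Proof.
move=> t0; rewrite addr_ge0 // mulr_ge0 ?sum_chi_ge0 ?powR_ge0 ?addr_ge0 //.
by rewrite invr_ge0 exprn_ge0 // enorm_ge0.
Qed.

Lemma hfun_ge1 m t x : (1 <= m)%N -> 0 <= t -> delta <= enorm x -> 1 <= hfun theta delta m t x.
Proof.
move=> m1 t0 dx; have [_ _ _ th2] := htheta.
have c1 : chi theta delta 1 x = 1.
  by apply: th2; rewrite ler_pdivlMr ?a_gt0 // /a_ expr1 mulrA mulfV // mul1r.
have := chi1_sum_chi x m1 t0; rewrite c1 => S1.
have e0 : 0 <= enorm x ^- 2 by rewrite invr_ge0 exprn_ge0 // enorm_ge0.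
have := mulr_ge0 e0 (sum_chi_ge0 m t x).
have : 0 <= (1 + t) * t `^ ((m%:R - 2) / 2) by rewrite mulr_ge0 ?powR_ge0 ?addr_ge0.
rewrite /hfun mulrDl mul1r; lra.
Qed.

(** The two terms of the weight [hfun] absorb the two bounds on the potential
    [`|U| `^ alpha], by the inverse of the time and of the squared distance. *)
Lemma potential_Theta_le al A1 K m t x (p : R) :
  0 < al -> 0 <= A1 -> 0 < K -> (2 <= m)%N -> 0 < t -> t <= 1 / 4 ->
  0 <= p -> p <= A1 * min_inv t x ->
  (p + Theta theta delta K m t x `^ al) * Theta theta delta K m t x <=
  (A1 + 3 `^ al) * (1 + K `^ (al + 1)) * hfun theta delta m t x.
Proof.
move=> al0 A10 K0 m2 t0 t4 p0 pA.
have Th0 := Theta_gt0 m x K0 t0; have h0 := hfun_ge0 m x (ltW t0).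
have K1 := le_1_powR (ltW al0) K0.
have pt : p <= A1 * t^-1.
  apply: le_trans pA _; rewrite ler_wpM2l // /min_inv; case: ifP => // _.
  by rewrite ge_min lexx.
have px : p * sum_chi theta delta m t x <= A1 * enorm x ^- 2 * sum_chi theta delta m t x.
  have [x0|x0] := eqVneq x 0.
    rewrite /sum_chi big1 ?mulr0 // => j _; rewrite chi_eq0 ?mulr0 //.
    rewrite x0 /enorm /dot big1 ?sqrtr0 ?(ltW (a_gt0 j)) // => i _.
    by rewrite mxE mul0r.
  rewrite ler_wpM2r ?sum_chi_ge0 //; apply: le_trans pA _.
  by rewrite /min_inv (negbTE x0) ler_wpM2l // ge_min lexx orbT.
have pm : p * t `^ (m%:R / 2) <= A1 * t `^ ((m%:R - 2) / 2).
  rewrite powR_m2 // mulrA ler_wpM2r ?powR_ge0 //.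
  by rewrite -ler_pdivlMr.
have S0 := sum_chi_ge0 m t x; have q0 := powR_ge0 t ((m%:R - 2) / 2).
have e1 : p * Theta theta delta K m t x <= A1 * K * hfun theta delta m t x.
  rewrite /Theta /hfun mulrCA (mulrC A1) -mulrA ler_pM2l // !mulrDr.
  have := mulr_ge0 A10 S0; have := mulr_ge0 A10 (mulr_ge0 (ltW t0) q0).
  move: px pm; move: (enorm x ^- 2) (sum_chi _ _ _ _ _) (_ `^ _) (_ `^ _) => e S P Q.
  by lra.
have e2 : Theta theta delta K m t x `^ al * Theta theta delta K m t x <=
    3 `^ al * K `^ (al + 1) * hfun theta delta m t x.
  rewrite (powRD1 (ltW K0) al0) -mulrA -mulrA mulrA -powRM ?(ltW K0) //.
  apply: ler_pM; rewrite ?powR_ge0 ?(ltW Th0) //; last exact: Theta_le_h.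
  apply: ge0_ler_powR; rewrite ?nnegrE ?(ltW al0) ?(ltW Th0) ?mulr_ge0 ?(ltW K0) //.
  exact: Theta_le (ltW t0) t4.
have e3 := ler_wpM2r h0 (ler_wpM2l A10 K1).
have e4 : 0 <= 3 `^ al * hfun theta delta m t x by rewrite mulr_ge0 ?powR_ge0.
rewrite mulrDl; rewrite (_ : (A1 + 3 `^ al) * _ * _ =
  A1 * (1 + K `^ (al + 1)) * hfun theta delta m t x + (3 `^ al * hfun theta delta m t x +
  3 `^ al * K `^ (al + 1) * hfun theta delta m t x)); last by ring.
lra.
Qed.

End weights_theta.

Section ball_closure.
Context {R : realType} {N : nat}.
Local Notation E := 'rV[R]_N.

Lemma enormZ (s : R) (x : E) : enorm (s *: x) = `|s| * enorm x.
Proof.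
rewrite /enorm (_ : dot (s *: x) (s *: x) = s ^+ 2 * dot x x).
  by rewrite sqrtrM ?sqr_ge0 // sqrtr_sqr.
by rewrite /dot mulr_sumr; apply: eq_bigr => i _; rewrite !mxE; ring.
Qed.

Lemma eq_on_closed_ball (f : E -> R) c (delta : R) : 0 < delta -> continuous f ->
  (forall x, enorm x < delta -> f x = c) -> forall x, enorm x <= delta -> f x = c.
Proof.
move=> d0 cf fc x xd.
have cs : f (s *: x) @[s --> (1 : R)^'-] --> f x.
  apply: cvg_at_left_filter.
  have -> : f x = f (1 *: x) by rewrite scale1r.
  apply: (@continuous_comp _ _ _ (fun s : R => s *: x) f); last exact: cf.
  by apply: cvgZr_tmp; exact: cvg_id.
have nc : \forall s \near (1 : R)^'-, f (s *: x) = c.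
  have s1 : \forall s \near (1 : R)^'-, s < 1 by exact: nbhs_left_lt.
  have s0 : \forall s \near (1 : R)^'-, 0 < s by apply: nbhs_left_gt.
  apply: filterS2 s1 s0 => s s1 s0; apply: fc; rewrite enormZ gtr0_norm //.
  have [x0|x0] := eqVneq (enorm x) 0; first by rewrite x0 mulr0.
  have xp : 0 < enorm x by rewrite lt_neqAle eq_sym x0 enorm_ge0.
  by apply: lt_le_trans xd; rewrite gtr_pMl.
have cc : f (s *: x) @[s --> (1 : R)^'-] --> c.
  apply: (@cvg_trans _ (cst c @ (1 : R)^'-)); last exact: cvg_cst.
  by apply: near_eq_cvg; apply: filterS nc => s ->.
exact: (cvg_unique _ cs cc).
Qed.

Lemma open_ball (delta : R) : open [set x : E | enorm x < delta].
Proof.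
apply: (@open_comp _ _ (@enorm R N) [set s | s < delta]); last exact: open_lt.
by move=> y _; exact: continuous_enorm.
Qed.

Lemma coord_le_enorm (x : E) i : `|x 0 i| <= enorm x.
Proof.
rewrite -sqrtr_sqr; apply: ler_wsqrtr; rewrite /dot (bigD1 i) //= -expr2 lerDl.
by apply: sumr_ge0 => j _; rewrite -expr2 sqr_ge0.
Qed.

End ball_closure.

Lemma ae_and d (X : measurableType d) (R : realType) (m : {measure set X -> \bar R})
    (P Q S : X -> Prop) :
  (\forall x \ae m, P x) -> (\forall x \ae m, Q x) ->
  (forall x, P x -> Q x -> S x) -> \forall x \ae m, S x.
Proof. by move=> aP aQ H; apply: filterS2 aP aQ. Qed.

Section almost_everywhere_cylinder.
Context {R : realType} {N : nat}.
Variables (Omega : set 'rV[R]_N) (T : R).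
Implicit Types P Q S : R -> 'rV[R]_N -> Prop.

Lemma ae_cyl2 P Q S : ae_cyl Omega T P -> ae_cyl Omega T Q ->
  (forall t x, cylinder Omega T (t, x) -> P t x -> Q t x -> S t x) ->
  ae_cyl Omega T S.
Proof.
move=> aP aQ H; apply: (ae_and aP aQ) => -[t x] /= HP HQ tx.
by apply: H => //; [exact: HP|exact: HQ].
Qed.

Lemma ae_cyl1 P S : ae_cyl Omega T P ->
  (forall t x, cylinder Omega T (t, x) -> P t x -> S t x) -> ae_cyl Omega T S.
Proof. by move=> aP H; apply: (ae_cyl2 aP aP) => t x tx p _; exact: H. Qed.

Lemma ae_cylT P : (forall t x, cylinder Omega T (t, x) -> P t x) -> ae_cyl Omega T P.
Proof.
move=> H; exists set0; split; [exact: measurable0|exact: measure0|].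
by move=> [t x] /= nP; apply: nP => tx; exact: H.
Qed.

End almost_everywhere_cylinder.

Section constant_A.
Context {R : realType} {N : nat}.
Local Notation E := 'rV[R]_N.
Variables (theta : R -> R) (htheta : is_cutoff_profile theta).
Variables (alpha delta T0 A1 : R) (Omega : set E) (U : R -> E -> R) (Psi : E -> R).
Hypotheses (al0 : 0 < alpha) (delta0 : 0 < delta) (A10 : 0 <= A1).
Hypothesis hUbound : forall t x, cylinder Omega T0 (t, x) ->
  `|U t x| `^ alpha <= A1 * min_inv t x.
Hypothesis hgradU : forall t x, cylinder Omega T0 (t, x) -> delta < enorm x ->
  enorm (grad (U t) x) `^ alpha <= A1.
Hypothesis hPsi : is_C2_W2oo Psi.
Hypothesis hPsi01 : forall x, 0 <= Psi x <= 1.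
Hypothesis hPsi1 : forall x, enorm x < delta -> Psi x = 1.

(** The cut-off terms of [calM] vanish on the closed ball: in the open ball because
    [Psi] is locally constant there, on its boundary by continuity. *)
Lemma Psi_closed_ball x : enorm x <= delta ->
  [/\ Psi x = 1, grad Psi x = 0 & laplacian Psi x = 0].
Proof.
have [[[dP cP cdP] C2] _] := hPsi.
have near1 y : enorm y < delta -> \forall z \near y, Psi z = cst 1 z.
  move=> yd; have := open_nbhs_nbhs (conj (@open_ball R N delta) yd).
  by apply: filterS => z; exact: hPsi1.
have pd0 i y : enorm y < delta -> pd i Psi y = 0.
  by move=> yd; rewrite /pd (near_eq_derive _ (near1 y yd)); exact: derive_cst.
have pd00 i y : enorm y < delta -> pd i (pd i Psi) y = 0.
  move=> yd; rewrite {1}/pd (near_eq_derive (g := cst 0)); first exact: derive_cst.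
  have := open_nbhs_nbhs (conj (@open_ball R N delta) yd).
  by apply: filterS => z; exact: pd0.
move=> xd; split.
- exact: (eq_on_closed_ball delta0 cP hPsi1 xd).
- apply/rowP => i; rewrite !mxE.
  exact: (eq_on_closed_ball delta0 (cdP i) (pd0 i) xd).
- rewrite /laplacian big1 // => i _; have [_ _ cdd] := C2 i.
  exact: (eq_on_closed_ball delta0 (cdd i) (pd00 i) xd).
Qed.

Let Mpsi : R := xget 0 [set M | forall x,
    [/\ `|Psi x| <= M, forall i, `|pd i Psi x| <= M &
        forall i j, `|pd j (pd i Psi) x| <= M]].

Let MpsiP x : [/\ forall i, `|pd i Psi x| <= Mpsi &
        forall i j, `|pd j (pd i Psi) x| <= Mpsi].
Proof.
have [_ ex] := hPsi; have := xgetPex 0 ex => /(_ x) [_ h1 h2]; split.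
  exact: h1.
exact: h2.
Qed.

Let Mpsi0 : 0 <= Mpsi.
Proof.
have [_ ex] := hPsi; have := xgetPex 0 ex => /(_ 0) [h _ _].
exact: le_trans (normr_ge0 _) h.
Qed.

Let gU := A1 `^ alpha^-1.
Let dU := (A1 * delta ^- 2) `^ alpha^-1.
Let c0 := 2 * (N%:R * (gU * Mpsi)) + dU * (N%:R * Mpsi).

Let Ain := 2 * (1 + alpha) * (2 `^ alpha + 1) * (A1 + 3 `^ alpha).
Let Aout := c0 + dU `^ (alpha + 1) + 2 `^ (alpha + 1) * (dU `^ (alpha + 1) + 3 `^ (alpha + 1))
  + 6 * (1 + alpha) * 2 `^ alpha * (dU `^ alpha + 3 `^ alpha).

Lemma dot_bound (u v : E) (a b : R) :
  enorm u <= a -> (forall i, `|v 0 i| <= b) -> `|dot u v| <= N%:R * (a * b).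
Proof.
move=> ua vb; apply: le_trans (ler_norm_sum _ _ _) _.
rewrite (_ : N%:R * _ = \sum_(i < N) a * b); last by rewrite sumr_const card_ord mulr_natl.
apply: ler_sum => i _; rewrite normrM; apply: ler_pM => //.
exact: le_trans (coord_le_enorm u i) ua.
Qed.

Section pointwise.
Variables (K t : R) (m : nat) (x : E) (w z : R -> E -> R).
Hypotheses (K0 : 0 < K) (m2 : (2 <= m)%N) (t4 : t <= 1 / 4).
Hypothesis tx : cylinder Omega T0 (t, x).
Let Th := Theta theta delta K m t x.
Let h := hfun theta delta m t x.
Hypotheses (wT : `|w t x| <= Th) (zT : `|z t x| <= Th).

Let t0 : 0 < t.
Proof. by have [/=] := tx; rewrite in_itv /= => /andP[]. Qed.
Let Th0 : 0 < Th. Proof. exact: Theta_gt0. Qed.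
Let h0 : 0 <= h. Proof. by apply: hfun_ge0 => //; exact: ltW. Qed.
Let ThK : Th <= 3 * K. Proof. by apply: Theta_le => //; exact: ltW. Qed.
Let kk := 1 + K `^ (alpha + 1).
Let kk0 : 0 <= kk. Proof. by rewrite addr_ge0 ?powR_ge0. Qed.
Let ratioE : `|w t x - z t x| = `|(w t x - z t x) / Th| * Th.
Proof. by rewrite normrM normfV (gtr0_norm Th0) divfK // gt_eqF. Qed.

Lemma powR_sum_bound (u v p : R) : `|v| <= Th -> `|u| `^ alpha <= p ->
  `|u + v| `^ alpha <= 2 `^ alpha * (p + Th `^ alpha).
Proof.
move=> vT up; apply: le_trans (_ : (`|u| + `|v|) `^ alpha <= _).
  by apply: ge0_ler_powR; rewrite ?nnegrE ?addr_ge0 ?(ltW al0) // ler_normD.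
apply: le_trans (powR_add_le al0 (normr_ge0 u) (normr_ge0 v)) _.
rewrite ler_wpM2l ?powR_ge0 //; apply: lerD => //.
by apply: ge0_ler_powR; rewrite ?nnegrE ?(ltW al0) ?(ltW Th0).
Qed.

(** Inside the ball [calM w] is the increment of the power nonlinearity between [U]
    and [U + w]. *)
Lemma calM_inner : enorm x <= delta ->
  `|calM alpha U Psi w t x| <= Ain * kk * h /\
  `|calM alpha U Psi w t x - calM alpha U Psi z t x| <=
    Ain * kk * `|(w t x - z t x) / Th| * h.
Proof.
move=> xd; have [P1 P2 P3] := Psi_closed_ball xd.
have g0 : dot (grad (U t) x) (grad Psi x) = 0.
  by rewrite P2 /dot big1 // => i _; rewrite !mxE mulr0.
pose p := `|U t x| `^ alpha; have p0 : 0 <= p by exact: powR_ge0.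
have key := potential_Theta_le htheta delta0 al0 A10 K0 m2 t0 t4 p0 (hUbound tx).
rewrite -/Th -/h -/kk in key.
have q0 := powR_ge0 Th alpha.
have ME v : calM alpha U Psi v t x = `|U t x + v t x| `^ alpha * (U t x + v t x) - p * U t x.
  by rewrite /calM g0 P3 P1 !mulr0 !mul1r !add0r.
have bw := powR_sum_bound wT (lexx p); have bz := powR_sum_bound zT (lexx p).
have c2 : 0 < 2 `^ alpha by rewrite powR_gt0.
have al1 : 0 <= 1 + alpha by rewrite addr_ge0 // ltW.
have kh0 : 0 <= (A1 + 3 `^ alpha) * kk * h by rewrite !mulr_ge0 // addr_ge0 ?powR_ge0.
have AE : Ain * kk * h = (1 + alpha) * (2 * (2 `^ alpha + 1)) * ((A1 + 3 `^ alpha) * kk * h).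
  by rewrite /Ain; ring.
have grow (s : R) : 0 <= s -> s <= 2 * (2 `^ alpha + 1) * (p + Th `^ alpha) ->
   (1 + alpha) * s * Th <= Ain * kk * h.
  move=> s0 sle; rewrite AE -!mulrA; rewrite ler_wpM2l //.
  apply: le_trans (ler_wpM2r (ltW Th0) sle) _.
  have c3 : 0 <= 2 * (2 `^ alpha + 1) by rewrite mulr_ge0 // addr_ge0 // ltW.
  by have := ler_wpM2l c3 key; rewrite -!mulrA.
split.
  rewrite ME; apply: le_trans (power_lip _ _ al0) _.
  rewrite addrAC subrr add0r.
  apply: le_trans (_ : (1 + alpha) * (`|U t x + w t x| `^ alpha + p) * Th <= _).
    by rewrite ler_wpM2l // mulr_ge0 // addr_ge0 ?powR_ge0.
  apply: grow; first by rewrite addr_ge0 ?powR_ge0.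
  have := mulr_ge0 (ltW c2) p0; have := mulr_ge0 (ltW c2) q0.
  by move: bw; lra.
rewrite !ME opprB addrA subrK; apply: le_trans (power_lip _ _ al0) _.
rewrite opprD addrACA subrr add0r ratioE.
rewrite mulrCA mulrA mulrAC -mulrA [leRHS]mulrAC [leRHS]mulrC ler_wpM2l //.
rewrite mulrC; apply: grow; first by rewrite addr_ge0 ?powR_ge0.
have := mulr_ge0 (ltW c2) p0; have := mulr_ge0 (ltW c2) q0.
by move: bw bz; lra.
Qed.

(** Outside of the ball [U] and its gradient are bounded while the weight [hfun] is
    at least 1, so that crude bounds suffice. *)
Lemma calM_outer : delta < enorm x ->
  `|calM alpha U Psi w t x| <= Aout * kk * h /\
  `|calM alpha U Psi w t x - calM alpha U Psi z t x| <=
    Aout * kk * `|(w t x - z t x) / Th| * h.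
Proof.
move=> xd; have [M1 M2] := MpsiP x.
have al1 : 0 <= 1 + alpha by rewrite addr_ge0 // ltW.
have h1 : 1 <= h by apply: hfun_ge1 => //; [exact: ltnW|exact: ltW|exact: ltW].
have kk1 : 1 <= kk by rewrite lerDl powR_ge0.
have xp : 0 < enorm x by exact: lt_trans xd.
have x0 : x != 0.
  apply: contraTneq xp => ->; rewrite /enorm /dot big1 ?sqrtr0 ?ltxx // => i _.
  by rewrite mxE mul0r.
have Ule : `|U t x| <= dU.
  apply: (powR_inv_le al0) => //; apply: le_trans (hUbound tx) _.
  rewrite ler_wpM2l // /min_inv (negbTE x0) ge_min; apply/orP; right.
  rewrite lef_pV2 ?posrE ?exprn_gt0 //; apply: lerXn2r; rewrite ?nnegrE ?(ltW delta0) ?(ltW xp) //.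
  exact: ltW.
have gle : enorm (grad (U t) x) <= gU.
  by apply: (powR_inv_le al0); [exact: enorm_ge0|exact: hgradU].
have d0 : 0 <= dU by exact: powR_ge0.
have gU0 : 0 <= gU by exact: powR_ge0.
have /andP[P0 P1] := hPsi01 x.
have lin : `|2 * dot (grad (U t) x) (grad Psi x) + U t x * laplacian Psi x| <= c0.
  apply: le_trans (ler_normD _ _) _; apply: lerD; rewrite normrM.
    rewrite (ger0_norm (_ : 0 <= 2)) // ler_wpM2l //; apply: dot_bound => // i.
    by rewrite mxE.
  apply: ler_pM => //; apply: le_trans (ler_norm_sum _ _ _) _.
  rewrite (_ : N%:R * _ = \sum_(i < N) Mpsi); last by rewrite sumr_const card_ord mulr_natl.
  by apply: ler_sum => i _; exact: M2.
have sumle v : `|v t x| <= Th -> `|Psi x * U t x + v t x| <= dU + 3 * K.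
  move=> vT; apply: le_trans (ler_normD _ _) _; apply: lerD; last exact: le_trans vT ThK.
  by rewrite normrM (ger0_norm P0) -[leRHS]mul1r; apply: ler_pM.
have K3 : 0 <= 3 * K by rewrite mulr_ge0 // ltW.
have powle v be : 0 < be -> `|v t x| <= Th ->
    `|Psi x * U t x + v t x| `^ be <= 2 `^ be * (dU `^ be + 3 `^ be * K `^ be).
  move=> be0 vT; apply: le_trans (_ : (dU + 3 * K) `^ be <= _).
    by apply: ge0_ler_powR; rewrite ?nnegrE ?(ltW be0) ?addr_ge0 // sumle.
  by apply: le_trans (powR_add_le be0 d0 K3) _; rewrite powRM ?(ltW K0).
have p1 := powR_ge0 dU alpha; have p2 := powR_ge0 dU (alpha + 1).
have p3 := powR_ge0 3 alpha; have p4 := powR_ge0 3 (alpha + 1).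
have p5 := powR_ge0 2 alpha; have p6 := powR_ge0 2 (alpha + 1).
have p7 := powR_ge0 K (alpha + 1); have p8 := powR_ge0 K alpha.
have c00 : 0 <= c0 by exact: le_trans (normr_ge0 _) lin.
have KK := le_1_powR (ltW al0) K0.
have last0 : 0 <= 6 * (1 + alpha) * 2 `^ alpha * (dU `^ alpha + 3 `^ alpha).
  by rewrite !mulr_ge0 // addr_ge0.
have first0 : 0 <= c0 + dU `^ (alpha + 1) + 2 `^ (alpha + 1) * (dU `^ (alpha + 1) + 3 `^ (alpha + 1)).
  apply: addr_ge0; first exact: addr_ge0.
  by apply: mulr_ge0 => //; exact: addr_ge0.
have powS v : 0 <= `|v| -> `|v| `^ alpha * `|v| = `|v : R| `^ (alpha + 1) by move=> v0; rewrite powRD1.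
have grow (s : R) : 0 <= s -> s <= Aout * kk -> s <= Aout * kk * h.
  by move=> s0 /le_trans; apply; rewrite ler_peMr //; rewrite mulr_ge0 // addr_ge0.
split.
  apply: grow => //; rewrite /calM.
  have b1 : `| `|Psi x * U t x + w t x| `^ alpha * (Psi x * U t x + w t x)| <=
     2 `^ (alpha + 1) * (dU `^ (alpha + 1) + 3 `^ (alpha + 1) * K `^ (alpha + 1)).
    rewrite normrM (ger0_norm (powR_ge0 _ _)) powS //.
    by apply: powle => //; rewrite addr_gt0.
  have b2 : `|Psi x * (`|U t x| `^ alpha * U t x)| <= dU `^ (alpha + 1).
    rewrite !normrM (ger0_norm P0) (ger0_norm (powR_ge0 _ _)) powS //.
    rewrite -[leRHS]mul1r; apply: ler_pM; rewrite ?powR_ge0 //.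
    by apply: ge0_ler_powR; rewrite ?nnegrE ?addr_ge0 // ltW.
  apply: le_trans (ler_normB _ _) _.
  apply: le_trans (_ : c0 + 2 `^ (alpha + 1) * (dU `^ (alpha + 1) + 3 `^ (alpha + 1) * K `^ (alpha + 1)) + dU `^ (alpha + 1) <= _).
    by apply: lerD => //; apply: le_trans (ler_normD _ _) _; apply: lerD.
  apply: le_trans (_ : (c0 + dU `^ (alpha + 1) + 2 `^ (alpha + 1) * (dU `^ (alpha + 1) + 3 `^ (alpha + 1))) * kk <= _).
    have := mulr_ge0 (addr_ge0 c00 p2) p7.
    have := mulr_ge0 (mulr_ge0 p6 p2) p7; have := mulr_ge0 p6 p4; rewrite /kk.
    move: (dU `^ _) (2 `^ _) (3 `^ _) (K `^ _) c0 => a b c d e; lra.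
  by rewrite ler_wpM2r // /Aout lerDl.
have E1 : calM alpha U Psi w t x - calM alpha U Psi z t x =
   `|Psi x * U t x + w t x| `^ alpha * (Psi x * U t x + w t x) -
   `|Psi x * U t x + z t x| `^ alpha * (Psi x * U t x + z t x).
  by rewrite /calM; ring.
rewrite E1; apply: le_trans (power_lip _ _ al0) _.
rewrite opprD addrACA subrr add0r ratioE.
rewrite mulrCA [leRHS]mulrAC [leRHS]mulrC ler_wpM2l //.
apply: grow; first by rewrite mulr_ge0 ?(ltW Th0) // mulr_ge0 // addr_ge0 ?powR_ge0.
have b1 := powle w alpha al0 wT; have b2 := powle z alpha al0 zT.
apply: le_trans (_ : 6 * (1 + alpha) * 2 `^ alpha * (dU `^ alpha + 3 `^ alpha) * kk <= _); last first.
  by rewrite ler_wpM2r // /Aout lerDr.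
apply: le_trans (_ : (1 + alpha) * (2 * (2 `^ alpha * (dU `^ alpha + 3 `^ alpha * K `^ alpha))) * (3 * K) <= _).
  apply: ler_pM => //; [by rewrite mulr_ge0 // addr_ge0 ?powR_ge0|exact: ltW|].
  rewrite ler_wpM2l //; apply: le_trans (lerD b1 b2) _.
  by rewrite [leRHS]mulr_natl mulr2n.
have e1 : (dU `^ alpha + 3 `^ alpha * K `^ alpha) * K <= (dU `^ alpha + 3 `^ alpha) * kk.
  rewrite [leRHS]mulrDl mulrDl -mulrA -(powRD1 (ltW K0) al0).
  by apply: lerD; rewrite ler_wpM2l // lerDr.
have c6 : 0 <= 6 * (1 + alpha) * 2 `^ alpha by rewrite !mulr_ge0.
have := ler_wpM2l c6 e1.
rewrite (_ : (1 + alpha) * _ * (3 * K) = 6 * (1 + alpha) * 2 `^ alpha * ((dU `^ alpha + 3 `^ alpha * K `^ alpha) * K)); last by ring.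
by rewrite !mulrA.
Qed.

End pointwise.

Lemma exists_constant_A : exists A, is_constant_A theta delta alpha Omega U Psi T0 A.
Proof.
have al1 : 0 <= 1 + alpha by rewrite addr_ge0 // ltW.
have Ain0 : 0 <= Ain by rewrite !mulr_ge0 // addr_ge0 ?powR_ge0.
have d0 : 0 <= dU by exact: powR_ge0.
have gU0 : 0 <= gU by exact: powR_ge0.
have Aout0 : 0 <= Aout.
  have c00 : 0 <= c0 by apply: addr_ge0; rewrite !mulr_ge0.
  apply: addr_ge0; last by rewrite !mulr_ge0 ?powR_ge0 // addr_ge0 ?powR_ge0.
  apply: addr_ge0; first by rewrite addr_ge0 ?powR_ge0.
  by rewrite mulr_ge0 ?powR_ge0 // addr_ge0 ?powR_ge0.
exists (Ain + Aout + 1); split; first by lra.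
move=> K m T w z K0 m2 T0' TT [_ aw] [_ az].
move: TT; rewrite le_min => /andP[T4 TT0].
apply: (ae_cyl2 aw az) => t x tx {}aw {}az.
have [/= + Ox] := tx; rewrite in_itv /= => /andP[t0 tT].
have t4 : t <= 1 / 4 by exact: le_trans (ltW tT) T4.
have tx0 : cylinder Omega T0 (t, x).
  by split => //=; rewrite in_itv /= t0 (lt_le_trans tT TT0).
have k0 : 0 <= 1 + K `^ (alpha + 1) by rewrite addr_ge0 ?powR_ge0.
have h0 : 0 <= hfun theta delta m t x by apply: hfun_ge0 => //; exact: ltW.
have le1 : Ain <= Ain + Aout + 1 by lra.
have le2 : Aout <= Ain + Aout + 1 by lra.
have [xd|xd] := leP (enorm x) delta.
  have [b1 b2] := calM_inner K0 m2 t4 tx0 aw az xd.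
  by split; [apply: le_trans b1 _|apply: le_trans b2 _]; rewrite !ler_wpM2r.
have [b1 b2] := calM_outer K0 m2 t4 tx0 aw az xd.
by split; [apply: le_trans b1 _|apply: le_trans b2 _]; rewrite !ler_wpM2r.
Qed.

End constant_A.

(** * The Duhamel term *)

Section parametrized_integrals.
Context {R : realType} d1 d2 {X : measurableType d1} {Y : measurableType d2}.
Variable m : {sigma_finite_measure set Y -> \bar R}.

Lemma fine_integral_measurable (h : X * Y -> R) : measurable_fun setT h ->
  measurable_fun setT (fun x => \int[m]_y h (x, y)).
Proof.
move=> mh.
have mh' : measurable_fun setT (EFin \o h) by apply/measurable_EFinP.
have mp : measurable_fun setT (fubini_F m ((EFin \o h) ^\+)%E).
  apply: measurable_fun_fubini_tonelli_F; [exact: measurable_funepos|exact: funepos_ge0].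
have mn : measurable_fun setT (fubini_F m ((EFin \o h) ^\-)%E).
  apply: measurable_fun_fubini_tonelli_F; [exact: measurable_funeneg|exact: funeneg_ge0].
have -> : (fun x => \int[m]_y h (x, y)) = fine \o
    (fun x => fubini_F m ((EFin \o h) ^\+)%E x - fubini_F m ((EFin \o h) ^\-)%E x)%E.
  by apply/funext => x /=; rewrite /fubini_F /Rintegral integralE; rewrite funepos.unlock funeneg.unlock.
by apply: measurableT_comp; [exact: (fine_measurable measurableT)|exact: emeasurable_funB].
Qed.

(** The measures of the slices of a null set have integral zero. *)
Lemma ae_slices (m1 : {sigma_finite_measure set X -> \bar R}) (P : X * Y -> Prop) :
  (\forall p \ae (m1 \x m)%E, P p) ->
  \forall x \ae m1, \forall y \ae m, P (x, y).
Proof.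
move=> [A [mA A0 sA]].
have mS : measurable_fun setT (m \o xsection A) by exact: measurable_fun_xsection.
have : (\int[m1]_x `|(m \o xsection A) x| = 0)%E.
  rewrite -[RHS]A0; apply: eq_integral => x _.
  by rewrite gee0_abs // measure_ge0.
move/(ae_eq_integral_abs _ measurableT mS); apply: filterS => x Hx.
exists (xsection A x); split; first exact: measurable_xsection.
  exact: (Hx I).
by move=> y nP; rewrite /xsection /= mem_set //; exact: sA.
Qed.

End parametrized_integrals.

Section kernel_joint_measurability.
Context {R : realType} {N : nat}.
Local Notation E := 'rV[R]_N.
Local Notation RT := (measurableTypeR R).
Local Notation mu := (lebesgue_rV N).
Variables (Omega : set E) (G : R -> E -> E -> R).
Hypothesis oO : open Omega.
Hypothesis hG : is_dirichlet_heat_kernel Omega G.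
Let mO : measurable Omega := open_measurable_rV oO.

Definition kernel_domain : set (R * E * E) := [set p | 0 < p.1.1 /\ Omega p.1.2 /\ Omega p.2].

Let id3 (p : RT * E * E) : R * E * E := ((p.1.1, p.1.2), p.2).

Lemma open_kernel_domain : open kernel_domain.
Proof.
rewrite openE => -[[t x] y] [/= t0 [Ox Oy]].
exists ([set p : R * E | 0 < p.1 /\ Omega p.2], Omega); last by move=> -[[s a] b] [[/= s0 Oa] Ob].
split; last exact: open_nbhs_nbhs.
exists ([set s : R | 0 < s], Omega); last by move=> -[s a] [/= s0 Oa].
by split => /=; apply: open_nbhs_nbhs; split => //; exact: open_gt.
Qed.

Lemma kernel_jointly_measurable :
  measurable_fun (id3 @^-1` kernel_domain) (fun p : RT * E * E => G p.1.1 p.1.2 p.2).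
Proof.
have mb : measurable_base id3.
  exact: (measurable_base_prod (measurable_base_prod (measurable_base_R R) (@measurable_base_rV R N))
    (@measurable_base_rV R N)).
apply: (continuous_on_measurable (g := fun p => G p.1.1 p.1.2 p.2) mb open_kernel_domain).
by move=> -[[t x] y] [/= t0 [Ox Oy]]; have [+ _] := hG; exact.
Qed.

Lemma measurable_kernel_domain : measurable (id3 @^-1` kernel_domain).
Proof.
apply: measurable_open open_kernel_domain.
exact: (measurable_base_prod (measurable_base_prod (measurable_base_R R) (@measurable_base_rV R N))
    (@measurable_base_rV R N)).
Qed.

(** Extended by zero the kernel is a Borel function on the whole product, as
    measurability of parametrized integrals requires. *)
Definition kernel0 (p : RT * E * E) : R :=
  ((fun p : RT * E * E => G p.1.1 p.1.2 p.2) \_ (id3 @^-1` kernel_domain)) p.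

Lemma measurable_kernel0 : measurable_fun setT kernel0.
Proof.
apply/(measurable_restrictT _ measurable_kernel_domain); exact: kernel_jointly_measurable.
Qed.

Lemma kernel0E t x y : 0 < t -> Omega x -> Omega y -> kernel0 (t, x, y) = G t x y.
Proof. by move=> t0 Ox Oy; rewrite /kernel0 patchE mem_set. Qed.

Lemma cylinder_measurable T : measurable (cylinder Omega T : set (RT * E)).
Proof. by apply: measurableX => //; exact: measurable_itv. Qed.

Variable T : R.
Definition cylF (F : R -> E -> R) (p : RT * E) : R :=
  ((fun p : RT * E => F p.1 p.2) \_ (cylinder Omega T)) p.

Lemma measurable_cylF F :
  measurable_fun (cylinder Omega T : set (RT * E)) (fun p => F p.1 p.2) ->
  measurable_fun setT (cylF F).
Proof. by move=> mF; apply/(measurable_restrictT _ (cylinder_measurable T)). Qed.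

Lemma cylFE F t x : 0 < t -> t < T -> Omega x -> cylF F (t, x) = F t x.
Proof.
by move=> t0 tT Ox; rewrite /cylF patchE mem_set //; split => //=; rewrite in_itv /= t0.
Qed.

Lemma slice_measurable (F : R -> E -> R) (t : R) :
  measurable_fun (cylinder Omega T : set (RT * E)) (fun p => F p.1 p.2) ->
  0 < t -> t < T -> measurable_fun Omega (F t).
Proof.
move=> mF t0 tT.
have : measurable_fun Omega (fun x => cylF F (t, x)).
  apply: measurable_funTS; apply: measurableT_comp; first exact: measurable_cylF.
  exact: measurable_pair1.
by apply: eq_measurable_fun => x; rewrite inE => Ox; rewrite cylFE.
Qed.

Lemma heat_measurable (w0 : E -> R) : measurable_fun Omega w0 ->
  measurable_fun (cylinder Omega T : set (RT * E))
    (fun p => heat_semigroup Omega G p.1 w0 p.2).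
Proof.
move=> mw.
pose h (q : (RT * E) * E) := kernel0 q * (w0 \_ Omega) q.2.
have mh : measurable_fun setT h.
  apply: measurable_funM; first exact: measurable_kernel0.
  apply: measurableT_comp; last exact: measurable_snd.
  exact/(measurable_restrictT _ mO).
have := measurable_funTS (D := cylinder Omega T) (fine_integral_measurable mu mh).
apply: eq_measurable_fun => -[t x]; rewrite inE => -[/=]; rewrite in_itv /= => /andP[t0 tT] Ox.
rewrite /heat_semigroup Rintegral_mkcond; apply: eq_Rintegral => y _.
rewrite /h /= !patchE; case: ifPn => yO; last by rewrite mulr0.
by rewrite kernel0E //; move: yO; rewrite inE.
Qed.

Definition potential (F : R -> E -> R) (t : R) (x : E) : R :=
  \int[lebesgue_measure]_(s in [set` `]0, t[]) heat_semigroup Omega G (t - s) (F s) x.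

Lemma potential_measurable (F : R -> E -> R) :
  measurable_fun (cylinder Omega T : set (RT * E)) (fun p => F p.1 p.2) ->
  measurable_fun (cylinder Omega T : set (RT * E)) (fun p => potential F p.1 p.2) /\
  forall t x, 0 < t -> t < T -> Omega x ->
    measurable_fun [set` `]0, t[] (fun s : RT => heat_semigroup Omega G (t - s) (F s) x).
Proof.
move=> mF.
pose h (q : ((RT * E) * RT) * E) : R :=
  kernel0 ((q.1.1.1 - q.1.2 : R), q.1.1.2, q.2) * cylF F (q.1.2, q.2).
have mh : measurable_fun setT h.
  apply: measurable_funM.
    apply: (measurableT_comp measurable_kernel0); apply: measurable_fun_pair; last exact: measurable_snd.
    apply: measurable_fun_pair.
      apply: measurable_funB.
        by do 2 apply: measurableT_comp => //.
      by apply: measurableT_comp => //.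
    by do 2 apply: measurableT_comp => //.
  apply: (measurableT_comp (measurable_cylF mF)); apply: measurable_fun_pair => //.
  by apply: measurableT_comp.
pose H (q : (RT * E) * RT) : R := \int[mu]_y h (q, y).
have mH : measurable_fun setT H by exact: fine_integral_measurable.
have HE t x s : 0 < t -> t < T -> Omega x -> 0 < s -> s < t ->
    H ((t, x), s) = heat_semigroup Omega G (t - s) (F s) x.
  move=> t0 tT Ox s0 st; rewrite /heat_semigroup Rintegral_mkcond; apply: eq_Rintegral => y _.
  rewrite /h /= patchE; case: ifPn => yO.
    rewrite inE in yO; rewrite kernel0E ?subr_gt0 // cylFE //; exact: lt_trans tT.
  rewrite /cylF patchE; case: ifPn; last by rewrite mulr0.
  by rewrite inE => -[_ /= Oy]; move: yO; rewrite notin_setE.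
pose S : set ((RT * E) * RT) := [set q | 0 < q.2 < q.1.1].
have mpos (k : (RT * E) * RT -> R) : measurable_fun setT k -> measurable [set q | 0 < k q].
  move=> mk; rewrite (_ : [set q | 0 < k q] = setT `&` k @^-1` [set` `]0, +oo[]).
    by apply: mk => //; exact: measurable_itv.
  by rewrite setTI; apply/seteqP; split => q /=; rewrite in_itv /= andbT.
have mS : measurable S.
  rewrite (_ : S = [set q | 0 < q.2] `&` [set q | 0 < q.1.1 - q.2]).
    apply: measurableI; apply: mpos => //; apply: measurable_funB => //.
    by do 2 apply: measurableT_comp => //.
  apply/seteqP; split => q /=; rewrite /S /= subr_gt0; first by move=> /andP[].
  by move=> [-> ->].
split.
  have mHS : measurable_fun setT (H \_ S).
    by apply/(measurable_restrictT _ mS); exact: measurable_funTS.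
  have := measurable_funTS (D := cylinder Omega T) (fine_integral_measurable (@lebesgue_measure R) mHS).
  apply: eq_measurable_fun => -[t x]; rewrite inE => -[/=]; rewrite in_itv /= => /andP[t0 tT] Ox.
  rewrite /potential Rintegral_mkcond; apply: eq_Rintegral => s _.
  rewrite !patchE; have -> : ((t, x, s) \in S) = (s \in [set` `]0, t[]).
    by apply/idP/idP => /set_mem /=; rewrite /S /= ?in_itv => H1; apply/mem_set; rewrite /= ?in_itv.
  by case: ifPn => //; rewrite inE /= in_itv /= => /andP[s0 st]; rewrite HE.
move=> t x t0 tT Ox.
have : measurable_fun [set` `]0, t[] (fun s : RT => H ((t, x), s)).
  by apply: measurable_funTS; apply: (measurableT_comp mH); exact: measurable_pair1.
apply: eq_measurable_fun => s; rewrite inE /= in_itv /= => /andP[s0 st].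
by rewrite HE.
Qed.

End kernel_joint_measurability.

Section potential_bounds.
Context {R : realType} {N : nat}.
Local Notation E := 'rV[R]_N.
Local Notation RT := (measurableTypeR R).
Local Notation mu := (lebesgue_rV N : {measure set E -> \bar R}).
Local Notation leb := (@lebesgue_measure R).
Variables (Omega : set E) (G : R -> E -> E -> R).
Hypothesis oO : open Omega.
Hypothesis hG : is_dirichlet_heat_kernel Omega G.
Let mO : measurable Omega := open_measurable_rV oO.

Lemma heat_bound (t : R) x (f g : E -> R) (c : R) : 0 < t -> Omega x ->
  measurable_fun Omega f -> measurable_fun Omega g ->
  (\forall y \ae mu, Omega y -> `|f y| <= g y) ->
  (heat_ge0 Omega G t x g <= c%:E)%E ->
  mu.-integrable Omega (fun y => (G t x y * f y)%:E) /\
  `|heat_semigroup Omega G t f x| <= c.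
Proof.
move=> t0 Ox mf mg fg gc.
have G0 y : Omega y -> 0 <= G t x y by exact: (kernel_ge0 oO hG).
have m1 := heat_ge0_measurable oO hG t0 Ox mf.
have m2 := heat_ge0_measurable oO hG t0 Ox mg.
have le1 : (\int[mu]_(y in Omega) `|(G t x y * f y)%:E| <= c%:E)%E.
  apply: le_trans gc; rewrite /heat_ge0.
  have [A [mA A0 sA]] := fg.
  have m3 : measurable_fun Omega (fun y => `|(G t x y * f y)%:E|%E) by exact: measurableT_comp.
  have m4 : measurable_fun Omega (fun y => `|(G t x y * g y)%:E|%E) by exact: measurableT_comp.
  apply: le_trans (_ : \int[mu]_(y in Omega) `|(G t x y * g y)%:E| <= _)%E.
    apply: ae_ge0_le_integral => //.
    exists A; split => // y /= nP; apply: sA => /= P; apply: nP => Oy.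
    rewrite lee_fin !normrM (ger0_norm (G0 y Oy)) ler_wpM2l ?G0 //.
    by apply: le_trans (P Oy) (ler_norm _).
  rewrite le_eqVlt; apply/orP; left; apply/eqP.
  apply: ae_eq_integral => //.
  exists A; split => // y /= nP; apply: sA => /= P; apply: nP => Oy.
  by rewrite ger0_norm // mulr_ge0 ?G0 // (le_trans _ (P Oy)).
have ii : mu.-integrable Omega (fun y => (G t x y * f y)%:E).
  by apply/integrableP; split => //; apply: le_lt_trans le1 _; exact: ltry.
split => //.
rewrite -lee_fin; apply: le_trans le1; rewrite /heat_semigroup EFin_normr_Rintegral //.
exact: le_abse_integral.
Qed.

Variable T : R.
Local Notation mcyl F := (measurable_fun (cylinder Omega T : set (RT * E)) (fun p => F p.1 p.2)).

Lemma ae_cyl_slices (P : R -> E -> Prop) : ae_cyl Omega T P ->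
  \forall s \ae leb, 0 < s < T -> \forall y \ae mu, Omega y -> P s y.
Proof.
move=> aP; have a1 := ae_slices aP; apply: (ae_and a1 a1) => s Hs _ sT.
by apply: filterS Hs => y Hy Oy; apply: Hy; split => //=; rewrite in_itv.
Qed.

(** The Duhamel integral is an iterated integral, of which the inner one is only
    controlled for almost every time: bounds on the source hold almost everywhere
    in space-time, hence on almost every slice. *)
Lemma time_integral_bound (t C : R) (k be : RT -> R) : 0 < t ->
  measurable_fun [set` `]0%R, t[] k -> measurable_fun [set` `]0%R, t[] be ->
  (\forall s \ae leb, 0 < s < t -> `|k s| <= be s) ->
  (forall s, 0 < s < t -> 0 <= be s) ->
  (\int[leb]_(s in [set` `]0%R, t[]) (be s)%:E <= C%:E)%E ->
  leb.-integrable [set` `]0%R, t[] (EFin \o k) /\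
  `|\int[leb]_(s in [set` `]0, t[]) k s| <= C.
Proof.
move=> t0 mk mbe kbe be0 beC.
have mI : measurable ([set` `]0, t[] : set RT) by exact: measurable_itv.
have le1 : (\int[leb]_(s in [set` `]0%R, t[]) `|(k s)%:E| <= C%:E)%E.
  apply: le_trans beC; apply: ae_ge0_le_integral => //.
  - by apply: measurableT_comp => //; exact/measurable_EFinP.
  - exact/measurable_EFinP.
have ii : leb.-integrable [set` `]0%R, t[] (EFin \o k).
  apply/integrableP; split; first exact/measurable_EFinP.
  by apply: le_lt_trans le1 _; exact: ltry.
split => //; rewrite -lee_fin; apply: le_trans le1; rewrite EFin_normr_Rintegral //.
apply: le_abse_integral => //; exact/measurable_EFinP.
Qed.

Lemma potential_bound (F g : R -> E -> R) (be : RT -> R) (t C : R) x :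
  mcyl F -> 0 < t -> t < T -> Omega x ->
  ae_cyl Omega T (fun s y => `|F s y| <= g s y) ->
  (forall s, 0 < s < t -> measurable_fun Omega (g s)) ->
  (forall s, 0 < s < t -> (heat_ge0 Omega G (t - s) x (g s) <= (be s)%:E)%E) ->
  measurable_fun [set` `]0%R, t[] be -> (forall s, 0 < s < t -> 0 <= be s) ->
  (\int[leb]_(s in [set` `]0%R, t[]) (be s)%:E <= C%:E)%E ->
  leb.-integrable [set` `]0%R, t[] (fun s => (heat_semigroup Omega G (t - s) (F s) x)%:E) /\
  `|potential Omega G F t x| <= C.
Proof.
move=> mF t0 tT Ox Fg mg gbe mbe be0 beC.
have [_ mk] := potential_measurable oO hG mF.
apply: (time_integral_bound t0 (mk t x t0 tT Ox) mbe _ be0 beC).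
have a1 := ae_cyl_slices Fg; apply: (ae_and a1 a1) => s Hs _ /andP[s0 st].
have sT : s < T by exact: lt_trans tT.
have s0t : 0 < s < t by rewrite s0.
have := Hs _; rewrite s0 sT => /(_ isT) Hy.
have ts : 0 < t - s by rewrite subr_gt0.
by have [] := heat_bound ts Ox (slice_measurable oO mF s0 sT) (mg s s0t) Hy (gbe s s0t).
Qed.

(** The majorant [g] serves to subtract the two integrals, [k] to estimate the
    result. *)
Lemma potential_diff_bound (F1 F2 g k : R -> E -> R) (be ka : RT -> R) (t C C' : R) x :
  mcyl F1 -> mcyl F2 -> 0 < t -> t < T -> Omega x ->
  ae_cyl Omega T (fun s y => `|F1 s y| <= g s y) ->
  ae_cyl Omega T (fun s y => `|F2 s y| <= g s y) ->
  ae_cyl Omega T (fun s y => `|F1 s y - F2 s y| <= k s y) ->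
  (forall s, 0 < s < t -> measurable_fun Omega (g s)) ->
  (forall s, 0 < s < t -> (heat_ge0 Omega G (t - s) x (g s) <= (be s)%:E)%E) ->
  measurable_fun [set` `]0%R, t[] be -> (forall s, 0 < s < t -> 0 <= be s) ->
  (\int[leb]_(s in [set` `]0%R, t[]) (be s)%:E <= C%:E)%E ->
  (forall s, 0 < s < t -> measurable_fun Omega (k s)) ->
  (forall s, 0 < s < t -> (heat_ge0 Omega G (t - s) x (k s) <= (ka s)%:E)%E) ->
  measurable_fun [set` `]0%R, t[] ka -> (forall s, 0 < s < t -> 0 <= ka s) ->
  (\int[leb]_(s in [set` `]0%R, t[]) (ka s)%:E <= C'%:E)%E ->
  `|potential Omega G F1 t x - potential Omega G F2 t x| <= C'.
Proof.
move=> mF1 mF2 t0 tT Ox F1g F2g Fk mg gbe mbe be0 beC mk kka mka ka0 kaC.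
have [i1 _] := potential_bound mF1 t0 tT Ox F1g mg gbe mbe be0 beC.
have [i2 _] := potential_bound mF2 t0 tT Ox F2g mg gbe mbe be0 beC.
have [_ mk1] := potential_measurable oO hG mF1.
have [_ mk2] := potential_measurable oO hG mF2.
rewrite /potential -RintegralB //.
apply: (time_integral_bound t0 _ mka _ ka0 kaC).2.
  by apply: measurable_funB; [exact: mk1|exact: mk2].
have a1 := ae_cyl_slices F1g; have a2 := ae_cyl_slices F2g; have a3 := ae_cyl_slices Fk.
apply: (ae_and (ae_and a1 a2 (fun _ h1 h2 => conj h1 h2)) a3) => s [H1 H2] H3 /andP[s0 st].
have sT : s < T by exact: lt_trans tT.
have s0t : 0 < s < t by rewrite s0.
have s0T : 0 < s < T by rewrite s0.
have ts : 0 < t - s by rewrite subr_gt0.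
have ms1 := slice_measurable oO mF1 s0 sT; have ms2 := slice_measurable oO mF2 s0 sT.
have [j1 _] := heat_bound ts Ox ms1 (mg s s0t) (H1 s0T) (gbe s s0t).
have [j2 _] := heat_bound ts Ox ms2 (mg s s0t) (H2 s0T) (gbe s s0t).
have [_ bnd] := heat_bound ts Ox (measurable_funB ms1 ms2) (mk s s0t) (H3 s0T) (kka s s0t).
apply: le_trans bnd; rewrite /heat_semigroup -RintegralB //.
rewrite le_eqVlt; apply/orP; left; apply/eqP; congr (`| _ |).
by apply: eq_Rintegral => y _ /=; rewrite mulrBr.
Qed.

End potential_bounds.

(** * The heat flow of the weights *)

Section smallness.
Context {R : realType}.

(** With [z = c / t], from [expR z = expR (z / n.+1) ^+ n.+1] and
    [expR (z / n.+1) >= z / n.+1]. *)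
Lemma exp_small (c eps : R) n : 0 < c -> 0 < eps ->
  exists2 T, 0 < T & forall t, 0 < t -> t <= T -> expR (- (c / t)) <= eps * t ^+ n.
Proof.
move=> c0 e0; pose D := (n.+1%:R / c) ^+ n.+1.
have D0 : 0 < D by rewrite exprn_gt0 // divr_gt0.
exists (eps / D) => [|t t0 tT]; first by rewrite divr_gt0.
have z0 : 0 < c / t / n.+1%:R by rewrite !divr_gt0.
apply: le_trans (_ : ((n.+1%:R / c) * t) ^+ n.+1 <= _).
  rewrite expRN -[leRHS]invrK lef_pV2 ?posrE ?expR_gt0 ?invr_gt0 ?exprn_gt0 ?mulr_gt0 ?invr_gt0 //.
  rewrite -exprVn (_ : (_ * t)^-1 = c / t / n.+1%:R); last first.
    by field; rewrite !gt_eqF // ltr0n.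
  rewrite (_ : c / t = (c / t / n.+1%:R) * n.+1%:R); last by rewrite divfK // gt_eqF // ltr0n.
  rewrite mulfK ?gt_eqF ?ltr0n // expRM_natr; apply: lerXn2r; rewrite ?nnegrE ?expR_ge0 ?(ltW z0) //.
  by apply: le_trans (expR_ge1Dx _); rewrite lerDr.
rewrite exprMn -/D exprS mulrA ler_wpM2r ?exprn_ge0 ?(ltW t0) //.
by rewrite mulrC -ler_pdivlMr.
Qed.

(** [theta] is continuous and equals 1 at 2, hence remains large slightly below 2.
    In terms of a radius [a], the cut-off of radius [a / 2] is large outside of
    the ball of radius [q * a], and this ball is at distance [(1 - q) * a] from
    the exterior of the ball of radius [a]. *)
Lemma profile_large (theta : R -> R) : is_cutoff_profile theta ->
  exists2 q, q < 1 & forall s, 2 * q <= s -> 3 / 4 <= theta s.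
Proof.
move=> [d mono _ th2].
have c2 : {for (2 : R), continuous theta}.
  by apply: differentiable_continuous; apply/derivable1_diffP; exact: (d 0%N).
have /nbhs_ballP[e /= e0 He] : \forall s \near (2 : R), 3 / 4 < theta s.
  by apply: (c2 [set y | 3 / 4 < y]); apply: open_nbhs_nbhs; split; [exact: open_gt|rewrite /= th2 //; lra].
exists (1 - e / 4) => [|s hs]; first by lra.
apply: le_trans (mono _ _ hs); apply: ltW; apply: He.
rewrite /ball /= (_ : 2 - _ = e / 2); last by field.
by rewrite ger0_norm; lra.
Qed.

Lemma integral_power (t : R) k : 0 < t -> (0 < k)%N ->
  (\int[lebesgue_measure]_(s in [set` `]0%R, t[]) (s ^+ k.-1)%:E = (t ^+ k / k%:R)%:E)%E.
Proof.
move=> t0 k0; have k1 : k%:R != 0 :> R by rewrite gt_eqF // ltr0n.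
have dF (a : R) : is_derive a 1 (fun s => k%:R^-1 *: s ^+ k) (a ^+ k.-1).
  have d1 : is_derive a 1 (fun s : R => s ^+ k) (k%:R * a ^+ k.-1).
    apply: DeriveDef; first exact: exprn_derivable.
    by rewrite exp_derive /GRing.scale /= mulr1.
  have := is_deriveZ (k%:R^-1) d1.
  by rewrite [X in is_derive _ _ _ X -> _]mulKf.
have cF (a : R) : {for a, continuous (fun s : R => k%:R^-1 *: s ^+ k)}.
  by apply: differentiable_continuous; apply/derivable1_diffP; have [] := dF a.
rewrite -(@integral_itv_bndoo _ _ _ (fun s : R => (s ^+ k.-1)%:E) true false); last first.
  by apply/measurable_EFinP; apply: measurable_funTS; exact: measurable_funX.
rewrite (@continuous_FTC2 _ (fun s : R => s ^+ k.-1) (fun s => k%:R^-1 *: s ^+ k)) //.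
- by rewrite /GRing.scale /= expr0n eqn0Ngt k0 /= mulr0 sube0 mulrC.
- apply: continuous_subspaceT => a; exact: exprn_continuous.
- split => [a _||].
  + by have [] := dF a.
  + by apply: cvg_at_right_filter; exact: (cF 0).
  + by apply: cvg_at_left_filter; exact: (cF t).
- by move=> a _; rewrite derive1E; apply: derive_val.
Qed.

End smallness.

Section weight_flow.
Context {R : realType} {N : nat}.
Local Notation E := 'rV[R]_N.
Local Notation leb := (@lebesgue_measure R).
Hypothesis N0 : (0 < N)%N.
Variables (theta : R -> R) (delta : R).
Hypothesis htheta : is_cutoff_profile theta.
Hypothesis delta0 : 0 < delta.
Variables (Omega : set E) (G : R -> E -> E -> R).
Hypothesis oO : open Omega.
Hypothesis hG : is_dirichlet_heat_kernel Omega G.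
Let mO : measurable Omega := open_measurable_rV oO.
Variable q : R.
Hypothesis q1 : q < 1.
Hypothesis thq : forall s, 2 * q <= s -> 3 / 4 <= theta s.

Definition far_set j : set E := [set y | a_ delta j <= enorm y].
Definition Lcst m : R := 1 + a_ delta m ^- 2.

Lemma Lcst_gt0 m : 0 < Lcst m.
Proof. by rewrite addr_gt0 // invr_gt0 exprn_gt0 // a_gt0. Qed.

(** A majorant of [hfun] by indicators of exterior regions: [chi j] and
    [enorm x ^- 2] are bounded there by 1 and by the inverse square of the radius. *)
Definition hmaj m (s : R) (y : E) : R :=
  (1 + s) * s `^ ((m%:R - 2) / 2) +
  Lcst m * \sum_(1 <= j < m.+1) (Num.sqrt s ^+ j.-1 * \1_(far_set j) y).

Lemma hfun_le_hmaj m s y : 0 <= s -> hfun theta delta m s y <= hmaj m s y.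
Proof.
move=> s0; rewrite /hfun /hmaj [leLHS]addrC lerD2l sum_chiE // !mulr_sumr.
apply: ler_sum_nat => j /andP[j1 jm].
rewrite mulrCA [leRHS]mulrCA ler_wpM2l ?exprn_ge0 ?sqrtr_ge0 //.
rewrite indicE; case: (boolP (y \in _)) => /= [|/negP yj]; last first.
  rewrite mulr0 chi_eq0 ?mulr0 //; apply: ltW; rewrite ltNge; apply/negP => H.
  by apply: yj; rewrite inE.
rewrite inE /far_set /= mulr1 => ay.
have aj := a_le delta0 (ltnSE jm).
have h : enorm y ^- 2 <= a_ delta m ^- 2.
  have a0 := a_gt0 delta0 m; have y0 : 0 < enorm y by apply: lt_le_trans ay; exact: a_gt0.
  rewrite lef_pV2 ?posrE ?exprn_gt0 //; apply: lerXn2r; rewrite ?nnegrE ?(ltW a0) ?(ltW y0) //.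
  exact: le_trans ay.
rewrite -[leRHS]mulr1; apply: ler_pM; rewrite ?chi_ge0 ?chi_le1 //.
  by rewrite addr_ge0 // invr_ge0 exprn_ge0 // enorm_ge0.
by rewrite /Lcst addrC lerD2l.
Qed.

Lemma measurable_far j : measurable (far_set j).
Proof.
apply: closed_measurable_rV; apply: (@closed_comp _ _ (@enorm R N) [set s | a_ delta j <= s]).
  by move=> y _; exact: continuous_enorm.
exact: closed_ge.
Qed.

Lemma measurable_hmaj m s : measurable_fun Omega (hmaj m s).
Proof.
apply: measurable_funTS; apply: measurable_funD; first exact: measurable_cst.
apply: measurable_funM; first exact: measurable_cst.
apply: measurable_sum => j; apply: measurable_funM; first exact: measurable_cst.
exact: measurable_indic (measurable_far j).
Qed.

Lemma hmaj_ge0 m s y : 0 <= s -> 0 <= hmaj m s y.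
Proof. by move=> s0; apply: le_trans (hfun_le_hmaj m y s0); exact: hfun_ge0. Qed.

Lemma gauss_anti (t r r' : R) : 0 < t -> 0 <= r -> r <= r' ->
  gauss (N := N) t r' <= gauss (N := N) t r.
Proof.
move=> t0 r0 rr'; have Np : 0 < N%:R :> R by rewrite ltr0n.
rewrite ler_wpM2l ?mulr_ge0 // ler_expR lerN2 ler_wpM2r ?invr_ge0 ?mulr_ge0 ?(ltW t0) //.
by apply: lerXn2r; rewrite ?nnegrE ?(le_trans r0 rr').
Qed.

(** Each indicator but the last one is charged to the next cut-off, up to an
    exponentially small tail; the last one to the total mass of the kernel. *)
Definition flow_cst m t (x : E) : R :=
  Lcst m * (\sum_(1 <= j < m) Num.sqrt t ^+ j.-1 *
      (4 / 3 * chi theta delta j.+1 x + Num.sqrt t ^+ m) + Num.sqrt t ^+ m.-1).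

Lemma far_heat m j (t s : R) x : 0 < s -> s <= t -> Omega x -> (j <= m)%N ->
  gauss (N := N) t ((1 - q) * a_ delta m) <= Num.sqrt t ^+ m ->
  (heat_ge0 Omega G s x (\1_(far_set j)) <=
   (4 / 3 * chi theta delta j.+1 x + Num.sqrt t ^+ m)%:E)%E.
Proof.
move=> s0 st Ox jm gm.
apply: le_trans (kernel_far N0 oO hG s0 Ox (a_gt0 delta0 j) q1 (theta_ge0 htheta) thq) _.
rewrite lee_fin /chi a_S lerD2l; apply: le_trans gm.
apply: le_trans (gauss_le (N := N) N0 _ s0 st) _.
have q0 : 0 <= 1 - q by rewrite subr_ge0 ltW.
apply: gauss_anti; first exact: lt_le_trans st.
  by rewrite mulr_ge0 // ltW // a_gt0.
by rewrite ler_wpM2l //; exact: a_le.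
Qed.

Lemma far_heat_le1 j (s : R) x : 0 < s -> Omega x -> (heat_ge0 Omega G s x (\1_(far_set j)) <= 1)%E.
Proof.
move=> s0 Ox; apply: le_trans (kernel_mass oO hG s0 Ox); apply: (heat_ge0_le oO hG) => //.
  by apply: measurable_funTS; exact: measurable_indic (measurable_far j).
by move=> y _; rewrite indicE; case: (_ \in _).
Qed.

(** For even [m] the singular part of the weight is a power of [s] with integral
    exponent; it does not depend on [x] and only meets the mass of the kernel. *)
Lemma hmaj_heat k (t s : R) x : (0 < k)%N -> 0 < s -> s < t -> t <= 1 / 4 -> Omega x ->
  gauss (N := N) t ((1 - q) * a_ delta k.*2) <= Num.sqrt t ^+ k.*2 ->
  (heat_ge0 Omega G (t - s) x (hmaj k.*2 s) <= ((1 + t) * s ^+ k.-1 + flow_cst k.*2 t x)%:E)%E.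
Proof.
move=> k0 s0 st t4 Ox gm; set m := k.*2.
have ts0 : 0 < t - s by rewrite subr_gt0.
have tst : t - s <= t by lra.
have L0 := ltW (Lcst_gt0 m).
have s1 : s `^ ((m%:R - 2) / 2) = s ^+ k.-1.
  rewrite (_ : (m%:R - 2) / 2 = k.-1%:R :> R); first by rewrite powR_mulrn // ltW.
  by rewrite /m -muln2 natrM -subn1 natrB //; field.
have mf j : measurable_fun Omega (\1_(far_set j) : E -> R).
  by apply: measurable_funTS; exact: measurable_indic (measurable_far j).
have mg (j : nat) : measurable_fun Omega (fun y => Num.sqrt s ^+ j.-1 * \1_(far_set j) y : R).
  by apply: measurable_funM => //; exact: measurable_cst.
have g0 (j : nat) y : Omega y -> 0 <= Num.sqrt s ^+ j.-1 * \1_(far_set j) y :> R.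
  by move=> _; rewrite mulr_ge0 ?exprn_ge0 ?sqrtr_ge0.
have mS : measurable_fun Omega (fun y => \sum_(1 <= j < m.+1) (Num.sqrt s ^+ j.-1 * \1_(far_set j) y) : R).
  by apply: measurable_sum.
have S0 y : Omega y -> 0 <= \sum_(1 <= j < m.+1) (Num.sqrt s ^+ j.-1 * \1_(far_set j) y) :> R.
  by move=> Oy; apply: sumr_ge0 => j _; exact: g0.
have c0 : 0 <= (1 + s) * s `^ ((m%:R - 2) / 2) by rewrite mulr_ge0 ?powR_ge0 // addr_ge0 // ltW.
rewrite (_ : hmaj m s = (fun y => (1 + s) * s `^ ((m%:R - 2) / 2) * cst 1 y +
  Lcst m * \sum_(1 <= j < m.+1) (Num.sqrt s ^+ j.-1 * \1_(far_set j) y))); last first.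
  by apply/funext => y; rewrite /hmaj /= mulr1.
rewrite (heat_ge0D oO hG) //; last 4 first.
- by apply: measurable_funM; exact: measurable_cst.
- by apply: measurable_funM => //; exact: measurable_cst.
- by move=> y _; rewrite mulr_ge0.
- by move=> y Oy; rewrite mulr_ge0 // S0.
rewrite EFinD; apply: leeD.
  rewrite (heat_ge0Z oO hG) //.
  apply: le_trans (lee_wpmul2l _ (kernel_mass oO hG ts0 Ox)) _; first by rewrite lee_fin.
  rewrite mule1 lee_fin s1 ler_wpM2r ?exprn_ge0 ?(ltW s0) // lerD2l; exact: ltW.
rewrite (heat_ge0Z oO hG) // /flow_cst EFinM; apply: lee_wpmul2l; first by rewrite lee_fin.
rewrite (heat_ge0_sum oO hG) // big_nat_recr ?double_gt0 //= EFinD -sumEFin.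
have sq j : Num.sqrt s ^+ j <= Num.sqrt t ^+ j.
  by apply: lerXn2r; rewrite ?nnegrE ?sqrtr_ge0 // ler_wsqrtr // ltW.
have term j (p : R) : (heat_ge0 Omega G (t - s) x (\1_(far_set j)) <= p%:E)%E ->
   (heat_ge0 Omega G (t - s) x (fun y => (Num.sqrt s ^+ j.-1 * \1_(far_set j) y)%R) <=
    (Num.sqrt t ^+ j.-1 * p)%:E)%E.
  move=> hp; rewrite (heat_ge0Z oO hG) ?exprn_ge0 ?sqrtr_ge0 //.
  apply: le_trans (lee_wpmul2l _ hp) _; first by rewrite lee_fin exprn_ge0 // sqrtr_ge0.
  rewrite -EFinM lee_fin ler_wpM2r // -lee_fin; apply: le_trans hp.
  exact: (heat_ge0_nonneg oO hG).
apply: leeD; last first.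
  by rewrite -[X in (_ <= X%:E)%E]mulr1; apply: term; exact: far_heat_le1.
rewrite big_seq [leRHS]big_seq; apply: lee_sum => j; rewrite mem_index_iota => /andP[_ jm].
by apply: term; apply: (@far_heat m) => //; exact: ltnW.
Qed.

Lemma flow_cst_ge0 m t x : 0 <= flow_cst m t x.
Proof.
have s0 := sqrtr_ge0 t.
apply: mulr_ge0; first exact: ltW (Lcst_gt0 m).
rewrite addr_ge0 ?exprn_ge0 // sumr_ge0 // => j _.
by rewrite mulr_ge0 ?exprn_ge0 // addr_ge0 ?exprn_ge0 // mulr_ge0 // chi_ge0.
Qed.

(** The ratio to [Theta], for [K = 1], of the Duhamel term of [hmaj]: the first
    term, from the integral of [s `^ ((m - 2) / 2)], is small for large [m],
    and then the second one for small times. *)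
Definition flow_rate m t : R := 4 / m%:R + Lcst m * Num.sqrt t * (m%:R + 2).

Lemma flow_rate_le m t t' : t <= t' -> flow_rate m t <= flow_rate m t'.
Proof.
move=> tt; rewrite lerD2l ler_wpM2r ?addr_ge0 // ler_wpM2l ?ler_wsqrtr //.
exact: ltW (Lcst_gt0 m).
Qed.

(** Passing from the [j]-th indicator to the cut-off of index [j.+1] costs a power
    of [Num.sqrt t]; the integration in time yields two of them. *)
Lemma flow_cst_le m t x : (0 < m)%N -> 0 <= t -> t <= 1 / 4 ->
  t * flow_cst m t x <= Lcst m * Num.sqrt t * (m%:R + 2) * Theta theta delta 1 m t x.
Proof.
move=> m0 t0 t4; set r := Num.sqrt t; have r0 : 0 <= r by exact: sqrtr_ge0.
have tE : t = r * r by rewrite -expr2 sqr_sqrtr.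
have L0 := Lcst_gt0 m.
rewrite {1}tE /flow_cst -/r (_ : r * r * (Lcst m * _) = Lcst m * r *
  (\sum_(1 <= j < m) r * (r ^+ j.-1 * (4 / 3 * chi theta delta j.+1 x + r ^+ m)) + r * r ^+ m.-1)); last first.
  by rewrite -mulr_sumr; ring.
rewrite -[leRHS]mulrA ler_wpM2l ?mulr_ge0 ?(ltW L0) // -exprS prednK //.
rewrite /Theta mul1r sum_chiE // powR_half_nat // -/r.
set S := \sum_(1 <= j < m.+1) _.
have S0 : 0 <= S by apply: sumr_ge0 => j _; rewrite mulr_ge0 ?exprn_ge0 // chi_ge0.
have rm0 : 0 <= r ^+ m by rewrite exprn_ge0.
have r1 j : (0 < j)%N -> r * r ^+ j.-1 = r ^+ j by move=> j0; rewrite -exprS prednK.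
have h1 : \sum_(1 <= j < m) r ^+ j * chi theta delta j.+1 x <= S.
  rewrite /S big_nat_recl //= big_add1 /= expr0 mul1r.
  rewrite lerDr; exact: chi_ge0.
have r1' : r <= 1 by have := sqrt_le_half t4; rewrite -/r; lra.
have h2 : \sum_(1 <= j < m) r * (r ^+ j.-1 * (4 / 3 * chi theta delta j.+1 x + r ^+ m)) <=
    4 / 3 * S + m%:R * r ^+ m.
  apply: le_trans (_ : \sum_(1 <= j < m) (4 / 3 * (r ^+ j * chi theta delta j.+1 x) + r ^+ m) <= _).
    apply: ler_sum_nat => j /andP[j1 _].
    rewrite mulrA r1 // mulrDr mulrCA lerD2l -[leRHS]mul1r ler_wpM2r //.
    exact: exprn_ile1.
  rewrite big_split /= -mulr_sumr; apply: lerD; first by rewrite ler_wpM2l //; lra.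
  rewrite sumr_const_nat -[leLHS]mulr_natl ler_wpM2r // ler_nat; exact: leq_subr.
have m1 : 1 <= m%:R :> R by rewrite ler1n.
have := mulr_ge0 (le_trans ler01 m1) S0.
have := mulr_ge0 (le_trans ler01 m1) rm0; clear h1.
by move: h2 S0 rm0 m1; set Q := \sum_(1 <= j < m) r * _; move: Q (S) (r ^+ m) => Q Z P; move: (m%:R) => M; lra.
Qed.

Lemma hmaj_heat_integral k (t : R) x : (0 < k)%N -> 0 < t -> t <= 1 / 4 ->
  (\int[leb]_(s in [set` `]0%R, t[]) ((1 + t) * s ^+ k.-1 + flow_cst k.*2 t x)%:E <=
   (flow_rate k.*2 t * Theta theta delta 1 k.*2 t x)%:E)%E.
Proof.
move=> k0 t0 t4; have mI : measurable ([set` `]0%R, t[] : set (measurableTypeR R)) by exact: measurable_itv.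
have mp : measurable_fun [set` `]0%R, t[] (fun s : R => (s ^+ k.-1)%:E).
  by apply/measurable_EFinP; apply: measurable_funTS; exact: measurable_funX.
have t1 : 0 <= 1 + t by lra.
under eq_integral do rewrite EFinD EFinM.
rewrite ge0_integralD //; last 3 first.
- move=> s /=; rewrite in_itv /= => /andP[s0 _]; rewrite -EFinM lee_fin mulr_ge0 // exprn_ge0 //; exact: ltW.
- by apply: emeasurable_funM => //; exact: measurable_cst.
- by move=> s _; rewrite lee_fin flow_cst_ge0.
rewrite ge0_integralZl_EFin //; last first.
  by move=> s /=; rewrite in_itv /= => /andP[s0 _]; rewrite lee_fin exprn_ge0 // ltW.
have l1 : @lebesgue_measure R [set` `]0%R, t[] = t%:E.
  by rewrite lebesgue_measure_itv /= lte_fin t0 sube0.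
have c1 (c : R) : (\int[leb]_(s in [set` `]0%R, t[]) c%:E = (c * t)%:E)%E.
  by transitivity (c%:E * leb [set` `]0%R, t[])%E; [exact: integral_cst|rewrite l1].
rewrite c1 integral_power // -EFinM -EFinD lee_fin /flow_rate [leRHS]mulrDl; apply: lerD; last first.
  by rewrite mulrC; apply: flow_cst_le => //; [rewrite double_gt0|exact: ltW].
have T0 : 0 <= sum_chi theta delta k.*2 t x by exact: sum_chi_ge0.
have kp : 0 < k%:R :> R by rewrite ltr0n.
have tE : t `^ (k.*2%:R / 2) = t ^+ k.
  by rewrite powR_half_nat ?(ltW t0) // -mul2n exprM sqr_sqrtr // ltW.
have mE : 4 / k.*2%:R = 2 / k%:R :> R by rewrite -mul2n natrM; field; rewrite gt_eqF.
rewrite /Theta mul1r tE mE.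
have tk0 : 0 <= t ^+ k by rewrite exprn_ge0 // ltW.
apply: le_trans (_ : 2 / k%:R * t ^+ k <= _); last first.
  by rewrite ler_wpM2l ?divr_ge0 ?(ltW kp) // lerDl.
rewrite mulrA [leRHS]mulrAC ler_wpM2r ?invr_ge0 ?(ltW kp) // ler_wpM2r //; lra.
Qed.

End weight_flow.

(** * Choice of the parameters *)

Section parameters.
Context {R : realType}.
Implicit Types (P Q : R -> Prop) (t c : R).

Definition for_small_times P := exists2 T : R, 0 < T & forall t, 0 < t -> t <= T -> P t.

Lemma for_small_timesI P Q : for_small_times P -> for_small_times Q ->
  for_small_times (fun t => P t /\ Q t).
Proof.
move=> [T1 T10 h1] [T2 T20 h2]; exists (Num.min T1 T2); first by rewrite lt_min T10.
by move=> t t0; rewrite le_min => /andP[t1 t2]; split; [exact: h1|exact: h2].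
Qed.

Lemma small_id c : 0 < c -> for_small_times (fun t => t <= c).
Proof. by move=> c0; exists c. Qed.

Lemma small_sqrt c : 0 < c -> for_small_times (fun t => Num.sqrt t <= c).
Proof.
move=> c0; exists (c ^+ 2); first by rewrite exprn_gt0.
move=> t t0 tc; rewrite (_ : c = Num.sqrt (c ^+ 2)); first exact: ler_wsqrtr.
by rewrite sqrtr_sqr gtr0_norm.
Qed.

Lemma small_exp (C c eps : R) n : 0 < C -> 0 < c -> 0 < eps ->
  for_small_times (fun t => C * expR (- (c / t)) <= eps * t ^+ n).
Proof.
move=> C0 c0 e0; have [||T T0 H] := @exp_small R c (eps / C) n => //; first by rewrite divr_gt0.
exists T => // t t0 tT; have := ler_wpM2l (ltW C0) (H t t0 tT).
by rewrite mulrA mulrCA mulfV ?gt_eqF // mulr1.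
Qed.

Lemma powR_even t k : 0 <= t -> t `^ (k.*2%:R / 2) = t ^+ k.
Proof. by move=> t0; rewrite powR_half_nat // -mul2n exprM sqr_sqrtr. Qed.

(** First [m] is chosen, large and even, to make [4 / m] small; the remaining
    requirements hold for all small times, since exponentials of [- 1 / t] beat
    powers of [t]. *)
Lemma parameters_exist (N : nat) (delta alpha K A T0 q : R) :
  (0 < N)%N -> 0 < delta -> 0 < K -> 0 < A -> 0 < T0 -> q < 1 ->
  let B := (1 + K `^ (alpha + 1)) * A in
  exists (k : nat) (T : R), [/\ (0 < k)%N, 0 < T <= Num.min (1 / 4) T0,
    B * flow_rate delta k.*2 T <= K / 3,
    forall t, 0 < t -> t <= T ->
      gauss (N := N) t ((1 - q) * a_ delta k.*2) <= Num.sqrt t ^+ k.*2 &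
    admissible N delta alpha K A k.*2 T].
Proof.
move=> N0 d0 K0 A0 T00 q1 B.
have B0 : 0 < B by rewrite mulr_gt0 // ltr_pwDl // powR_ge0.
have Np : 0 < N%:R :> R by rewrite ltr0n.
pose k := (Num.truncn (12 * B / K)).+1; have k0 : (0 < k)%N by [].
have kB : 12 * B / K < k%:R by exact: truncnS_gt.
pose m := k.*2; have m0 : 0 < m%:R :> R by rewrite ltr0n double_gt0.
have mE : m%:R = 2 * k%:R :> R by rewrite /m -mul2n natrM.
have B6 : 0 < 6 * B by apply: mulr_gt0.
have B4 : 0 < 4 * B by apply: mulr_gt0.
have m2 : 0 < m%:R + 2 :> R by apply: addr_gt0.
have m4 : 4 / m%:R <= K / (6 * B).
  rewrite ler_pdivrMr //.
  move: kB; rewrite ltr_pdivrMr // => kB.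
  have -> : 4 = K / (6 * B) * (24 * B / K) by field; rewrite !gt_eqF.
  have c0 : 0 <= K / (6 * B) by apply: divr_ge0; [exact: ltW|apply: mulr_ge0 => //; exact: ltW].
  rewrite ler_wpM2l //.
  by rewrite ler_pdivrMr // mE; lra.
have L0 := Lcst_gt0 d0 m.
have e0 : 0 < K / (4 * B) by exact: divr_gt0.
pose c1 := K / (6 * B * (Lcst delta m * (m%:R + 2))).
have c10 : 0 < c1 by apply: divr_gt0 => //; apply: mulr_gt0 => //; exact: mulr_gt0.
pose P2 : R := 2 `^ (N%:R / 2); have P20 : 0 < P2 by rewrite powR_gt0.
have am j : 0 < a_ delta j by exact: a_gt0.
have sq : for_small_times (fun t => gauss (N := N) t ((1 - q) * a_ delta m) <= t ^+ k).
  have q0 : 0 < 1 - q by rewrite subr_gt0.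
  have [|||T T0' H] := @small_exp (N%:R * 2) (((1 - q) * a_ delta m) ^+ 2 / (4 * N%:R)) 1 k.
  - by rewrite mulr_gt0.
  - by rewrite divr_gt0 ?exprn_gt0 ?mulr_gt0.
  - by [].
  exists T => // t t0 tT; rewrite -[leRHS]mul1r; apply: le_trans (H t t0 tT).
  by rewrite /gauss invfM [in leLHS]mulrA.
have s2 : for_small_times (fun t => P2 * expR (- (a_ delta 1 ^+ 2 / 8 / t)) <= 1 / 2 * t ^+ k).
  by apply: small_exp => //; rewrite divr_gt0 // exprn_gt0.
have s4 : for_small_times (fun t =>
    (m%:R * P2 * Lcst delta m * 2) * expR (- (a_ delta m.+1 ^+ 2 / 8 / t)) <= K / (4 * B) * t ^+ k).
  apply: small_exp => //; first by rewrite !mulr_gt0.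
  by rewrite divr_gt0 // exprn_gt0.
have T1 : 0 < Num.min (1 / 4) T0 by rewrite lt_min T00 andbT; lra.
have [T Tp H] := for_small_timesI (small_id T1) (for_small_timesI (small_sqrt c10)
  (for_small_timesI sq (for_small_timesI s2 s4))).
have [TT [Tc _]] := H T Tp (lexx _).
have T4 : T <= 1 / 4 by move: TT; rewrite le_min => /andP[].
have LT : Lcst delta m * Num.sqrt T * (m%:R + 2) <= K / (6 * B).
  rewrite mulrAC mulrC -ler_pdivlMr; last exact: mulr_gt0.
  by apply: le_trans Tc _; rewrite /c1 invfM mulrA.
have K46 : K / (6 * B) <= K / (4 * B).
  by rewrite ler_wpM2l ?(ltW K0) // lef_pV2 ?posrE // ler_wpM2r ?(ltW B0) //; lra.
exists k, T; split => //.
- by rewrite Tp.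
- rewrite /flow_rate -/m (_ : K / 3 = B * (K / (6 * B) + K / (6 * B))); last by field; rewrite gt_eqF.
  by rewrite ler_wpM2l ?(ltW B0) // lerD.
- move=> t t0 tT; have [_ [_ [h _]]] := H t t0 tT.
  by rewrite -powR_half_nat ?(ltW t0) // powR_even // ltW.
split.
- by split => //; rewrite -(doubleS 0) leq_double.
- by rewrite -/B; apply: le_trans K46.
- move=> t t0 tT; have [_ [_ [_ [h _]]]] := H t t0 tT.
  by rewrite powR_even ?(ltW t0) //; move: h; rewrite invfM mulrA.
- rewrite -/B mul1r powR12_sqrt ?(ltW Tp) //; apply: le_trans K46; apply: le_trans LT.
  rewrite -/(Lcst delta m) mulrC ler_peMr ?mulr_ge0 ?sqrtr_ge0 ?(ltW L0) //; lra.
move=> t t0 tT; have [_ [_ [_ [_ h]]]] := H t t0 tT.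
rewrite -/B powR_even ?(ltW t0) //; apply: le_trans h; rewrite -/P2 -/(Lcst delta m) invfM mulrA.
rewrite ler_wpM2r ?expR_ge0 // ler_wpM2l ?mulr_ge0 ?(ltW P20) ?(ltW L0) //.
have -> : (k.*2%:R + 1) / 2 = m.+1%:R / 2 :> R by congr (_ / _); exact: natr1.
by have := powR_half_le1 m.+1 (ltW t0) (le_trans tT T4); lra.
Qed.

End parameters.

(** * The contraction argument *)

Section essential_bounds.
Context d {X : measurableType d} {R : realType} (m : {measure set X -> \bar R}).
Variable D : set X.

Lemma Lnorm_oo_le (f : X -> R) (M : R) : 0 <= M ->
  (\forall x \ae m, D x -> `|f x| <= M) -> (Lnorm_on m +oo%E D f <= M%:E)%E.
Proof.
move=> M0 fM; rewrite /Lnorm_on unlock /=; case: ifP => _; last by rewrite lee_fin.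
apply/ess_supP; apply: (ae_and fM fM) => x Dx _ /=; rewrite patchE.
by case: ifPn => [|_]; rewrite lee_fin ?normr0 // inE; exact: Dx.
Qed.

Lemma Lnorm_oo_bound (f : X -> R) : in_L m +oo%E D f ->
  \forall x \ae m, D x -> `|f x| <= fine (Lnorm_on m +oo%E D f).
Proof.
move=> [_ foo]; have fin : Lnorm_on m +oo%E D f \is a fin_num.
  by rewrite ge0_fin_numE // Lnorm_ge0.
(* on a null space the norm is 0 by convention and every property holds *)
have [m0|m0] := boolP (0 < m [set: X])%E; last first.
  exists setT; split => //; apply/eqP; move: m0; rewrite -leNgt => m0.
  by rewrite eq_le m0 measure_ge0.
have h := ess_sup_ge m (abse \o (EFin \o (f \_ D))).
apply: (ae_and h h) => x Hx _ Dx; rewrite -lee_fin fineK //.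
by move: Hx; rewrite /Lnorm_on unlock m0 /= patchE mem_set.
Qed.

End essential_bounds.

Lemma geometric_limit (R : realType) (u : nat -> R) (c : R) :
  (forall n, `|u n.+1 - u n| <= 2 * (3^-1) ^+ n * c) ->
  exists2 l, u @ \oo --> l & forall n, `|l - u n| <= 3 * (3^-1) ^+ n * c.
Proof.
move=> H.
have c0 : 0 <= c by have := le_trans (normr_ge0 _) (H 0%N); rewrite expr0; lra.
have r0 n : 0 <= (3^-1 : R) ^+ n by rewrite exprn_ge0.
have dist n p : `|u (n + p)%N - u n| <= 3 * (3^-1) ^+ n * c.
  suff : `|u (n + p)%N - u n| <= 3 * (3^-1) ^+ n * (1 - (3^-1) ^+ p) * c.
    have g3 : 0 <= 3 * (3^-1) ^+ n :> R by have := r0 n; lra.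
    move/le_trans; apply; rewrite ler_wpM2r // -[leRHS]mulr1 ler_wpM2l //.
  elim: p => [|p IH]; first by rewrite addn0 subrr normr0 expr0 subrr mulr0 mul0r.
  have -> : u (n + p.+1)%N - u n = (u (n + p).+1 - u (n + p)%N) + (u (n + p)%N - u n).
    by rewrite addnS; ring.
  apply: le_trans (ler_normD _ _) _; apply: le_trans (lerD (H _) IH) _.
  rewrite -mulrDl ler_wpM2r // exprD exprS.
  by have := mulr_ge0 (r0 n) (r0 p); lra.
have gsmall (e : R) : 0 < e -> \forall n \near \oo, 3 * (3^-1) ^+ n * c < e.
  move=> e0; have g0 : (fun n => 3 * c * (3^-1) ^+ n) @ \oo --> (0 : R).
    have := @cvg_geometric R (3 * c) (3^-1); apply.
    by rewrite ger0_norm ?invr_ge0 // invf_lt1 // ltr1n.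
  have /cvgrPdist_lt/(_ e e0) := g0; apply: filterS => n.
  rewrite sub0r normrN ger0_norm ?mulr_ge0 //; apply: le_lt_trans.
  by rewrite le_eqVlt; apply/orP; left; apply/eqP; ring.
have cu : cvgn u.
  apply: cauchy_cvg; apply/cauchy_exP => e e0.
  have [n _ Hn] := gsmall e e0; exists (u n); exists n => // k /= nk.
  have -> : k = (n + (k - n))%N by rewrite subnKC.
  rewrite /ball /= distrC; apply: le_lt_trans (dist _ _) _; exact: (Hn n (leqnn n)).
exists (limn u) => // n.
apply/ler_addgt0Pr => e e0; have /cvgrPdist_lt/(_ e e0)[p _ Hp] := cu.
have h1 := Hp (n + p)%N (leq_addl n p); have h2 := dist n p.
have -> : limn u - u n = (limn u - u (n + p)%N) + (u (n + p)%N - u n) by rewrite addrA subrK.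
by apply: le_trans (ler_normD _ _) _; rewrite addrC; apply: lerD => //; exact: ltW.
Qed.

Section source_measurability.
Context {R : realType} {N : nat}.
Local Notation E := 'rV[R]_N.
Local Notation RT := (measurableTypeR R).
Variables (alpha : R) (Omega : set E) (U : R -> E -> R) (Psi : E -> R) (T0 T : R).
Hypothesis oO : open Omega.
Hypothesis hU : is_C12 (cylinder Omega T0) U.
Hypothesis hPsi : is_C2_W2oo Psi.
Hypothesis TT : T <= T0.
Local Notation mcyl F := (measurable_fun (cylinder Omega T : set (RT * E)) (fun p => F p.1 p.2)).

Lemma continuous_cylinder_measurable (g : R * E -> R) :
  (forall p, cylinder Omega T0 p -> {for p, continuous g}) ->
  measurable_fun (cylinder Omega T : set (RT * E)) (fun p => g (p : R * E)).
Proof.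
move=> cg.
pose i2 (p : RT * E) : R * E := (p.1, p.2).
have mb : measurable_base i2.
  exact: (measurable_base_prod (measurable_base_R R) (@measurable_base_rV R N)).
have oc : open (cylinder Omega T0).
  rewrite openE => -[t x] [/= tT Ox].
  exists ([set` `]0, T0[], Omega); last by move=> [s y] [/= ? ?]; split.
  split; apply: open_nbhs_nbhs; split => //; exact: interval_open.
have := continuous_on_measurable mb oc cg.
have sub : (cylinder Omega T : set (RT * E)) `<=` i2 @^-1` cylinder Omega T0.
  move=> [t x] [/= tT Ox]; split => //=; move: tT; rewrite !in_itv /= => /andP[-> tT].
  exact: lt_le_trans tT TT.
have mc : measurable (i2 @^-1` cylinder Omega T0) by exact: measurable_open.
move=> mg; have := measurable_funS mc sub mg.
by apply: eq_measurable_fun => -[t x].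
Qed.

Lemma continuous_space_measurable (g : E -> R) : continuous g ->
  measurable_fun (cylinder Omega T : set (RT * E)) (fun p => g p.2).
Proof.
move=> cg; apply: measurable_funTS; apply: measurableT_comp => //.
exact: continuous_measurable_rV.
Qed.

Lemma calM_measurable (w : R -> E -> R) : mcyl w -> mcyl (calM alpha U Psi w).
Proof.
move=> mw; have [_ cU] := hU; have [[[_ cP cdP] C2] _] := hPsi.
have mU : mcyl U.
  have cU0 p : cylinder Omega T0 p ->
      {for p, continuous (fun q : R * E => U q.1 q.2)} by move=> /cU[].
  exact: (continuous_cylinder_measurable cU0).
have mP : measurable_fun (cylinder Omega T : set (RT * E)) (fun p => Psi p.2).
  exact: continuous_space_measurable.
have mpow (f : RT * E -> R) : measurable_fun (cylinder Omega T : set (RT * E)) f ->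
    measurable_fun (cylinder Omega T : set (RT * E)) (fun p : RT * E => `|f p| `^ alpha * f p).
  move=> mf; apply: measurable_funM => //.
  have mn : measurable_fun (cylinder Omega T : set (RT * E)) (fun p : RT * E => `|f p|) by exact: measurableT_comp.
  apply: (measurableT_comp (f := fun r : R => r `^ alpha)); last exact: mn.
  exact: (measurable_powR alpha).
have mPU : measurable_fun (cylinder Omega T : set (RT * E)) (fun p => Psi p.2 * U p.1 p.2 + w p.1 p.2).
  by apply: measurable_funD => //; exact: measurable_funM.
apply: measurable_funB; last by apply: measurable_funM => //; exact: mpow.
apply: measurable_funD; last exact: mpow.
apply: measurable_funD.
  apply: measurable_funM => //; rewrite /dot.
  apply: measurable_sum => i; under eq_fun do rewrite !mxE.
  apply: measurable_funM; last exact: (continuous_space_measurable (cdP i)).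
  have cpd p : cylinder Omega T0 p ->
      {for p, continuous (fun q : R * E => pd i (U q.1) q.2)}.
    by move=> hp; have [_ _ c _] := cU p hp; exact: c.
  exact: (continuous_cylinder_measurable cpd).
apply: measurable_funM => //; rewrite /laplacian; apply: measurable_sum => i.
by have [_ _ cdd] := C2 i; exact: (continuous_space_measurable (cdd i)).
Qed.

End source_measurability.

Lemma iterate_arith (R : realFieldType) (r c : R) : 0 <= 3 * r * c ->
  3 * (3^-1 * r) * c + 3 * r / 3 * c <= 6 * r * c.
Proof. lra. Qed.

Section fixed_point.
Context {R : realType} {N : nat}.
Local Notation E := 'rV[R]_N.
Local Notation RT := (measurableTypeR R).
Local Notation mu := (lebesgue_rV N : {measure set E -> \bar R}).
Local Notation leb := (@lebesgue_measure R).
Hypothesis N0 : (0 < N)%N.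
Variables (theta : R -> R) (delta alpha : R).
Hypothesis htheta : is_cutoff_profile theta.
Hypothesis delta0 : 0 < delta.
Variables (Omega : set E) (G : R -> E -> E -> R).
Hypothesis oO : open Omega.
Hypothesis hG : is_dirichlet_heat_kernel Omega G.
Variables (U : R -> E -> R) (Psi w0 : E -> R) (T0 A K T q : R) (k : nat).
Hypothesis hA : is_constant_A theta delta alpha Omega U Psi T0 A.
Hypothesis K0 : 0 < K.
Hypothesis k0 : (0 < k)%N.
Hypothesis T_gt0 : 0 < T.
Hypothesis T_le : T <= Num.min (1 / 4) T0.
Local Notation mcyl F := (measurable_fun (cylinder Omega T : set (RT * E)) (fun p => F p.1 p.2)).
Hypothesis calM_meas : forall w : R -> E -> R, mcyl w -> mcyl (calM alpha U Psi w).
Hypothesis q1 : q < 1.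
Hypothesis thq : forall s, 2 * q <= s -> 3 / 4 <= theta s.
Local Notation m := k.*2.
Let B := (1 + K `^ (alpha + 1)) * A.
Hypothesis rate_small : B * flow_rate delta m T <= K / 3.
Hypothesis gauss_small : forall t, 0 < t -> t <= T ->
  gauss (N := N) t ((1 - q) * a_ delta m) <= Num.sqrt t ^+ m.
Hypothesis mw0 : measurable_fun Omega w0.
Hypothesis bw0 : \forall y \ae mu, Omega y -> `|w0 y| <= K / 2 * \1_(far_set delta 0) y.
Local Notation Th := (Theta (N := N) theta delta K m).
Local Notation F := (duhamel alpha Omega U Psi G w0).
Local Notation M := (calM alpha U Psi).
Local Notation H := (hmaj (N := N) delta m).

Let A0 : 0 < A. Proof. by have [] := hA. Qed.
Let B0 : 0 < B. Proof. by rewrite mulr_gt0 // ltr_pwDl // powR_ge0. Qed.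
Let T4 : T <= 1 / 4. Proof. by move: T_le; rewrite le_min => /andP[]. Qed.
Let m2 : (2 <= m)%N. Proof. by rewrite -(doubleS 0) leq_double. Qed.

Let cylP t x : cylinder Omega T (t, x) -> [/\ 0 < t, t < T & Omega x].
Proof. by move=> [/=]; rewrite in_itv /= => /andP[? ?] ?. Qed.

Lemma Theta_scale (t : R) (x : E) : Th t x = K * Theta theta delta 1 m t x.
Proof. by rewrite /Theta mul1r. Qed.

Lemma calE_bounded (w : R -> E -> R) : mcyl w -> ae_cyl Omega T (fun t x => `|w t x| <= Th t x) ->
  calE theta delta Omega K m T w.
Proof.
move=> mw wT; split => //; split => //; apply: le_lt_trans (_ : (3 * K)%:E < _)%E; last exact: ltry.
apply: Lnorm_oo_le; first by rewrite mulr_ge0 // ltW.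
have := ae_cyl1 (S := fun t x => `|w t x| <= 3 * K) wT; apply => t x /cylP[t0 tT _] h.
by apply: le_trans h _; apply: Theta_le => //; [exact: ltW|exact: le_trans (ltW tT) T4].
Qed.

Lemma source_bounds (w z : R -> E -> R) (kap : R) : 0 <= kap ->
  calE theta delta Omega K m T w -> calE theta delta Omega K m T z ->
  ae_cyl Omega T (fun t x => `|w t x - z t x| <= kap * Th t x) ->
  ae_cyl Omega T (fun t x => `|M w t x| <= B * H t x) /\
  ae_cyl Omega T (fun t x => `|M w t x - M z t x| <= B * kap * H t x).
Proof.
move=> kap0 Ew Ez wz; have [_ hA2] := hA.
have h := hA2 K m T w z K0 m2 T_gt0 T_le Ew Ez; rewrite mulrC -/B in h.
split.
  apply: (ae_cyl1 h) => t x /cylP[t0 tT _] [h1 _]; apply: le_trans h1 _.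
  by rewrite ler_wpM2l ?(ltW B0) //; apply: hfun_le_hmaj => //; exact: ltW.
apply: (ae_cyl2 h wz) => t x /cylP[t0 tT _] [_ h2] h3; apply: le_trans h2 _.
have Th0 : 0 < Th t x by exact: Theta_gt0.
apply: ler_pM.
- by rewrite mulr_ge0 ?(ltW B0).
- by apply: hfun_ge0 => //; exact: ltW.
- rewrite ler_wpM2l ?(ltW B0) // normrM normfV (gtr0_norm Th0) ler_pdivrMr //.
- by apply: hfun_le_hmaj => //; exact: ltW.
Qed.

Let majorant (c : R) t x : 0 <= c -> 0 < t -> t < T -> Omega x ->
  let be := fun s : RT => c * ((1 + t) * s ^+ k.-1 + flow_cst theta delta m t x) in
  [/\ forall s, 0 < s < t -> measurable_fun Omega (fun y => c * H s y),
      forall s, 0 < s < t -> (heat_ge0 Omega G (t - s) x (fun y => (c * H s y)%R) <= (be s)%:E)%E,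
      measurable_fun [set` `]0%R, t[] be, forall s, 0 < s < t -> 0 <= be s &
      (\int[leb]_(s in [set` `]0%R, t[]) (be s)%:E <=
        (c * (flow_rate delta m T * Theta theta delta 1 m t x))%:E)%E].
Proof.
move=> c0 t0 tT Ox be; have t4 : t <= 1 / 4 by exact: le_trans (ltW tT) T4.
have mH s : measurable_fun Omega (H s) by exact: measurable_hmaj.
have bb0 s : 0 < s < t -> 0 <= (1 + t) * s ^+ k.-1 + flow_cst theta delta m t x.
  move=> /andP[s0 _]; rewrite addr_ge0 ?flow_cst_ge0 // mulr_ge0 ?exprn_ge0 ?(ltW s0) //.
  by rewrite addr_ge0 // ltW.
have mb : measurable_fun [set` `]0%R, t[]
    (fun s : RT => (1 + t) * s ^+ k.-1 + flow_cst theta delta m t x).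
  apply: measurable_funTS; apply: measurable_funD; last exact: measurable_cst.
  by apply: measurable_funM; [exact: measurable_cst|exact: measurable_funX].
split.
- by move=> s _; apply: measurable_funM; [exact: measurable_cst|exact: mH].
- move=> s /andP[s0 st]; rewrite (heat_ge0Z oO hG) ?subr_gt0 //; last first.
    by move=> y _; apply: (hmaj_ge0 htheta delta0); exact: ltW.
  rewrite /be EFinM; apply: lee_wpmul2l; first by rewrite lee_fin.
  by apply: (hmaj_heat N0 htheta delta0 oO hG q1 thq) => //; apply: gauss_small => //; exact: ltW.
- by apply: measurable_funM; [exact: measurable_cst|exact: mb].
- by move=> s st; rewrite mulr_ge0 // bb0.
rewrite /be; under eq_integral do rewrite EFinM.
rewrite ge0_integralZl_EFin //.
- rewrite [leRHS]EFinM; apply: lee_wpmul2l; first by rewrite lee_fin.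
  have h := hmaj_heat_integral htheta delta0 x k0 t0 t4; apply: (le_trans h).
  rewrite lee_fin ler_wpM2r //; last by apply: flow_rate_le => //; exact: ltW.
  exact: ltW (Theta_gt0 _ _ _ _ _ _).
- exact/measurable_EFinP.
Qed.

(** The bound on differences of sources has the form of the bound on the sources
    themselves, with the weighted distance [kap] as an additional factor, so that
    the smallness of the flow rate is also the ratio of a contraction. *)
Lemma duhamel_diff (w z : R -> E -> R) (kap : R) : 0 <= kap -> mcyl w -> mcyl z ->
  calE theta delta Omega K m T w -> calE theta delta Omega K m T z ->
  ae_cyl Omega T (fun t x => `|w t x - z t x| <= kap * Th t x) ->
  forall t x, cylinder Omega T (t, x) -> `|F w t x - F z t x| <= kap / 3 * Th t x.
Proof.
move=> kap0 mw mz Ew Ez wz t x /cylP[t0 tT Ox].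
have [s1 s2] := source_bounds kap0 Ew Ez wz.
have kz : ae_cyl Omega T (fun t x => `|z t x - w t x| <= kap * Th t x).
  by apply: (ae_cyl1 wz) => s y _; rewrite distrC.
have [s3 _] := source_bounds kap0 Ez Ew kz.
have [a1 a2 a3 a4 a5] := majorant (ltW B0) t0 tT Ox.
have Bk0 : 0 <= B * kap by rewrite mulr_ge0 // ltW.
have [b1 b2 b3 b4 b5] := majorant Bk0 t0 tT Ox.
have pd := potential_diff_bound oO hG (calM_meas mw) (calM_meas mz) t0 tT Ox s1 s3 s2 a1 a2 a3 a4 a5 b1 b2 b3 b4 b5.
have E : F w t x - F z t x = potential Omega G (M w) t x - potential Omega G (M z) t x.
  by rewrite /duhamel /potential opprD addrACA subrr add0r.
rewrite E; apply: (le_trans pd).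
have Th1 : 0 <= Theta theta delta 1 m t x by exact: ltW (Theta_gt0 _ _ _ _ _ _).
rewrite Theta_scale (_ : _ * _ * (_ * _) = kap * (B * flow_rate delta m T) * Theta theta delta 1 m t x); last by ring.
rewrite (_ : _ / _ * _ = kap * (K / 3) * Theta theta delta 1 m t x); last by ring.
by rewrite ler_wpM2r // ler_wpM2l.
Qed.

(** The datum is supported in [enorm y >= delta]: its flow is charged to the first
    cut-off at the price of the factor 4/3, which leaves a third of [Theta] to the
    Duhamel term. *)
Lemma linear_bound t x : cylinder Omega T (t, x) ->
  `|heat_semigroup Omega G t w0 x| <= 2 / 3 * Th t x.
Proof.
move=> /cylP[t0 tT Ox].
have mf : measurable_fun Omega (fun y => K / 2 * \1_(far_set delta 0) y : R).
  apply: measurable_funM; first exact: measurable_cst.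
  by apply: measurable_funTS; exact: measurable_indic (measurable_far _ 0).
apply: (heat_bound oO hG t0 Ox mw0 mf bw0 _).2.
have K2 : 0 <= K / 2 by rewrite divr_ge0 // ltW.
rewrite (heat_ge0Z oO hG) //; last first.
  by apply: measurable_funTS; exact: measurable_indic (measurable_far _ 0).
have h := far_heat N0 htheta delta0 oO hG q1 thq t0 (lexx t) Ox (leq0n m) (gauss_small t0 (ltW tT)).
apply: le_trans (lee_wpmul2l _ h) _; first by rewrite lee_fin.
rewrite -EFinM lee_fin /Theta powR_half_nat ?(ltW t0) //.
have c1 : chi theta delta 1 x <= sum_chi theta delta m t x.
  by apply: chi1_sum_chi => //; [exact: ltnW|exact: ltW].
have r0 : 0 <= Num.sqrt t ^+ m by rewrite exprn_ge0 // sqrtr_ge0.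
rewrite (_ : 2 / 3 * _ = K / 2 * (4 / 3 * (Num.sqrt t ^+ m + sum_chi theta delta m t x))); last by field.
by rewrite ler_wpM2l //; lra.
Qed.

Lemma duhamel_bound (w : R -> E -> R) : mcyl w -> calE theta delta Omega K m T w ->
  forall t x, cylinder Omega T (t, x) -> `|F w t x| <= Th t x.
Proof.
move=> mw Ew t x tx; have [t0 tT Ox] := cylP tx.
have ww : ae_cyl Omega T (fun t x => `|w t x - w t x| <= 0 * Th t x).
  by apply: ae_cylT => s y _; rewrite subrr normr0 mul0r.
have [s1 _] := source_bounds (lexx 0) Ew Ew ww.
have [a1 a2 a3 a4 a5] := majorant (ltW B0) t0 tT Ox.
have [_ h] := potential_bound oO hG (calM_meas mw) t0 tT Ox s1 a1 a2 a3 a4 a5.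
have l := linear_bound tx.
have Th1 : 0 <= Theta theta delta 1 m t x by exact: ltW (Theta_gt0 _ _ _ _ _ _).
have p : `|potential Omega G (M w) t x| <= 1 / 3 * Th t x.
  apply: le_trans h _; rewrite Theta_scale [leLHS]mulrA [leRHS]mulrA ler_wpM2r //.
  by apply: le_trans rate_small _; rewrite mulrC div1r.
by apply: le_trans (ler_normD _ _) _; apply: le_trans (lerD l p) _; rewrite -mulrDl; lra.
Qed.

Lemma duhamel_measurable (w : R -> E -> R) : mcyl w -> mcyl (F w).
Proof.
move=> mw; apply: measurable_funD; first exact: (heat_measurable oO hG mw0).
exact: (potential_measurable oO hG (calM_meas mw)).1.
Qed.

Let wn (n : nat) : R -> E -> R := iter n F (fun _ _ => 0).

Let wn_props n : mcyl (wn n) /\ forall t x, cylinder Omega T (t, x) -> `|wn n t x| <= Th t x.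
Proof.
elim: n => [|n [IH1 IH2]].
  split; first exact: measurable_cst.
  by move=> t x /cylP[t0 _ _] /=; rewrite normr0 ltW // Theta_gt0.
split; first exact: duhamel_measurable.
by apply: duhamel_bound => //; apply: calE_bounded => //; exact: ae_cylT.
Qed.

Let wn_calE n : calE theta delta Omega K m T (wn n).
Proof. by have [h1 h2] := wn_props n; apply: calE_bounded => //; exact: ae_cylT. Qed.

Let wn_cauchy n t x : cylinder Omega T (t, x) ->
  `|wn n.+1 t x - wn n t x| <= 2 * (3^-1) ^+ n * Th t x.
Proof.
elim: n t x => [|n IH] t x tx.
  have [_ h0] := wn_props 0; have [_ h1] := wn_props 1.
  apply: le_trans (ler_normB _ _) _; apply: le_trans (lerD (h1 _ _ tx) (h0 _ _ tx)) _.
  by rewrite expr0 mulr1 mulr_natl mulr2n.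
have r0 : 0 <= 2 * (3^-1) ^+ n :> R by rewrite mulr_ge0 // exprn_ge0.
rewrite (_ : 2 * _ ^+ n.+1 = 2 * (3^-1) ^+ n / 3); last by rewrite exprSr mulrA.
apply: (duhamel_diff r0 (wn_props n.+1).1 (wn_props n).1 (wn_calE _) (wn_calE _)) tx.
exact: ae_cylT.
Qed.

Let w_lim (t : R) (x : E) : R := limn (fun n => wn n t x).

Let w_limP t x : cylinder Omega T (t, x) ->
  (fun n => wn n t x) @ \oo --> w_lim t x /\
  forall n, `|w_lim t x - wn n t x| <= 3 * (3^-1) ^+ n * Th t x.
Proof.
move=> tx; have [l cl hl] := geometric_limit (fun n => wn_cauchy n tx).
by have -> : w_lim t x = l by apply: cvg_lim.
Qed.

(** Picard iteration from zero. The image of a function under [F] is estimated at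
    every point of the cylinder, so that the limit solves the equation everywhere. *)
Lemma fixed_point : exists w : R -> E -> R, [/\ mcyl w,
  forall t x, cylinder Omega T (t, x) -> `|w t x| <= Th t x,
  calE theta delta Omega K m T w &
  forall t x, cylinder Omega T (t, x) -> w t x = F w t x].
Proof.
have mw : mcyl w_lim.
  apply: (measurable_fun_cvg (h := fun n p => wn n p.1 p.2)) => [n|[t x] tx].
    exact: (wn_props n).1.
  exact: (w_limP tx).1.
have r0 n : 0 <= 3 * (3^-1) ^+ n :> R by rewrite mulr_ge0 // exprn_ge0.
have small (a c : R) : 0 <= c -> (forall n, a <= 6 * (3^-1) ^+ n * c) -> a <= 0.
  move=> c0 h; have g0 : (fun n => 6 * c * (3^-1) ^+ n) @ \oo --> (0 : R).
    have := @cvg_geometric R (6 * c) (3^-1); apply.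
    by rewrite ger0_norm ?invr_ge0 // invf_lt1 // ltr1n.
  apply/ler_addgt0Pr => e e0; have /cvgrPdist_lt/(_ e e0)[n _ Hn] := g0.
  rewrite add0r; apply: le_trans (h n) _; have := Hn n (leqnn n).
  rewrite /= sub0r normrN => hn; apply: le_trans (ltW hn); rewrite mulrAC; exact: ler_norm.
have wT t x : cylinder Omega T (t, x) -> `|w_lim t x| <= Th t x.
  move=> tx; have [t0 _ _] := cylP tx; rewrite -subr_le0; apply: (small _ (Th t x)).
    by rewrite ltW // Theta_gt0.
  move=> n; have h := (w_limP tx).2 n; have h2 := (wn_props n).2 t x tx.
  have Th0 : 0 <= Th t x by rewrite ltW // Theta_gt0.
  have e : w_lim t x = (w_lim t x - wn n t x) + wn n t x by rewrite subrK.
  have := ler_normD (w_lim t x - wn n t x) (wn n t x); rewrite -e.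
  have := mulr_ge0 (r0 n) Th0; lra.
have Ew : calE theta delta Omega K m T w_lim by apply: calE_bounded => //; exact: ae_cylT.
exists w_lim; split => // t x tx; have [t0 _ _] := cylP tx.
apply/eqP; rewrite -subr_eq0 -normr_le0; apply: (small _ (Th t x)).
  by rewrite ltW // Theta_gt0.
move=> n; have h1 := (w_limP tx).2 n.+1.
have h2 : `|F (wn n) t x - F w_lim t x| <= 3 * (3^-1) ^+ n / 3 * Th t x.
  apply: (duhamel_diff (r0 n)) => //; first exact: (wn_props n).1.
  by apply: ae_cylT => s y sy; rewrite distrC; exact: (w_limP sy).2.
have e : w_lim t x - F w_lim t x = (w_lim t x - wn n.+1 t x) + (F (wn n) t x - F w_lim t x).
  by rewrite addrA subrK.
rewrite e; apply: le_trans (ler_normD _ _) _; apply: le_trans (lerD h1 h2) _.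
have Th0 : 0 <= Th t x by rewrite ltW // Theta_gt0.
by rewrite exprS; exact: iterate_arith (mulr_ge0 (r0 n) Th0).
Qed.

(** Any two functions of the class are at weighted distance at most 2, which the
    contraction divides by 3 as often as desired. *)
Lemma fixed_point_unique (w z : R -> E -> R) :
  calE theta delta Omega K m T w -> calE theta delta Omega K m T z ->
  ae_cyl Omega T (fun t x => w t x = F w t x) ->
  ae_cyl Omega T (fun t x => z t x = F z t x) ->
  ae_cyl Omega T (fun t x => z t x = w t x).
Proof.
move=> Ew Ez wF zF; have [[mw _] wT] := Ew; have [[mz _] zT] := Ez.
have step n : ae_cyl Omega T (fun t x => `|z t x - w t x| <= 2 * (3^-1) ^+ n * Th t x).
  elim: n => [|n IH].
    apply: (ae_cyl2 wT zT) => t x _ h1 h2.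
    apply: le_trans (ler_normB _ _) _; apply: le_trans (lerD h2 h1) _.
    by rewrite expr0 mulr1 mulr_natl mulr2n.
  have r0 : 0 <= 2 * (3^-1) ^+ n :> R by rewrite mulr_ge0 // exprn_ge0.
  have h := duhamel_diff r0 mz mw Ez Ew IH.
  apply: (ae_cyl2 wF zF) => t x tx -> ->.
  by rewrite (_ : 2 * _ ^+ n.+1 = 2 * (3^-1) ^+ n / 3); [exact: h|rewrite exprSr mulrA].
have all := ae_foralln step; apply: (ae_and all all) => -[t x] /= h _ tx.
have [t0 _ _] := cylP tx.
apply/eqP; rewrite -subr_eq0 -normr_le0.
have g0 : (fun n => 2 * Th t x * (3^-1) ^+ n) @ \oo --> (0 : R).
  have := @cvg_geometric R (2 * Th t x) (3^-1); apply.
  by rewrite ger0_norm ?invr_ge0 // invf_lt1 // ltr1n.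
apply/ler_addgt0Pr => e e0; have /cvgrPdist_lt/(_ e e0)[n _ Hn] := g0.
rewrite add0r; apply: le_trans (h n tx) _; have := Hn n (leqnn n).
rewrite /= sub0r normrN => hn; apply: le_trans (ltW hn); rewrite mulrAC; exact: ler_norm.
Qed.

Lemma hmaj_bounded t (x : E) : 0 < t -> t < T -> H t x <= 2 + Lcst delta m * m%:R.
Proof.
move=> t0 tT; have t4 : t <= 1 / 4 by exact: le_trans (ltW tT) T4.
have s1 : Num.sqrt t <= 1 by have := sqrt_le_half t4; lra.
apply: lerD.
  have p0 := powR_ge0 t ((m%:R - 2) / 2).
  have p1 : t `^ ((m%:R - 2) / 2) <= 1.
    rewrite -natrB // powR_half_nat ?(ltW t0) //; apply: exprn_ile1 => //; exact: sqrtr_ge0.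
  by apply: le_trans (_ : (1 + t) * 1 <= _); [rewrite ler_wpM2l // addr_ge0 // ltW|lra].
rewrite ler_wpM2l ?(ltW (Lcst_gt0 delta0 m)) //.
have -> : m%:R = \sum_(1 <= j < m.+1) 1 :> R by rewrite sumr_const_nat subSS subn0.
apply: ler_sum => j _; rewrite -[leRHS]mulr1; apply: ler_pM => //.
by apply: exprn_ile1 => //; exact: sqrtr_ge0.
Qed.

(** [hfun] is bounded, its singularity at the origin being cut off; the kernel has
    mass at most one, so that integrating a bounded source in time gives a factor
    [t]. *)
Lemma source_bounded w : calE theta delta Omega K m T w -> exists2 C, 0 <= C &
  ae_cyl Omega T (fun t x => `|M w t x| <= C) /\
  (mcyl w -> forall t x, cylinder Omega T (t, x) ->
    `|F w t x - heat_semigroup Omega G t w0 x| <= C * t).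
Proof.
move=> Ew.
have ww : ae_cyl Omega T (fun t x => `|w t x - w t x| <= 0 * Th t x).
  by apply: ae_cylT => s y _; rewrite subrr normr0 mul0r.
have [s1 _] := source_bounds (lexx 0) Ew Ew ww.
pose C := B * (2 + Lcst delta m * m%:R).
have C0 : 0 <= C.
  by rewrite mulr_ge0 ?(ltW B0) // addr_ge0 // mulr_ge0 // ltW // Lcst_gt0.
have sC : ae_cyl Omega T (fun t x => `|M w t x| <= C).
  apply: (ae_cyl1 s1) => t x /cylP[t0 tT _] h; apply: le_trans h _.
  by rewrite ler_wpM2l ?(ltW B0) // hmaj_bounded.
exists C => //; split => // mw t x /cylP[t0 tT Ox].
have l1 : @lebesgue_measure R [set` `]0%R, t[] = t%:E.
  by rewrite lebesgue_measure_itv /= lte_fin t0 sube0.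
have int : (\int[leb]_(s in [set` `]0%R, t[]) C%:E <= (C * t)%:E)%E.
  rewrite (_ : integral _ _ _ = C%:E * leb [set` `]0%R, t[])%E; last exact: integral_cst.
  by rewrite l1.
have hC (s : R) : 0 < s < t ->
    (heat_ge0 Omega G (t - s) x (fun=> C * cst 1 x)%R <= C%:E)%E.
  move=> /andP[s0 st]; have ts : 0 < t - s by rewrite subr_gt0.
  have -> : (fun=> C * cst 1 x)%R = (fun y : E => C * cst 1 y)%R by [].
  rewrite (heat_ge0Z oO hG) //.
  apply: le_trans (lee_wpmul2l _ (kernel_mass oO hG ts Ox)) _; first by rewrite lee_fin.
  by rewrite mule1.
have sC' : ae_cyl Omega T (fun t x => `|M w t x| <= C * cst 1 x).
  by apply: (ae_cyl1 sC) => s y _; rewrite /= mulr1.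
have mc : measurable_fun Omega (fun y : E => C * cst 1 y).
  by apply: measurable_funM; exact: measurable_cst.
have [_] := potential_bound oO hG (g := fun _ y => C * cst 1 y) (be := fun=> C)
  (calM_meas mw) t0 tT Ox sC' (fun s _ => mc) hC (measurable_cst _) (fun s _ => C0) int.
by rewrite /duhamel addrAC subrr add0r.
Qed.

End fixed_point.

Theorem theorem4p1 (R : realType) (N : nat) (hN : (0 < N)%N)
  (theta : R -> R) (htheta : is_cutoff_profile theta)
  (alpha : R) (halpha : 0 < alpha)
  (Omega : set 'rV[R]_N) (hOmega : is_domain Omega)
  (G : R -> 'rV[R]_N -> 'rV[R]_N -> R) (hG : is_dirichlet_heat_kernel Omega G)
  (delta : R) (hdelta : 0 < delta)
  (hball : [set x : 'rV[R]_N | enorm x < delta] `<=` Omega)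
  (T0 A1 : R) (hT0 : 0 < T0) (hA1 : 0 <= A1)
  (U : R -> 'rV[R]_N -> R) (hU : is_C12 (cylinder Omega T0) U)
  (hUeq : forall t x, cylinder Omega T0 (t, x) ->
     derive1 (U ^~ x) t - laplacian (U t) x = `|U t x| `^ alpha * U t x)
  (hUbound : forall t x, cylinder Omega T0 (t, x) ->
     `|U t x| `^ alpha <= A1 * min_inv t x)
  (hgradU : forall t x, cylinder Omega T0 (t, x) -> delta < enorm x ->
     enorm (grad (U t) x) `^ alpha <= A1)
  (Psi : 'rV[R]_N -> R) (hPsi : is_C2_W2oo Psi)
  (hPsi01 : forall x, 0 <= Psi x <= 1)
  (hPsi1 : forall x, enorm x < delta -> Psi x = 1)
  (w0 : 'rV[R]_N -> R) (hw0 : in_L (lebesgue_rV N) +oo%E Omega w0)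
  (hw00 : \forall x \ae lebesgue_rV N, enorm x < delta -> w0 x = 0) :
  let M := calM alpha U Psi in
  let Phi := duhamel alpha Omega U Psi G w0 in
  let K := 2 * fine (Lnorm_on (lebesgue_rV N) +oo%E Omega w0) in
  (exists A, is_constant_A theta delta alpha Omega U Psi T0 A) /\
  forall A, is_constant_A theta delta alpha Omega U Psi T0 A ->
  exists (T : R) (w : R -> 'rV[R]_N -> R),
    [/\ 0 < T <= T0 /\ Linfty_cyl Omega T w,
        Linfty_cyl Omega T (M w),
        forall t x, cylinder Omega T (t, x) -> w t x = Phi w t x,
        0 < K -> exists m : nat,
          [/\ admissible N delta alpha K A m T,
              calE theta delta Omega K m T w &
              forall z, calE theta delta Omega K m T z ->
                ae_cyl Omega T (fun t x => z t x = Phi z t x) ->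
                ae_cyl Omega T (fun t x => z t x = w t x)] &
        exists C : R, forall t, 0 < t < T ->
          (Lnorm_on (lebesgue_rV N) +oo%E Omega
             (fun x => w t x - heat_semigroup Omega G t w0 x)%R
           <= (C * t)%:E)%E].
Proof.
move=> M Phi K.
have [oO _ _] := hOmega.
have [A exA] := exists_constant_A htheta halpha hdelta hA1 hUbound hgradU hPsi hPsi01 hPsi1.
split; [by exists A|move: A exA => _ _ A hA].
have [A0 _] := hA.
have [mw0 _] := hw0.
have w0K := Lnorm_oo_bound hw0.
have L0 : 0 <= fine (Lnorm_on (lebesgue_rV N) +oo%E Omega w0) by rewrite fine_ge0 // Lnorm_ge0.
(* if [w0] vanishes then [K = 0], and any positive constant serves instead *)
pose K' := if 0 < K then K else 1.
have K'0 : 0 < K' by rewrite /K'; case: ifP.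
have KK' : K <= K' by rewrite /K'; case: (ltP 0 K) => // /le_trans; apply.
have bw0 : \forall y \ae (lebesgue_rV N : {measure set 'rV[R]_N -> \bar R}),
    Omega y -> `|w0 y| <= K' / 2 * \1_(far_set delta 0) y.
  apply: (ae_and w0K hw00) => y h1 h2 Oy.
  rewrite indicE; case: (boolP (y \in _)) => [_|/negP yd].
    by rewrite mulr1; apply: le_trans (h1 Oy) _; move: KK'; rewrite /K; lra.
  rewrite h2 ?normr0 ?mulr_ge0 ?divr_ge0 ?(ltW K'0) // ltNge; apply/negP => dy.
  by apply: yd; rewrite inE /far_set /a_ /= expr0 invr1 mul1r.
have [q q1 thq] := profile_large htheta.
have [k [T [k0 /andP[Tp TT] rate gs adm]]] :=
  parameters_exist alpha hN hdelta K'0 A0 hT0 q1.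
have TT0 : T <= T0 by move: TT; rewrite le_min => /andP[].
have cM := calM_measurable alpha oO hU hPsi TT0.
have [w [mw _ Ew wF]] :=
  fixed_point hN htheta hdelta oO hG hA K'0 k0 Tp TT cM q1 thq rate gs mw0 bw0.
have [C C0 [MC dC]] := source_bounded htheta hdelta oO hG w0 hA K'0 k0 Tp TT cM Ew.
exists T, w; split.
- by split; [rewrite Tp|have [] := Ew].
- split; first exact: cM.
  by apply: le_lt_trans (Lnorm_oo_le C0 MC) _; exact: ltry.
- exact: wF.
- move=> K0; have KE : K' = K by rewrite /K' K0.
  rewrite KE in adm Ew; exists k.*2; split => // z Ez zF.
  rewrite -KE in Ew Ez.
  exact: (fixed_point_unique hN htheta hdelta oO hG hA K'0 k0 Tp TT cM q1 thq rate gs Ew Ez (ae_cylT wF) zF).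
exists C => t /andP[t0 tT]; apply: Lnorm_oo_le; first by rewrite mulr_ge0 // ltW.
apply: aeW => x Ox.
have tx : cylinder Omega T (t, x) by split => //=; rewrite in_itv /= t0.
by rewrite wF //; exact: dC.
Qed.
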